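(* For every integer $d\ge3$ there exists a constant $C_d>0$, depending only on $d$, such that for the random $d$-regular graph $G_n\in\mathrm{RRG}(n,d)$, with high probability (i.e. with probability tending to $1$ as $n\to\infty$), $$\mathbb{E}(\zeta_{slim}(G_n))\ \ge\ \tfrac12\log_{d-1}n-\tfrac32\log_{d-1}\log_{d-1}n-C_d \quad\text{and}\quad \mathbb{E}(\eta_{minsize}(G_n))\ \ge\ \tfrac12\log_{d-1}n-\tfrac32\log_{d-1}\log_{d-1}n-C_d .$$
   Context: $\mathrm{RRG}(n,d)$ is the uniformly random simple $d$-regular graph on $n$ labelled vertices ($nd$ even), conditioned on being connected (which holds with probability tending to 1). Let $G$ be a finite connected graph with shortest-path metric. A geodesic triangle $\Delta(x,y,z)$ is a choice of shortest paths $[x,y],[y,z],[z,x]$ (regarded as vertex sets). $\mathrm{slim}(\Delta(x,y,z))$ is the smallest $\delta\ge0$ such that every vertex on one side is at distance at most $\delta$ from the union of the other two sides (for each of the three sides). $\mathrm{minsize}(\Delta(x,y,z))=\min\mathrm{diam}\{x',y',z'\}$ over vertices $x'\in[y,z]$, $y'\in[z,x]$, $z'\in[x,y]$. A random triangle on $x,y,z$ is obtained by choosing each side independently and uniformly among all shortest paths between its endpoints. $\mathbb{E}(\zeta_{slim}(G))$ (resp. $\mathbb{E}(\eta_{minsize}(G))$) is the expectation of $\mathrm{slim}(\Delta(x,y,z))$ (resp. $\mathrm{minsize}(\Delta(x,y,z))$) over $x,y,z$ i.i.d. uniform vertices of $G$ and the random triangle; for random $G$ these are random variables depending on $G$. 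*)

(* Defs.v *)
From HB Require Import structures.
From mathcomp Require Import all_boot all_order all_algebra.
From mathcomp Require Import all_classical all_reals all_analysis.

Set Implicit Arguments.
Unset Strict Implicit.
Unset Printing Implicit Defensive.

Import Order.TTheory GRing.Theory Num.Theory.
Import numFieldNormedType.Exports.

Local Open Scope classical_set_scope.
Local Open Scope ring_scope.

(* A simple graph on T is given by its edge set: a set of 2-element subsets. *)
Definition simple_edges (T : finType) (E : {set {set T}}) : bool :=
  [forall e in E, #|e| == 2%N].

(* Irreflexive whenever E is simple, since [set x; x] is then not in E. *)
Definition adj (T : finType) (E : {set {set T}}) : rel T :=
  fun x y => [set x; y]%SET \in E.

Definition regular_graph (T : finType) (d : nat) (E : {set {set T}}) : bool :=
  [forall x : T, #|[set y | adj E x y]%SET| == d].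

Definition connected_graph (T : finType) (E : {set {set T}}) : bool :=
  [forall x : T, forall y : T, connect (adj E) x y].

(* The smallest k < N satisfying P, and N if there is none. *)
Definition least (N : nat) (P : pred nat) : nat := find P (iota 0 N).

(* A walk from x of length k is the k-tuple of its vertices after x.  In a
   connected graph the distance is less than #|T|; #|T| is the junk value for
   vertices in different components. *)
Definition gdist (T : finType) (e : rel T) (x y : T) : nat :=
  least #|T| (fun k => [exists p : k.-tuple T, path e x p && (last x p == y)]).

Definition geodesics (T : finType) (e : rel T) (x y : T) :
    {set (gdist e x y).-tuple T} :=
  [set p : (gdist e x y).-tuple T | path e x p && (last x p == y)]%SET.

Definition side (T : finType) (x : T) (k : nat) (p : k.-tuple T) : {set T} :=
  [set:: x :: p]%SET.

Definition diam (T : finType) (e : rel T) (A : {set T}) : nat :=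
  \max_(u in A) \max_(v in A) gdist e u v.

Definition within_dist (T : finType) (e : rel T) (k : nat) (A B : {set T}) :
    bool :=
  [forall u in A, exists v in B, (gdist e u v <= k)%N].

(* A, B, C are the three sides of a triangle.  Distances being natural
   numbers, the smallest real delta is a natural number; it is less than #|T|
   in a connected graph. *)
Definition slim (T : finType) (e : rel T) (A B C : {set T}) : nat :=
  least #|T| (fun k => [&& within_dist e k A (B :|: C)%SET,
                           within_dist e k B (C :|: A)%SET &
                           within_dist e k C (A :|: B)%SET]).

(* The neutral element #|T| exceeds every diameter in a connected graph, so
   this is the minimum over one vertex on each side. *)
Definition minsize (T : finType) (e : rel T) (A B C : {set T}) : nat :=
  \big[minn/#|T|]_(u in A) \big[minn/#|T|]_(v in B) \big[minn/#|T|]_(w in C)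
    diam e [set u; v; w]%SET.

(* Expectation of f under the uniform distribution on A. *)
Definition unif_mean (R : realType) (I : finType) (A : {set I}) (f : I -> R) :
    R :=
  (\sum_(a in A) f a) / #|A|%:R.

(* Expectation, over independent uniform vertices x, y, z and independent
   uniform geodesics, of a statistic of the sides [x,y], [y,z], [z,x]. *)
Definition triangle_mean (R : realType) (T : finType) (e : rel T)
    (f : {set T} -> {set T} -> {set T} -> nat) : R :=
  unif_mean [set: T]%SET (fun x =>
  unif_mean [set: T]%SET (fun y =>
  unif_mean [set: T]%SET (fun z =>
  unif_mean (geodesics e x y) (fun p =>
  unif_mean (geodesics e y z) (fun q =>
  unif_mean (geodesics e z x) (fun r =>
    (f (side x p) (side y q) (side z r))%:R)))))).

Definition mean_slim (R : realType) (T : finType) (E : {set {set T}}) : R :=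
  triangle_mean R (adj E) (slim (adj E)).

Definition mean_minsize (R : realType) (T : finType) (E : {set {set T}}) : R :=
  triangle_mean R (adj E) (minsize (adj E)).

Definition RRG (n d : nat) : {set {set {set 'I_n}}} :=
  [set E : {set {set 'I_n}} |
    [&& simple_edges E, regular_graph d E & connected_graph E]]%SET.

(* Probability of P under the uniform distribution on RRG n d. *)
Definition RRG_prob (R : realType) (n d : nat) (P : pred {set {set 'I_n}}) : R :=
  #|[set E in RRG n d | P E]%SET|%:R / #|RRG n d|%:R.

(* n tends to infinity along the values for which n * d is even. *)
Definition RRG_whp (R : realType) (d : nat)
    (P : forall n : nat, pred {set {set 'I_n}}) : Prop :=
  RRG_prob R d (P n) @[n --> within [set n | ~~ odd (n * d)] \oo] --> (1 : R).

Definition log (R : realType) (b x : R) : R := ln x / ln b.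

(* Main.v *)
(* Write b = d-1, let n be the number of vertices and l = log_b n, and let k be
   the integer part of l/2 - (3/2) log_b l.  If slim or minsize of a triangle is
   at most k, then, up to exchanging x and y, the side [x,y] has beyond its
   midpoint (seen from y) a vertex within distance k of the side [y,z].  Put
   c = d(x,y)/2 - k.  Either the two sides agree up to distance c from y, or
   their union with a path of length at most k contains a cycle.

   In any d-regular graph, counting the ends of the shorter side with the longer
   one fixed shows that the number of triples (x,y,z) with the first alternative
   is at most a constant times b^k times the sum of b^(d(y,z)/2) over all pairs
   (y,z), up to averaging over geodesics.  For the second alternative a switching (replace edges uv, ab by ua, vb) shows that prescribing
   one more edge costs a factor O(1/n), also among connected graphs, since one of
   the two orientations of ab keeps the graph connected; so a configuration with a
   cycle is rarer by n^(1/2-o(1)) than its count with one edge deleted.  The same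
   estimate shows that balls around most vertices grow like b^r.

   Finally P(d(y,z) >= 2r+4) = O(n b^(-2r)): if the balls of radius r+1 around y
   and z grow well and d(y,z) >= 2r+4, switching an edge that leaves the ball of
   radius r around y with one that leaves the ball around z gives a graph in which
   the new middle edge lies on all geodesics from y to z, hence is determined; few
   of these switchings disconnect the graph, because the parts they cut off would
   be disjoint and large.  So the sum of b^(d(y,z)/2) is O(n^(5/2)), exceptional
   triangles have expected frequency O(l^(-3/2)), and by Markov's inequality with
   high probability their frequency is at most 1/l, which costs only a constant
   in the mean. *)
Require Import Defs.
From HB Require Import structures.
From mathcomp Require Import all_boot all_order all_algebra.
From mathcomp Require Import zify ring lra.

Set Implicit Arguments.
Unset Strict Implicit.
Unset Printing Implicit Defensive.

(** * Distances and geodesics *)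

Lemma connect_invariant (T : finType) (e : rel T) (P : pred T) x y :
  (forall u v, e u v -> P u -> P v) -> connect e x y -> P x -> P y.
Proof.
move=> hP /connectP[p pp ->] {y}; elim: p x pp => //= v p IH x /andP[exv pp] Px.
by apply: IH pp (hP _ _ exv Px).
Qed.

Section Distance.
Variables (T : finType) (e : rel T).

Lemma gdist_le x p : path e x p -> gdist e x (last x p) <= size p.
Proof.
move=> pp; rewrite /gdist /least leqNgt; apply/negP => lt.
have hk : size p < #|T|.
  apply: leq_trans lt _.
  by rewrite -[X in _ <= X](size_iota 0); exact: find_size.
have := before_find 0 lt; rewrite nth_iota // add0n => /negbT/existsP[].
by exists (in_tuple p); rewrite /= pp eqxx.
Qed.

Lemma gdist_leP x y p : path e x p -> last x p = y -> gdist e x y <= size p.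
Proof. by move=> /gdist_le ? <-. Qed.

Lemma gdist_path x y : connect e x y ->
  exists p, [/\ path e x p, last x p = y & size p = gdist e x y].
Proof.
case/connectP=> p0 /shortenP[p pp up _] ->.
(* A walk without repeated vertices has fewer than [#|T|] steps, so the bounded search in [gdist]
   does not end in its junk value. *)
have lt : size p < #|T| by have := max_card [in x :: p]; rewrite (card_uniqP up).
set P : pred nat := fun k => [exists q : k.-tuple T, path e x q && (last x q == last x p)].
have hP : has P (iota 0 #|T|).
  apply/hasP; exists (size p); first by rewrite mem_iota.
  by apply/existsP; exists (in_tuple p); rewrite /= pp eqxx.
have hf : find P (iota 0 #|T|) < #|T| by move: hP; rewrite has_find size_iota.
have := nth_find 0 hP; rewrite nth_iota // add0n => /existsP[q /andP[pq /eqP lq]].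
by exists q; rewrite pq lq size_tuple.
Qed.

Lemma gdistxx x : gdist e x x = 0.
Proof. by apply/eqP; rewrite -leqn0; exact: (@gdist_leP x x [::]). Qed.

Lemma geodesic_uniq x p : path e x p -> size p = gdist e x (last x p) -> uniq (x :: p).
Proof.
move=> pp sz; case/shortenP: (pp) sz => p' pp' up' sub sz.
apply: (leq_size_uniq up'); last by rewrite /= ltnS sz gdist_le.
by move=> z; rewrite !inE => /orP[->//|/sub ->]; rewrite orbT.
Qed.

Lemma last_take x (p : seq T) i : i <= size p -> last x (take i p) = nth x (x :: p) i.
Proof.
case: i => [|i] hi; first by rewrite take0.
by rewrite (last_nth x) size_take_min (minn_idPl hi) /= nth_take.
Qed.

Lemma path_drop x p i : path e x p -> path e (nth x (x :: p) i) (drop i p).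
Proof.
move=> pp; case: (leqP i (size p)) => hi; last by rewrite drop_oversize // ltnW.
by move: pp; rewrite -{1}(cat_take_drop i p) cat_path last_take // => /andP[].
Qed.

Lemma path_take x p i : path e x p -> path e x (take i p).
Proof. by rewrite -{1}(cat_take_drop i p) cat_path => /andP[]. Qed.

Lemma last_drop x (p : seq T) i : i <= size p ->
  last (nth x (x :: p) i) (drop i p) = last x p.
Proof.
by move=> hi; rewrite -[in RHS](cat_take_drop i p) last_cat last_take.
Qed.

Lemma path_adj x p i : path e x p -> i < size p ->
  e (nth x (x :: p) i) (nth x (x :: p) i.+1).
Proof. by move=> /(pathP x) h hi; exact: h. Qed.

Hypothesis conn : forall x y, connect e x y.

Lemma gdist_triangle x y z : gdist e x z <= gdist e x y + gdist e y z.
Proof.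
have [p [pp lp <-]] := gdist_path (conn x y).
have [q [pq lq <-]] := gdist_path (conn y z).
rewrite -size_cat; apply: gdist_leP; first by rewrite cat_path pp lp pq.
by rewrite last_cat lp.
Qed.

Lemma gdist_adj x y z : e y z -> gdist e x z <= (gdist e x y).+1.
Proof.
move=> eyz; apply: leq_trans (gdist_triangle x y z) _.
by rewrite -addn1 leq_add2l (@gdist_leP y z [:: z]) //= eyz.
Qed.

Lemma gdist_eq0 x y : (gdist e x y == 0) = (x == y).
Proof.
apply/eqP/eqP => [h|->]; last exact: gdistxx.
by have [[|a p] [_ lp]] := gdist_path (conn x y); rewrite h.
Qed.

Lemma gdist_parent x y : x != y ->
  exists2 z, e z y & gdist e x y = (gdist e x z).+1.
Proof.
move=> nxy; have [p [pp lp sz]] := gdist_path (conn x y).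
case/lastP: p pp lp sz => [_ /= lp|p z]; first by rewrite lp eqxx in nxy.
rewrite rcons_path last_rcons size_rcons => /andP[pp ez] zy sz.
exists (last x p); rewrite -zy // zy; apply/eqP.
rewrite eqn_leq -{1}zy gdist_adj //= -sz ltnS.
exact: gdist_le.
Qed.

Lemma geodesic_prefix x p i : path e x p -> size p = gdist e x (last x p) -> i <= size p ->
  gdist e x (nth x (x :: p) i) = i.
Proof.
move=> pp sz hi; apply/eqP; rewrite eqn_leq; apply/andP; split.
  rewrite -(last_take x hi); apply: leq_trans (gdist_le (path_take i pp)) _.
  by rewrite size_take_min geq_minl.
have := gdist_triangle x (nth x (x :: p) i) (last x p).
have := gdist_leP (path_drop i pp) (last_drop x hi).
rewrite size_drop -sz; lia.
Qed.

Lemma geodesic_suffix x p i : path e x p -> size p = gdist e x (last x p) -> i <= size p ->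
  gdist e (nth x (x :: p) i) (last x p) = size p - i.
Proof.
move=> pp sz hi; apply/eqP; rewrite eqn_leq; apply/andP; split.
  by rewrite -size_drop; apply: gdist_leP (path_drop i pp) (last_drop x hi).
have := gdist_triangle x (nth x (x :: p) i) (last x p).
rewrite (geodesic_prefix pp sz hi) -sz; lia.
Qed.

Hypothesis sym : symmetric e.

Lemma gdist_sym x y : gdist e x y = gdist e y x.
Proof.
suff h u v : gdist e u v <= gdist e v u by apply/eqP; rewrite eqn_leq !h.
have [p [pp lp <-]] := gdist_path (conn v u).
have -> : size p = size (rev (belast v p)) by rewrite size_rev size_belast.
apply: gdist_leP.
  by rewrite -lp rev_path; rewrite (eq_path (e' := e)).
by case: p pp lp => [//|w p] _ _ /=; rewrite rev_cons last_rcons.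
Qed.

End Distance.

(** * Counting paths in regular graphs *)

Lemma card_bigcup_le (I T : finType) (P : pred I) (F : I -> {set T}) :
  #|\bigcup_(i | P i) F i| <= \sum_(i | P i) #|F i|.
Proof.
elim/big_rec2: _ => [|i n A _ le]; first by rewrite cards0.
by apply: leq_trans (leq_card_setU _ _).1 _; rewrite leq_add2l.
Qed.

Definition RG (T : finType) (d : nat) : {set {set {set T}}} :=
  [set E : {set {set T}} |
    [&& simple_edges E, regular_graph d E & connected_graph E]].

Definition nbrs (T : finType) (E : {set {set T}}) (x : T) : {set T} :=
  [set y | adj E x y].

Definition sphere (T : finType) (E : {set {set T}}) (r : nat) (x : T) : {set T} :=
  [set y | gdist (adj E) x y == r].

Lemma adj_sym (T : finType) (E : {set {set T}}) : symmetric (adj E).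
Proof. by move=> x y; rewrite /adj setUC. Qed.

Lemma adj_irrefl (T : finType) (E : {set {set T}}) x : simple_edges E -> ~~ adj E x x.
Proof.
by move=> /forall_inP sE; apply/negP => /sE; rewrite setUid cards1.
Qed.

Section Graph.
Variables (T : finType) (d : nat) (E : {set {set T}}).
Hypothesis hE : E \in RG T d.

Let sE : simple_edges E. Proof. by move: hE; rewrite inE => /and3P[]. Qed.

Lemma adj_neq x y : adj E x y -> x != y.
Proof. by apply: contraTN => /eqP->; exact: adj_irrefl. Qed.

Lemma card_nbrs x : #|nbrs E x| = d.
Proof. by move: hE; rewrite inE => /and3P[_ /forallP/(_ x)/eqP]. Qed.

Lemma RG_connect x y : connect (adj E) x y.
Proof. by move: hE; rewrite inE => /and3P[_ _ /forallP/(_ x)/forallP/(_ y)]. Qed.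

(** The vertex before the current one is excluded at every step, which leaves [d.-1] neighbours; [a]
    plays this role for [x]. *)
Lemma card_avoiding_paths r a x : adj E x a ->
  #|[set p : r.-tuple T | path (adj E) x p && uniq [:: a, x & p]]| <= d.-1 ^ r.
Proof.
elim: r a x => [|r IH] a x xa.
  by rewrite expn0 (leq_trans (max_card _)) // card_tuple expn0.
set S := [set p : r.+1.-tuple T | _].
pose F v := (@cons_tuple r T v) @: [set p : r.-tuple T | path (adj E) v p && uniq [:: x, v & p]].
have sub : S \subset \bigcup_(v in nbrs E x :\ a) F v.
  apply/subsetP => p; rewrite inE; case/tupleP: p => v p /=.
  move=> /andP[/andP[xv pp] /andP[ha /and3P[h1 h2 h3]]].
  apply/bigcupP; exists v.
    by rewrite !inE xv andbT; apply: contraNneq ha => ->; rewrite !inE eqxx orbT.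
  by apply: imset_f; rewrite inE pp /= h2 h3 !andbT; exact: h1.
apply: leq_trans (subset_leq_card sub) _; apply: leq_trans (card_bigcup_le _ _) _.
have -> : d.-1 ^ r.+1 = \sum_(v in nbrs E x :\ a) d.-1 ^ r.
  rewrite sum_nat_const expnS; congr (_ * _).
  by have := cardsD1 a (nbrs E x); rewrite card_nbrs inE xa => ->.
apply: leq_sum => v; rewrite !inE => /andP[_ xv].
by apply: leq_trans (leq_imset_card _ _) (IH _ _ _); rewrite adj_sym.
Qed.

Definition upaths (x : T) (r : nat) : {set r.-tuple T} :=
  [set p : r.-tuple T | path (adj E) x p && uniq (x :: p)].

Hypothesis d3 : 3 <= d.

(** Only the first step has [d] choices, and d <= 2(d-1). *)
Lemma card_upaths x r : #|upaths x r| <= 2 * d.-1 ^ r.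
Proof.
case: r => [|r].
  by rewrite expn0 (leq_trans (max_card _)) // card_tuple expn0.
pose F v := (@cons_tuple r T v) @: [set p : r.-tuple T | path (adj E) v p && uniq [:: x, v & p]].
have sub : upaths x r.+1 \subset \bigcup_(v in nbrs E x) F v.
  apply/subsetP => p; rewrite inE; case/tupleP: p => v p /=.
  move=> /andP[/andP[xv pp] /and3P[h1 h2 h3]].
  apply/bigcupP; exists v; first by rewrite !inE xv.
  by apply: imset_f; rewrite inE pp /= h2 h3 !andbT; exact: h1.
apply: leq_trans (subset_leq_card sub) _; apply: leq_trans (card_bigcup_le _ _) _.
apply: (@leq_trans (\sum_(v in nbrs E x) d.-1 ^ r)); last first.
  by rewrite sum_nat_const card_nbrs expnS mulnA leq_mul2r; apply/orP; right; lia.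
apply: leq_sum => v; rewrite !inE => xv.
by apply: leq_trans (leq_imset_card _ _) (card_avoiding_paths _ _); rewrite adj_sym.
Qed.

Lemma geodesicP x y : exists p : (gdist (adj E) x y).-tuple T,
  [/\ path (adj E) x p, last x p = y & uniq (x :: p)].
Proof.
have [p [pp lp /eqP sz]] := gdist_path (RG_connect x y).
exists (Tuple sz); split=> //=; apply: geodesic_uniq pp _.
by rewrite lp (eqP sz).
Qed.

Lemma card_sphere x r : #|sphere E r x| <= 2 * d.-1 ^ r.
Proof.
apply: leq_trans (card_upaths x r).
apply: leq_trans (leq_imset_card (fun p : r.-tuple T => last x p) _).
apply: subset_leq_card; apply/subsetP => y; rewrite inE => /eqP dxy.
have := geodesicP x y; rewrite dxy => -[p [pp lp up]].
by apply/imsetP; exists p => //; rewrite inE pp up.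
Qed.

Lemma card_ball x r : #|[set y | gdist (adj E) x y <= r]| <= 4 * d.-1 ^ r.
Proof.
have sub : [set y | gdist (adj E) x y <= r] \subset \bigcup_(i < r.+1) sphere E i x.
  apply/subsetP => y; rewrite inE -ltnS => lt.
  by apply/bigcupP; exists (Ordinal lt); rewrite // inE.
apply: leq_trans (subset_leq_card sub) _; apply: leq_trans (card_bigcup_le _ _) _.
apply: (@leq_trans (\sum_(i < r.+1) 2 * d.-1 ^ i)).
  by apply: leq_sum => i _; exact: card_sphere.
rewrite -big_distrr /= (_ : 4 = 2 * 2)// -mulnA leq_mul2l /=.
elim: r {sub} => [|r IH]; first by rewrite big_ord1 expn0.
rewrite big_ord_recr /=; have : 2 * d.-1 ^ r <= d.-1 ^ r.+1.
  by rewrite expnS leq_mul2r; apply/orP; right; lia.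
by move: IH; lia.
Qed.

End Graph.

(** * Switchings *)

Lemma set2_eq (T : finType) (x y u v : T) :
  ([set x; y] == [set u; v]) = (x == u) && (y == v) || (x == v) && (y == u).
Proof.
apply/eqP/orP => [h|[/andP[/eqP-> /eqP->]|/andP[/eqP-> /eqP->]]] //; last exact: setUC.
have hx : x \in [set u; v] by rewrite -h !inE eqxx.
have hy : y \in [set u; v] by rewrite -h !inE eqxx orbT.
have hu : u \in [set x; y] by rewrite h !inE eqxx.
have hv : v \in [set x; y] by rewrite h !inE eqxx orbT.
move: hx hy hu hv; rewrite !inE (eq_sym u) (eq_sym u y) (eq_sym v) (eq_sym v y).
by case: (x == u); case: (x == v); case: (y == u); case: (y == v) => //=; auto.
Qed.

Section Switching.
Variable T : finType.
Implicit Types (E : {set {set T}}) (u v a b x y : T).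

Definition cut E u v a b : {set {set T}} := E :\: [set [set u; v]; [set a; b]].

Definition switch E u v a b : {set {set T}} :=
  cut E u v a b :|: [set [set u; a]; [set v; b]].

Definition switchable E u v a b :=
  [&& adj E u v, adj E a b, ~~ adj E u a, ~~ adj E v b, u != a & v != b].

Lemma adj_cut E u v a b x y : adj (cut E u v a b) x y =
  [&& [set x; y] != [set u; v], [set x; y] != [set a; b] & adj E x y].
Proof. by rewrite /adj !inE negb_or -andbA. Qed.

Lemma adj_switch E u v a b x y : adj (switch E u v a b) x y =
  [|| adj (cut E u v a b) x y, [set x; y] == [set u; a] | [set x; y] == [set v; b]].
Proof. by rewrite /adj !inE. Qed.

Lemma cutC E u v a b : cut E u v a b = cut E a b u v.
Proof. by rewrite /cut (setUC [set [set u; v]]). Qed.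

Lemma cutCC E u v a b : cut E u v a b = cut E v u b a.
Proof. by rewrite /cut (setUC [set u]) (setUC [set a]). Qed.

Lemma cut_flip E u v a b : cut E u v a b = cut E u v b a.
Proof. by rewrite /cut (setUC [set a]). Qed.

Lemma switchC E u v a b : switch E u v a b = switch E a b u v.
Proof. by rewrite /switch cutC (setUC [set u]) (setUC [set v]). Qed.

Lemma switchCC E u v a b : switch E u v a b = switch E v u b a.
Proof. by rewrite /switch cutCC (setUC [set [set u; a]]). Qed.

Lemma switchableC E u v a b : switchable E u v a b = switchable E a b u v.
Proof.
rewrite /switchable (adj_sym E a u) (adj_sym E b v) (eq_sym a u) (eq_sym b v).
by rewrite andbCA.
Qed.

Lemma switchableCC E u v a b : switchable E u v a b = switchable E v u b a.
Proof.
rewrite /switchable (adj_sym E v u) (adj_sym E b a).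
do 2 congr (_ && _); rewrite andbCA; do 2 congr (_ && _); exact: andbC.
Qed.

(** The remaining coincidences are excluded too: u = b would turn the edge [ab] into the absent
    [ua], and v = a would turn it into the absent [vb]. *)
Lemma switchable_neq E u v a b : simple_edges E -> switchable E u v a b ->
  [/\ u != v, a != b, u != b & v != a].
Proof.
move=> sE /and5P[uv ab ua vb /andP[nua nvb]].
have irr x : ~~ adj E x x by exact: adj_irrefl.
split.
- by apply: contraTneq uv => ->.
- by apply: contraTneq ab => ->.
- by apply: contraNneq ua => ->; rewrite adj_sym.
- by apply: contraNneq vb => ->.
Qed.

Lemma nbrs_switch E u v a b : simple_edges E -> switchable E u v a b ->
  nbrs (switch E u v a b) u = a |: (nbrs E u :\ v).
Proof.
move=> sE sw; have [uv ab ub va] := switchable_neq sE sw.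
case/and5P: sw => _ _ _ _ /andP[ua vb].
apply/setP => y; rewrite !inE adj_switch adj_cut !set2_eq eqxx /=.
rewrite (negPf uv) (negPf ua) (negPf ub) /=.
by case: (y == a) => /=; rewrite ?orbT ?orbF.
Qed.

Lemma card_nbrs_switch E u v a b : simple_edges E -> switchable E u v a b ->
  #|nbrs (switch E u v a b) u| = #|nbrs E u|.
Proof.
move=> sE sw; rewrite nbrs_switch //; case/and5P: sw => uv ab ua vb _.
by rewrite cardsU1 !inE (negPf ua) andbF /= (cardsD1 v (nbrs E u)) inE uv.
Qed.

Lemma switch_simple E u v a b : simple_edges E -> switchable E u v a b ->
  simple_edges (switch E u v a b).
Proof.
move=> sE /and5P[_ _ _ _ /andP[ua vb]]; apply/forall_inP => e; rewrite !inE.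
case/or3P => [/andP[_ he]|/eqP->|/eqP->]; last 2 first.
- by rewrite cards2 ua.
- by rewrite cards2 vb.
by move/forall_inP: sE; apply.
Qed.

Lemma switch_regular d E u v a b : simple_edges E -> switchable E u v a b ->
  regular_graph d E -> regular_graph d (switch E u v a b).
Proof.
move=> sE sw /forallP rE; apply/forallP => x; apply/eqP.
rewrite -(eqP (rE x)) -/(nbrs E x) -/(nbrs (switch E u v a b) x).
have [->|xu] := eqVneq x u; first exact: card_nbrs_switch.
have [->|xv] := eqVneq x v.
  by rewrite switchCC card_nbrs_switch // -switchableCC.
have [->|xa] := eqVneq x a.
  by rewrite switchC card_nbrs_switch // -switchableC.
have [->|xb] := eqVneq x b.
  by rewrite switchC switchCC card_nbrs_switch // -switchableCC -switchableC.
apply: eq_card => y; rewrite !inE adj_switch adj_cut !set2_eq.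
by rewrite (negPf xu) (negPf xv) (negPf xa) (negPf xb) !orbF.
Qed.

(** The new graph and the four vertices determine the old graph; this makes the switching maps below
    injective. *)
Lemma switchK E u v a b : switchable E u v a b ->
  switch (switch E u v a b) u a v b = E.
Proof.
case/and5P => uv ab ua vb _; apply/setP => e; rewrite !inE.
have [->|_] := eqVneq e [set u; v]; first by rewrite /= orbT -/(adj E u v) uv.
have [->|_] := eqVneq e [set a; b]; first by rewrite /= !orbT -/(adj E a b) ab.
rewrite /= !orbF.
have [->|_] := eqVneq e [set u; a]; first by rewrite -/(adj E u a) (negPf ua).
have [->|_] := eqVneq e [set v; b]; first by rewrite -/(adj E v b) (negPf vb).
by rewrite ?orbF ?andbT.
Qed.

Lemma adj_csym E : connect_sym (adj E).
Proof. exact: sym_connect_sym (@adj_sym T E). Qed.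

Lemma sub_cut_switch E u v a b : subrel (adj (cut E u v a b)) (adj (switch E u v a b)).
Proof. by move=> x y; rewrite adj_switch => ->. Qed.

(** The new edges join [u] to [a] and [v] to [b], so a single link between these two pairs that
    survives the cut joins all four ends, and both removed edges are bypassed. *)
Lemma switch_connected E u v a b : connected_graph E ->
  [|| connect (adj (cut E u v a b)) u v, connect (adj (cut E u v a b)) u b,
      connect (adj (cut E u v a b)) a v | connect (adj (cut E u v a b)) a b] ->
  connected_graph (switch E u v a b).
Proof.
move=> /forallP cE; set E0 := cut _ _ _ _ _; set E' := switch _ _ _ _ _ => hc.
have up x y : connect (adj E0) x y -> connect (adj E') x y.
  by apply: connect_sub => {x y} x y /sub_cut_switch ?; exact: connect1.
have cu : connect (adj E') u a by apply: connect1; rewrite adj_switch eqxx orbT.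
have cv : connect (adj E') v b by apply: connect1; rewrite adj_switch eqxx !orbT.
have cC := adj_csym E'.
have huv : connect (adj E') u v.
  case/or4P: hc => /up h; first by [].
  - by apply: connect_trans h _; rewrite cC.
  - exact: connect_trans cu h.
  - by apply: connect_trans cu (connect_trans h _); rewrite cC.
have hb := connect_trans huv cv.
have all x : connect (adj E') u x.
  move/forallP/(_ x): (cE u) => h.
  apply: (@connect_invariant _ _ (connect (adj E') u) _ _ _ h) => // {h}x y xy cx.
    have [xy'|] := boolP (adj E0 x y).
    by apply: connect_trans cx (up _ _ (connect1 xy')).
  rewrite adj_cut xy andbT negb_and !negbK !set2_eq => /orP[]/orP[]/andP[_ /eqP->] //.
apply/forallP => x; apply/forallP => y.
by apply: connect_trans (all y); rewrite cC.
Qed.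

(* If neither orientation of the second edge works, then no vertex of the
   first edge is linked to a vertex of the second one after deletion of both,
   although the graph was connected. *)
Lemma switch_connected_or E u v a b : connected_graph E ->
  connected_graph (switch E u v a b) || connected_graph (switch E u v b a).
Proof.
move=> cE; apply/norP => -[/negP h1 /negP h2].
have {}h1 := contra_not (switch_connected cE) h1.
have {}h2 := contra_not (switch_connected cE) h2.
move/negP: h1; move/negP: h2; rewrite -(cut_flip E u v a b).
set E0 := cut _ _ _ _ _; rewrite !negb_or => /and4P[uv ua bv ba] /and4P[_ ub av ab].
have cC := adj_csym E0.
have h x : connect (adj E0) u x || connect (adj E0) v x.
  move/forallP/(_ u)/forallP/(_ x): cE => h.
  pose P x := connect (adj E0) u x || connect (adj E0) v x.
  apply: (@connect_invariant _ _ P _ _ _ h) => [{h}x y xy|]; last by rewrite /P connect0.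
  rewrite /P => hx.
  have [xy'|] := boolP (adj E0 x y).
    by case/orP: hx => hx; rewrite (connect_trans hx (connect1 xy')) ?orbT.
  rewrite adj_cut xy andbT negb_and !negbK !set2_eq.
  case/orP=> /orP[]/andP[/eqP ex /eqP ey]; rewrite {}ey ?connect0 ?orbT //.
  - by move: hx; rewrite ex (negPf ua) cC (negPf av).
  - by move: hx; rewrite ex (negPf ub) cC (negPf bv).
by move: (h a); rewrite (negPf ua) cC (negPf av).
Qed.

Lemma switch_RG d E u v a b : E \in RG T d -> switchable E u v a b ->
  (switch E u v a b \in RG T d) = connected_graph (switch E u v a b).
Proof.
rewrite !inE => /and3P[sE rE cE] sw.
by rewrite switch_simple // switch_regular.
Qed.

End Switching.

(** * The probability of an additional edge *)

Lemma card_dep_pairs (A B : finType) (S : {set A}) (F : A -> {set B}) :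
  #|[set p : A * B | (p.1 \in S) && (p.2 \in F p.1)]| = \sum_(a in S) #|F a|.
Proof.
rewrite -sum1_card (eq_bigl _ _ (in_set _)).
rewrite -(pair_big_dep (mem S) (fun a b => b \in F a) (fun _ _ => 1)) /=.
by apply: eq_bigr => a _; rewrite sum1_card.
Qed.

Lemma card_dep_le (A B : finType) (S : {set A * B}) (S1 : {set A}) c :
  (forall p, p \in S -> p.1 \in S1) ->
  (forall a, a \in S1 -> #|[set b | (a, b) \in S]| <= c) ->
  #|S| <= #|S1| * c.
Proof.
move=> h1 h2.
have sub : S \subset [set p | (p.1 \in S1) && (p.2 \in [set b | (p.1, b) \in S])].
  by apply/subsetP => p pS; rewrite !inE h1 //= -surjective_pairing.
apply: leq_trans (subset_leq_card sub) _.
by rewrite (card_dep_pairs _ (fun a => [set b | (a, b) \in S])) -sum_nat_const leq_sum.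
Qed.

Lemma card_set2_in (T : finType) (F : seq {set T}) :
  #|[set p : T * T | [set p.1; p.2] \in F]| <= 2 * size F.
Proof.
elim: F => [|f F IH]; first by rewrite (eq_card0 (A := _)) // => p; rewrite !inE.
have sub : [set p : T * T | [set p.1; p.2] \in f :: F] \subset
    [set p | [set p.1; p.2] == f] :|: [set p | [set p.1; p.2] \in F].
  by apply/subsetP => p; rewrite !inE.
apply: leq_trans (subset_leq_card sub) _; apply: leq_trans (leq_card_setU _ _).1 _.
rewrite /= mulnS leq_add //.
have [->|[[a b]]] := set_0Vmem [set p : T * T | [set p.1; p.2] == f].
  by rewrite cards0.
rewrite inE /= => /eqP <-; apply: (@leq_trans #|[set (a, b); (b, a)]|).
  by apply/subset_leq_card/subsetP => -[x y]; rewrite !inE /= set2_eq !xpair_eqE.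
by rewrite cards2; case: (_ != _).
Qed.

Lemma card_adj_pairs (T : finType) d (E : {set {set T}}) (W : {set T}) : E \in RG T d ->
  #|[set p : T * T | (p.1 \in W) && adj E p.1 p.2]| = #|W| * d.
Proof.
move=> hE; rewrite -sum_nat_const -(eq_bigr _ (fun x _ => card_nbrs hE x)).
by rewrite -card_dep_pairs; apply: eq_card => p; rewrite !inE.
Qed.

Lemma card_swap (T : finType) (S : {set T * T}) :
  #|[set p | (p.2, p.1) \in S]| = #|S|.
Proof.
have swapI : injective (fun p : T * T => (p.2, p.1)) by move=> [a b] [a' b'] [-> ->].
rewrite -(card_imset S swapI); apply: eq_card => -[a b]; rewrite inE /=.
apply/idP/imsetP => [h|[[c e] h [-> ->]]] //; by exists (b, a).
Qed.

Section ForcedEdge.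
Variables (T : finType) (d : nat) (u v : T) (F : seq {set T}).
Hypothesis uvF : [set u; v] \notin F.
Hypothesis large : #|T| + 2 * size F + 4 * d * d.+1 <= #|T| * d.

Let W E := (u |: nbrs E u) :|: (v |: nbrs E v).

(** The candidates for the second edge of a switching at [uv], with orientation. Away from the
    closed neighbourhoods of [u] and [v] both orientations are switchable, and outside [F] no
    prescribed edge is lost. *)
Let pairs E : {set T * T} := [set p : T * T | [&& adj E p.1 p.2, [set p.1; p.2] \notin F,
  p.1 \notin W E & p.2 \notin W E]].

Let card_W E : E \in RG T d -> #|W E| <= 2 * d.+1.
Proof.
move=> hE; apply: leq_trans (leq_card_setU _ _).1 _.
have h x : #|x |: nbrs E x| <= d.+1.
  by rewrite cardsU1 (card_nbrs hE) -add1n leq_add2r leq_b1.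
by rewrite mul2n -addnn leq_add.
Qed.

(** Of the n d oriented edges at most 2|F| lie in [F] and at most 4d(d+1) have an end in [W E]; by
    [large], n of them remain. *)
Let card_pairs E : E \in RG T d -> #|T| <= #|pairs E|.
Proof.
move=> hE.
have tot := card_adj_pairs [set: T] hE.
have wl := card_adj_pairs (W E) hE.
pose L := [set p : T * T | (p.1 \in W E) && adj E p.1 p.2].
have wr := card_swap L.
have sub : [set p : T * T | (p.1 \in [set: T]) && adj E p.1 p.2] \subset
  pairs E :|: [set p : T * T | [set p.1; p.2] \in F] :|: (L :|: [set p | (p.2, p.1) \in L]).
  apply/subsetP => p; rewrite !in_setU !in_set /=.
  rewrite (adj_sym E p.2); case: (adj E p.1 p.2) => //= _.
  case: ([set p.1; p.2] \in F); rewrite ?orbT //= orbF.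
  by rewrite !andbT -negb_or orNb.
have := subset_leq_card sub; rewrite tot cardsT => h.
have h1 := (leq_card_setU (pairs E :|: [set p : T * T | [set p.1; p.2] \in F]) (L :|: [set p | (p.2, p.1) \in L])).1.
have h2 := (leq_card_setU (pairs E) [set p : T * T | [set p.1; p.2] \in F]).1.
have h3 := (leq_card_setU L [set p | (p.2, p.1) \in L]).1.
have h4 := card_set2_in F.
have h5 : #|W E| * d <= 2 * d.+1 * d by rewrite leq_mul2r card_W // orbT.
have h6 : #|L| + #|[set p | (p.2, p.1) \in L]| <= 4 * d * d.+1 by rewrite wr wl; lia.
have {}h := leq_trans h (leq_trans h1 (leq_add (leq_trans h2 (leq_add (leqnn _) h4)) (leq_trans h3 h6))).
by move: (leq_trans large h); lia.
Qed.

Let switchable_pair E p : adj E u v -> p \in pairs E ->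
  switchable E u v p.1 p.2 /\ switchable E u v p.2 p.1.
Proof.
move=> uv; rewrite !inE => /and4P[ab _ ha hb].
move: ha hb; rewrite !negb_or => /andP[/andP[a1 a2] /andP[a3 a4]] /andP[/andP[b1 b2] /andP[b3 b4]].
split; apply/and5P; split; rewrite // 1?eq_sym ?a1 ?b1 1?eq_sym ?a3 ?b3 //.
by rewrite adj_sym.
Qed.

Let good E := [set p in pairs E | connected_graph (switch E u v p.1 p.2)].

(** By [switch_connected_or], each oriented edge in [pairs E] is in [good E] itself or has its
    reversal there. *)
Let card_good E : E \in RG T d -> #|T| <= 2 * #|good E|.
Proof.
move=> hE; apply: leq_trans (card_pairs hE) _.
rewrite mul2n -addnn -{2}(card_swap (good E)).
apply: leq_trans (leq_card_setU _ _).1; apply: subset_leq_card.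
apply/subsetP => p hp.
have hp' : (p.2, p.1) \in pairs E.
  move: hp; rewrite !in_set /= => /and4P[h1 h2 -> ->].
  by rewrite adj_sym h1 setUC h2.
have cE : connected_graph E by move: hE; rewrite inE => /and3P[].
apply/setUP; have /orP[h|h] := switch_connected_or u v p.1 p.2 cE; [left|right].
  by rewrite /good in_set hp.
by rewrite in_set /good in_set hp'.
Qed.

(** Double counting of the switchings that destroy [uv]: a graph containing this edge admits at
    least n/2 of them, and in the result [a] is a neighbour of [u] and [b] one of [v], so that each
    graph arises at most d^2 times. As [F] survives, prescribing [uv] in addition costs a factor
    O(1/n). *)
Lemma forced_edge :
  #|T| * #|[set E in RG T d | all [in E] F && adj E u v]| <=
  2 * d ^ 2 * #|[set E in RG T d | all [in E] F]|.
Proof.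
set A := [set E in _ | _ && _]; set B := [set E in _ | _].
pose S := [set x : {set {set T}} * (T * T) | (x.1 \in A) && (x.2 \in good x.1)].
pose S' := [set x : {set {set T}} * (T * T) |
  (x.1 \in B) && (x.2 \in setX (nbrs x.1 u) (nbrs x.1 v))].
have cS' : #|S'| = #|B| * d ^ 2.
  rewrite (card_dep_pairs B (fun E => setX (nbrs E u) (nbrs E v))) -sum_nat_const.
  by apply: eq_bigr => E; rewrite inE => /andP[hE _]; rewrite cardsX !(card_nbrs hE).
have cS : #|T| * #|A| <= 2 * #|S|.
  rewrite (card_dep_pairs A good) mulnC -sum_nat_const big_distrr /=.
  by apply: leq_sum => E; rewrite inE => /andP[hE _]; exact: card_good.
apply: leq_trans cS _; rewrite -mulnA leq_mul2l /= [X in _ <= X]mulnC -cS'.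
pose f (x : {set {set T}} * (T * T)) := (switch x.1 u v x.2.1 x.2.2, x.2).
have facts x : x \in S -> [/\ x.1 \in RG T d, all [in x.1] F, x.2 \in pairs x.1,
    switchable x.1 u v x.2.1 x.2.2 & connected_graph (switch x.1 u v x.2.1 x.2.2)].
  rewrite in_set => /andP[]; rewrite in_set => /and3P[h1 h2 h3]; rewrite in_set => /andP[h4 h5].
  have [h6 _] := switchable_pair h3 h4.
  by split.
rewrite -(card_in_imset (f := f) (D := mem S)); last first.
  move=> [E [a b]] [E' [a' b']] /facts[_ _ _ /= sw _] /facts[_ _ _ /= sw' _] [] /= eE ea eb.
  by rewrite -(switchK sw) -(switchK sw') eE ea eb.
apply/subset_leq_card/subsetP => _ /imsetP[[E [a b]] /facts[/= hE hF hp sw cn] ->].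
rewrite !in_set /= switch_simple ?switch_regular ?cn //=; last 3 first.
- by move: hE; rewrite inE => /and3P[].
- by move: hE; rewrite inE => /and3P[].
- by move: hE; rewrite inE => /and3P[].
rewrite !adj_switch !eqxx !orbT !andbT.
apply/allP => e eF; rewrite !inE (allP hF e eF) andbT negb_or.
apply/orP; left; apply/andP; split; first by apply: contraNneq uvF => <-.
by move: hp; rewrite !in_set => /and4P[_ h _ _]; apply: contraNneq h => <-.
Qed.

End ForcedEdge.

(** * Cycles closed by one edge *)

Fixpoint pedges (T : finType) (x : T) (p : seq T) : seq {set T} :=
  if p is y :: p' then [set x; y] :: pedges y p' else [::].

Lemma size_pedges (T : finType) (x : T) p : size (pedges x p) = size p.
Proof. by elim: p x => //= y p IH x; rewrite IH. Qed.

Lemma path_pedges (T : finType) (E : {set {set T}}) x p :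
  path (adj E) x p = all [in E] (pedges x p).
Proof. by elim: p x => //= y p IH x; rewrite IH. Qed.

Lemma pedges_vertex (T : finType) (a b x : T) p :
  [set a; b] \in pedges x p -> a \in x :: p.
Proof.
elim: p x => //= y p IH x; rewrite inE => /orP[|/IH h].
  by rewrite set2_eq => /orP[]/andP[/eqP-> _]; rewrite !inE eqxx ?orbT.
by rewrite inE h orbT.
Qed.

Section Theta.
Variables (T : finType) (i j q q' : nat).

(* The tuple (y, P, Q, V, W) encodes two walks P, Q from y and walks V, W
   starting at the ends of P and Q; the ends of V and W are to be joined by
   one further edge, which closes a cycle. *)
Definition theta : finType :=
  (T * i.-tuple T * j.-tuple T * q.-tuple T * q'.-tuple T)%type.

Definition theta_edges (t : theta) : seq {set T} :=
  let: (y, P, Q, V, W) := t in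
  pedges y P ++ pedges y Q ++ pedges (last y P) V ++ pedges (last y Q) W.

Definition theta_uniq (t : theta) : bool :=
  let: (y, P, Q, V, W) := t in
  [&& uniq (y :: P), uniq (y :: Q), uniq (last y P :: V) & uniq (last y Q :: W)].

Definition theta_ends (t : theta) : T * T :=
  let: (y, P, Q, V, W) := t in (last (last y P) V, last (last y Q) W).

Definition open_thetas (E : {set {set T}}) : {set theta} :=
  [set t | theta_uniq t & all [in E] (theta_edges t)].

Definition thetas (E : {set {set T}}) : {set theta} :=
  [set t in open_thetas E | let: (u, v) := theta_ends t in
    ([set u; v] \notin theta_edges t) && adj E u v].

(** The four paths are chosen one after the other by [card_upaths]; each contributes a factor 2,
    whence 16. *)
Lemma card_open_thetas d E : 3 <= d -> E \in RG T d ->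
  #|open_thetas E| <= #|T| * 16 * d.-1 ^ (i + j + q + q').
Proof.
move=> d3 hE.
have up x r := card_upaths hE d3 x r.
pose S2 : {set T * i.-tuple T} := [set t | t.2 \in upaths E t.1 i].
pose S3 : {set T * i.-tuple T * j.-tuple T} :=
  [set t | (t.1 \in S2) && (t.2 \in upaths E t.1.1 j)].
pose S4 : {set T * i.-tuple T * j.-tuple T * q.-tuple T} :=
  [set t | (t.1 \in S3) && (t.2 \in upaths E (last t.1.1.1 t.1.1.2) q)].
have c2 : #|S2| <= #|[set: T]| * (2 * d.-1 ^ i).
  apply: card_dep_le => [p _|y _]; first by rewrite inE.
  by apply: leq_trans (up y i); apply/subset_leq_card/subsetP => p; rewrite !inE.
have c3 : #|S3| <= #|S2| * (2 * d.-1 ^ j).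
  apply: card_dep_le => [p|y _]; first by rewrite inE => /andP[].
  apply: leq_trans (up y.1 j); apply/subset_leq_card/subsetP => p.
  by rewrite in_set /= in_set => /andP[].
have c4 : #|S4| <= #|S3| * (2 * d.-1 ^ q).
  apply: card_dep_le => [p|y _]; first by rewrite inE => /andP[].
  apply: leq_trans (up (last y.1.1 y.1.2) q); apply/subset_leq_card/subsetP => p.
  by rewrite in_set /= in_set => /andP[].
have c5 : #|open_thetas E| <= #|S4| * (2 * d.-1 ^ q').
  apply: card_dep_le => [[[[[y P] Q] V] W]|[[[y P] Q] V] _].
    rewrite !in_set /= !all_cat -!path_pedges.
    by case/andP => /and4P[-> -> -> _] /and4P[-> -> -> _].
  apply: leq_trans (up (last y Q) q'); apply/subset_leq_card/subsetP => W.
  rewrite !in_set /= !all_cat -!path_pedges.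
  by case/andP => /and4P[_ _ _ ->] /and4P[_ _ _ ->].
apply: leq_trans c5 _; rewrite !expnD.
have -> : #|T| * 16 * (d.-1 ^ i * d.-1 ^ j * d.-1 ^ q * d.-1 ^ q') =
  #|T| * (2 * d.-1 ^ i) * (2 * d.-1 ^ j) * (2 * d.-1 ^ q) * (2 * d.-1 ^ q').
  by set a := _ ^ i; set b := _ ^ j; set c := _ ^ q; set e := _ ^ q'; nia.
rewrite leq_mul2r; apply/orP; right; apply: leq_trans c4 _.
rewrite leq_mul2r; apply/orP; right; apply: leq_trans c3 _.
by rewrite leq_mul2r; apply/orP; right; move: c2; rewrite cardsT.
Qed.

Lemma size_theta_edges t : size (theta_edges t) = i + j + q + q'.
Proof.
by case: t => [[[[y P] Q] V] W] /=; rewrite !size_cat !size_pedges !size_tuple !addnA.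
Qed.

(** For a fixed position [t], [forced_edge] applies with the open edges as [F] and the closing edge
    as [uv]. The factor 1/n gained there cancels the n choices of [y] in [card_open_thetas], so the
    bound on the expected number is free of n. *)
Lemma sum_card_thetas d : 3 <= d -> 0 < #|T| ->
  #|T| + 2 * (i + j + q + q') + 4 * d * d.+1 <= #|T| * d ->
  \sum_(E in RG T d) #|thetas E| <= 32 * d ^ 2 * d.-1 ^ (i + j + q + q') * #|RG T d|.
Proof.
move=> d3 n0 large; rewrite -(leq_pmul2l n0).
pose G t := [set E in RG T d | all [in E] (theta_edges t)].
pose Ge t := [set E in RG T d | all [in E] (theta_edges t) &&
  adj E (theta_ends t).1 (theta_ends t).2].
pose ok t := theta_uniq t && ([set (theta_ends t).1; (theta_ends t).2] \notin theta_edges t).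
have -> : \sum_(E in RG T d) #|thetas E| = \sum_(t | ok t) #|Ge t|.
  under eq_bigr do rewrite -sum1_card.
  under [RHS]eq_bigr do rewrite -sum1_card.
  rewrite (exchange_big_dep ok) /=; last first.
    by move=> E t _; rewrite !in_set /ok; case: (theta_ends t) => a b /andP[/andP[-> _] /andP[-> _]].
  apply: eq_bigr => t okt; apply: eq_bigl => E; rewrite !in_set.
  move: okt; rewrite /ok; case: (theta_ends t) => a b /= /andP[-> ->].
  by [].
have -> : #|T| * (32 * d ^ 2 * d.-1 ^ (i + j + q + q') * #|RG T d|) =
  2 * d ^ 2 * (#|RG T d| * (#|T| * 16 * d.-1 ^ (i + j + q + q'))) by lia.
apply: (@leq_trans (2 * d ^ 2 * \sum_(E in RG T d) #|open_thetas E|)); last first.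
  rewrite leq_mul2l -sum_nat_const leq_sum ?orbT // => E hE.
  exact: card_open_thetas.
have -> : \sum_(E in RG T d) #|open_thetas E| = \sum_(t | theta_uniq t) #|G t|.
  under eq_bigr do rewrite -sum1_card.
  under [RHS]eq_bigr do rewrite -sum1_card.
  rewrite (exchange_big_dep theta_uniq) /=; last first.
    by move=> E t _; rewrite !in_set => /andP[].
  by apply: eq_bigr => t okt; apply: eq_bigl => E; rewrite !in_set okt.
rewrite !big_distrr /= [X in _ <= X](bigID ok) /=.
apply: leq_trans (leq_addr _ _).
rewrite [X in _ <= X](eq_bigl ok); last by move=> t; rewrite /ok; case: (theta_uniq t).
apply: leq_sum => t /andP[_ nt].
apply: forced_edge => //; by rewrite size_theta_edges.
Qed.

End Theta.

(** * Growth of balls *)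

Lemma pedges_rcons (T : finType) (x : T) p v :
  pedges x (rcons p v) = rcons (pedges x p) [set last x p; v].
Proof. by elim: p x => //= y p IH x; rewrite IH. Qed.

Section Growth.
Variables (T : finType) (d : nat).
Implicit Types (E : {set {set T}}) (x y v : T).

(** In a tree rooted at [y] this is just the parent of [v], for [v] other than [y]; a second element
    closes a cycle. *)
Definition low E y v : {set T} :=
  [set p in nbrs E v | gdist (adj E) y p <= gdist (adj E) y v].

Definition low_pairs E y v : {set T * T} :=
  [set t | [&& t.1 \in low E y v, t.2 \in low E y v & t.1 != t.2]].

(* Vanishes when the ball of radius h around y is a tree. *)
Definition collisions E h y : nat := \sum_(v in sphere E h y) #|low_pairs E y v|.

Lemma card_low_le E y v : #|low E y v| <= 1 + #|low_pairs E y v|.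
Proof.
have [->|[p hp]] := set_0Vmem (low E y v); first by rewrite cards0.
rewrite (cardsD1 p) hp leq_add2l.
have inj : injective (fun q : T => (p, q)) by move=> a b [].
rewrite -(card_imset _ inj); apply/subset_leq_card/subsetP => _ /imsetP[q hq ->].
move: hq; rewrite in_setD1 => /andP[nq hq].
by rewrite in_set /= hp hq eq_sym nq.
Qed.

Section Fixed.
Variable E : {set {set T}}.
Hypothesis hE : E \in RG T d.
Let e := adj E.
Let conn : forall x y, connect e x y := RG_connect hE.

Lemma geodesic_end x (p : seq T) v : path e x p -> size p = gdist e x (last x p) ->
  v \in x :: p -> gdist e x (last x p) <= gdist e x v -> v = last x p.
Proof.
move=> pp sz vp; have hi : index v (x :: p) < (size p).+1 by rewrite index_mem.
rewrite -{1}(nth_index x vp) geodesic_prefix // -sz => hj.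
rewrite -[LHS](nth_index x vp) (last_nth x); congr nth.
by apply/eqP; rewrite eqn_leq hj andbT -ltnS.
Qed.

(** Count the edges from one sphere to the next: up to collisions, a vertex has at most one low
    neighbour, and its other neighbours lie on the next sphere, where each vertex receives at most
    one edge. *)
Lemma sphere_step h y : d * #|sphere E h y| <=
  #|sphere E h y| + collisions E h y + #|sphere E h.+1 y| + collisions E h.+1 y.
Proof.
pose up u := [set v in nbrs E u | gdist e y v == h.+1].
have lo k : \sum_(v in sphere E k y) #|low E y v| <= #|sphere E k y| + collisions E k y.
  by rewrite -sum1_card -big_split /=; apply: leq_sum => v _; exact: card_low_le.
have tot : d * #|sphere E h y| <= \sum_(u in sphere E h y) #|low E y u| +
    \sum_(u in sphere E h y) #|up u|.
  rewrite mulnC -sum_nat_const -big_split /=; apply: leq_sum => u; rewrite inE => /eqP hu.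
  rewrite -(card_nbrs hE u); apply: leq_trans (leq_card_setU _ _).1.
  apply/subset_leq_card/subsetP => v; rewrite !inE hu => uv; rewrite uv /=.
  by rewrite orbC -ltnS -leq_eqVlt -hu; exact: gdist_adj.
have sw : \sum_(u in sphere E h y) #|up u| <= \sum_(v in sphere E h.+1 y) #|low E y v|.
  under eq_bigr do rewrite -sum1_card.
  rewrite (exchange_big_dep (mem (sphere E h.+1 y))) /=; last first.
    by move=> u v _; rewrite !inE => /andP[].
  apply: leq_sum => v; rewrite inE => /eqP hv; rewrite sum1_card.
  apply/subset_leq_card/subsetP => u; rewrite unfold_in /= !inE => /andP[/eqP hu /andP[uv _]].
  by rewrite adj_sym uv -/e hu hv leqnSn.
have := lo h; have := lo h.+1; lia.
Qed.

(** The recursion that [sphere_step] yields for the deficit of the sphere of radius r+1 against its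
    size d(d-1)^r in the d-regular tree. *)
Fixpoint loss r y : nat :=
  if r is r'.+1 then d.-1 * loss r' y + collisions E r y + collisions E r.+1 y
  else collisions E 1 y.

Lemma sphere_growth r y : d * d.-1 ^ r <= #|sphere E r.+1 y| + loss r y.
Proof.
elim: r => [|r IH].
  rewrite expn0 muln1 -(card_nbrs hE y); apply: leq_trans (leq_addr _ _).
  apply/subset_leq_card/subsetP => z; rewrite !inE => yz.
  have := @gdist_leP _ e y z [:: z]; rewrite /= /e yz => /(_ isT erefl) le1.
  by rewrite eqn_leq le1 lt0n (gdist_eq0 conn) (adj_neq hE yz).
have := sphere_step r.+1 y; rewrite /= expnS.
have : d.-1 * (d * d.-1 ^ r) <= d.-1 * (#|sphere E r.+1 y| + loss r y).
  by rewrite leq_mul2l IH orbT.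
case: d => [|b]; rewrite ?mul0n //= mulnDr mulSn; set z := b ^ r.
have -> : b.+1 * (b * z) = b * (b.+1 * z) by lia.
lia.
Qed.

Lemma path_to_neighbour y p v : p \in low E y v -> exists P : seq T,
  [/\ path e y (rcons P v), last y P = p, uniq (y :: rcons P v),
      size P = gdist e y p & v \notin y :: P].
Proof.
rewrite !inE => /andP[vp le].
have [P [pP lP sP]] := gdist_path (conn y p); exists P.
(* As [v] is at least as far from [y] as [p], it could only be the end [p] of this geodesic. *)
have vP : v \notin y :: P.
  apply/negP => /geodesic_end; rewrite lP => /(_ pP sP le) vp'.
  by move: (adj_neq hE vp); rewrite vp' eqxx.
split=> //; first by rewrite rcons_path pP lP /e adj_sym.
rewrite -rcons_cons rcons_uniq vP; apply: geodesic_uniq pP _.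
by rewrite lP.
Qed.

Let tripl h := [set t : T * T * T * T |
  (t.1.1.2 \in sphere E h t.1.1.1) && ((t.1.2, t.2) \in low_pairs E t.1.1.1 t.1.1.2)].

Let of_theta i j (t : theta T i j 0 0) : T * T * T * T :=
  let: (y, P, Q, _, _) := t in (y, last y P, nth y (y :: P) i.-1, last y Q).

(** The first leg is a geodesic to [p] prolonged by [v], the second a geodesic to [q], and [vq] is
    the closing edge. As [p] and [q] are at distance h-1 or h from [y], each leg has two possible
    lengths, indexed by ['I_2]. *)
Let collision_theta h t : t \in tripl h -> exists ij : 'I_2 * 'I_2,
  t \in @of_theta (ij.1 + h) (ij.2 + h.-1) @: thetas (ij.1 + h) (ij.2 + h.-1) 0 0 E.
Proof.
case: t => [[[y v] p] q]; rewrite in_set /= in_set => /andP[/eqP hv].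
rewrite in_set /= => /and3P[pl ql npq].
have [P [pP lP uP sP vP]] := path_to_neighbour pl.
have [Q [pQ lQ uQ sQ vQ]] := path_to_neighbour ql.
have vp : adj E v p by move: pl; rewrite !inE => /andP[].
have vq : adj E v q by move: ql; rewrite !inE => /andP[].
have bounds z : z \in low E y v -> gdist e y z <= h /\ h <= (gdist e y z).+1.
  rewrite !inE hv => /andP[vz ->]; split=> //; rewrite -hv.
  by apply: gdist_adj => //; rewrite /e adj_sym.
have [p1 p2] := bounds _ pl; have [q1 q2] := bounds _ ql.
have i2 : (gdist e y p).+1 - h < 2 by move: p1 p2; clear; lia.
have j2 : gdist e y q - h.-1 < 2 by move: q1 q2; clear; lia.
exists (Ordinal i2, Ordinal j2) => /=.
have szP : size (rcons P v) == (gdist e y p).+1 - h + h by rewrite size_rcons sP; move: p1 p2; clear; lia.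
have szQ : size Q == gdist e y q - h.-1 + h.-1 by rewrite sQ; move: q1 q2; clear; lia.
apply/imsetP; exists (y, Tuple szP, Tuple szQ, [tuple], [tuple]); last first.
  rewrite /= last_rcons lQ -(eqP szP) size_rcons /=; congr (_, _, _).
  by rewrite -lP -rcons_cons nth_rcons /= ltnSn (last_nth y).
move: (uP) => /= uP'.
rewrite !in_set /= lQ last_rcons !cats0 uP' vq !all_cat -!path_pedges pP /= !andbT.
move: pQ uQ; rewrite rcons_path -rcons_cons rcons_uniq => /andP[-> _] /andP[_ /= /andP[-> ->]] /=.
rewrite pedges_rcons mem_cat mem_rcons inE !negb_or -!andbA; apply/and3P; split.
- by rewrite lP set2_eq (negPf (adj_neq hE vp)) eqxx /= eq_sym.
- by apply: contra vP => /pedges_vertex.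
- by apply: contra vQ => /pedges_vertex.
Qed.

Lemma sum_collisions h : \sum_y collisions E h y <=
  \sum_(ij : 'I_2 * 'I_2) #|thetas (ij.1 + h) (ij.2 + h.-1) 0 0 E|.
Proof.
have -> : \sum_y collisions E h y = #|tripl h|.
  rewrite /collisions pair_big_dep /=.
  pose S := [set p : T * T | p.2 \in sphere E h p.1].
  have := card_dep_pairs S (fun p => low_pairs E p.1 p.2).
  have -> : \sum_(a in S) #|low_pairs E a.1 a.2| =
      \sum_(p | p.2 \in sphere E h p.1) #|low_pairs E p.1 p.2|.
    by apply: eq_bigl => p; rewrite inE.
  move=> <-; pose f (t : T * T * T * T) := (t.1.1, (t.1.2, t.2)).
  have fI : injective f by move=> [[[a b] c] g] [[[a' b'] c'] g'] [-> -> -> ->].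
  rewrite -(card_imset (tripl h) fI); apply: eq_card => -[[y v] [p q]].
  rewrite in_set /= in_set /=; apply/idP/imsetP => [hh|[[[[a b] c] g]]].
    by exists (y, v, p, q); rewrite // in_set.
  by rewrite in_set => /= hh [-> -> -> ->].
have sub : tripl h \subset \bigcup_(ij : 'I_2 * 'I_2)
  @of_theta (ij.1 + h) (ij.2 + h.-1) @: thetas (ij.1 + h) (ij.2 + h.-1) 0 0 E.
  by apply/subsetP => t /collision_theta[ij hij]; apply/bigcupP; exists ij.
apply: leq_trans (subset_leq_card sub) _; apply: leq_trans (card_bigcup_le _ _) _.
by apply: leq_sum => ij _; exact: leq_imset_card.
Qed.

End Fixed.

(** The sphere of radius r+1 falls short of its tree size d(d-1)^r by at most (d-1)^r / 2. *)
Definition growing E r y := (2 * d).-1 * d.-1 ^ r <= 2 * #|sphere E r.+1 y|.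

Definition stunted E r : {set T} := [set y | ~~ growing E r y].

Definition regular_at E r y :=
  growing E r y && (2 * #|stunted E r :&: sphere E r.+1 y| <= d.-1 ^ r).

Hypothesis d3 : 3 <= d.

(** Markov's inequality: by [sphere_growth], the loss at a stunted vertex is at least (d-1)^r /
    2. *)
Lemma card_stunted E r : E \in RG T d ->
  d.-1 ^ r * #|stunted E r| <= 2 * \sum_y loss E r y.
Proof.
move=> hE; rewrite mulnC -sum_nat_const big_distrr /=.
rewrite [X in _ <= X](bigID (mem (stunted E r))) /=; apply: leq_trans (leq_addr _ _).
apply: leq_sum => y; rewrite inE -ltnNge => h.
have := sphere_growth hE r y; move: h d3; set z := d.-1 ^ r => h hd h2.
have : (2 * d).-1 * z + z = 2 * (d * z) by rewrite -mulSnr prednK ?mulnA //; lia.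
lia.
Qed.

(** A stunted vertex lies on the spheres of at most 2(d-1)^(r+1) centres, so the centres that see
    more than (d-1)^r / 2 stunted vertices number at most 4(d-1) times the stunted vertices. The
    stunted centres come on top. *)
Lemma card_irregular E r : E \in RG T d ->
  #|[set y | ~~ regular_at E r y]| <= 5 * d.-1 * #|stunted E r|.
Proof.
move=> hE; pose A := [set y | d.-1 ^ r < 2 * #|stunted E r :&: sphere E r.+1 y|].
have sub : [set y | ~~ regular_at E r y] \subset stunted E r :|: A.
  by apply/subsetP => y; rewrite !inE negb_and -ltnNge.
have cA : d.-1 ^ r * #|A| <= d.-1 ^ r * (4 * d.-1 * #|stunted E r|).
  rewrite mulnC -sum_nat_const.
  apply: (@leq_trans (2 * \sum_y #|stunted E r :&: sphere E r.+1 y|)).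
    rewrite big_distrr /= [X in _ <= X](bigID (mem A)) /=; apply: leq_trans (leq_addr _ _).
    by apply: leq_sum => y; rewrite inE => /ltnW.
  under eq_bigr do rewrite -sum1_card.
  rewrite (exchange_big_dep (mem (stunted E r))) /=; last first.
    by move=> y x _; rewrite inE => /andP[].
  have : \sum_(x in stunted E r) \sum_(y | x \in stunted E r :&: sphere E r.+1 y) 1 <=
      \sum_(x in stunted E r) 2 * d.-1 ^ r.+1.
    apply: leq_sum => x hx; rewrite sum1_card; apply: leq_trans (card_sphere hE d3 x _).
    apply/subset_leq_card/subsetP => y; rewrite -[y \in _]/(x \in stunted E r :&: sphere E r.+1 y) !inE => /andP[_].
    by rewrite (gdist_sym (RG_connect hE) (@adj_sym T E)).
  by rewrite sum_nat_const expnS; nia.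
apply: leq_trans (subset_leq_card sub) _; apply: leq_trans (leq_card_setU _ _).1 _.
move: cA; rewrite leq_pmul2l ?expn_gt0; last by lia.
nia.
Qed.

Section Expectation.
Variable H : nat.
Hypothesis large : #|T| + 4 * H + 4 * d * d.+1 <= #|T| * d.

Let n0 : 0 < #|T|. Proof. by rewrite lt0n; apply: contraTneq large => ->; lia. Qed.

(** Each of the four shapes in [collision_theta] has at most 2h+1 open edges; the surplus factor d-1
    is absorbed in d^3. *)
Lemma sum_sum_collisions h : 0 < h -> h < H ->
  \sum_(E in RG T d) \sum_y collisions E h y <= 128 * d ^ 3 * d.-1 ^ (2 * h) * #|RG T d|.
Proof.
move=> h0 hH.
apply: (@leq_trans (\sum_(E in RG T d) \sum_(ij : 'I_2 * 'I_2)
    #|thetas (ij.1 + h) (ij.2 + h.-1) 0 0 E|)).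
  by apply: leq_sum => E hE; exact: sum_collisions hE h.
rewrite exchange_big /=.
have le (ij : 'I_2 * 'I_2) : \sum_(E in RG T d) #|thetas (ij.1 + h) (ij.2 + h.-1) 0 0 E| <=
    32 * d ^ 2 * (d * d.-1 ^ (2 * h)) * #|RG T d|.
  have i2 := ltn_ord ij.1; have j2 := ltn_ord ij.2.
  apply: leq_trans (sum_card_thetas d3 n0 _) _; first by lia.
  rewrite leq_mul2r; apply/orP; right; rewrite leq_mul2l; apply/orP; right.
  apply: (@leq_trans (d.-1 ^ (2 * h).+1)); first by rewrite leq_pexp2l //; lia.
  by rewrite expnS leq_mul2r leq_pred orbT.
apply: (@leq_trans (\sum_(ij : 'I_2 * 'I_2) 32 * d ^ 2 * (d * d.-1 ^ (2 * h)) * #|RG T d|)).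
  by apply: leq_sum => ij _; exact: le.
rewrite sum_nat_const card_prod card_ord.
rewrite (expnSr d 2); move: (d ^ 2) (d.-1 ^ _) #|RG T d| => D z R; clear; lia.
Qed.

(** Inherited loss grows by the factor d-1 only, while the bound for the collisions grows by
    (d-1)^2. Three times the constant 128 of [sum_sum_collisions] leaves room for all three terms
    because d-1 >= 2. *)
Lemma sum_loss r : r.+1 < H ->
  \sum_(E in RG T d) \sum_y loss E r y <=
  384 * d ^ 3 * d.-1 ^ (2 * r.+1) * #|RG T d|.
Proof.
elim: r => [|r IH] hr.
  apply: leq_trans (sum_sum_collisions _ hr) _ => //.
  by rewrite !leq_mul2r; do 3 (apply/orP; right).
rewrite /=; under eq_bigr do rewrite !big_split /= -big_distrr /=.
rewrite !big_split /= -big_distrr /=.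
have h1 := IH (ltnW hr).
have h2 := sum_sum_collisions (ltn0Sn r) (ltnW hr).
have h3 := sum_sum_collisions (ltn0Sn r.+1) hr.
move: h1 h2 h3.
have e2 : 2 * r.+2 = (2 * r.+1).+2 by lia.
rewrite e2 (expnS _ (2 * r.+1).+1) (expnS _ (2 * r.+1)); move: (d.-1 ^ (2 * r.+1)) => z; set R := #|_|.
have hb : 2 <= d.-1 by lia.
move: (d.-1) (d ^ 3) hb => b D hb; set X := D * (z * R).
rewrite (_ : 384 * D * z * R = 384 * X); last by rewrite /X; ring.
rewrite (_ : 128 * D * z * R = 128 * X); last by rewrite /X; ring.
rewrite (_ : 128 * D * (b * (b * z)) * R = 128 * (b * (b * X))); last by rewrite /X; ring.
rewrite (_ : 384 * D * (b * (b * z)) * R = 384 * (b * (b * X))); last by rewrite /X; ring.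
move=> h1 h2 h3.
set x := \sum_(E in _) _ in h1 *.
have {}h1 : b * x <= b * (384 * X) by rewrite leq_mul2l h1 orbT.
have h4 : 2 * (b * X) <= b * (b * X) by rewrite leq_mul2r hb orbT.
have h5 : 2 * X <= b * X by rewrite leq_mul2r hb orbT.
apply: leq_trans (leq_add (leq_add h1 h2) h3) _.
by move: X h4 h5 {h1 h2 h3 x} => X h4 h5; clear -h4 h5; nia.
Qed.

(** The total expected loss is of order (d-1)^(2r), and each stunted vertex uses up (d-1)^r / 2 of
    it. So irregular vertices are rare as long as (d-1)^r is small compared with n. *)
Lemma sum_irregular r : r.+1 < H ->
  \sum_(E in RG T d) #|[set y | ~~ regular_at E r y]| <=
  3840 * d ^ 6 * d.-1 ^ r * #|RG T d|.
Proof.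
move=> hr; have hb : 0 < d.-1 ^ r by rewrite expn_gt0; apply/orP; left; lia.
rewrite -(leq_pmul2l hb).
apply: (@leq_trans (10 * d.-1 * (384 * d ^ 3 * d.-1 ^ (2 * r.+1) * #|RG T d|))).
  apply: leq_trans (leq_mul (leqnn _) (sum_loss hr)).
  rewrite !big_distrr /=; apply: leq_sum => E hE.
  apply: (@leq_trans (d.-1 ^ r * (5 * d.-1 * #|stunted E r|))).
    by rewrite leq_mul2l card_irregular ?orbT.
  by have := card_stunted r hE; nia.
have -> : d.-1 ^ (2 * r.+1) = d.-1 * d.-1 * (d.-1 ^ r * d.-1 ^ r).
  by rewrite (_ : 2 * r.+1 = (r + r).+2) ?expnS ?expnD ?mulnA //; lia.
have -> : d ^ 6 = d ^ 3 * (d * d * d) by ring.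
have : d.-1 * (d.-1 * d.-1) <= d * d * d by rewrite mulnA !leq_mul ?leq_pred.
move: (d.-1 ^ r) (d ^ 3) #|RG T d| (d * d * d) => z D R c hc.
rewrite (_ : 10 * _ * _ = 3840 * D * z * z * R * (d.-1 * (d.-1 * d.-1))); last by ring.
rewrite (_ : z * _ = 3840 * D * z * z * R * c); last by ring.
by rewrite leq_mul2l hc orbT.
Qed.

End Expectation.
End Growth.

(** * Upper tail of the distance *)

Lemma exit_index (T : eqType) (P : pred T) x p : P x -> ~~ P (last x p) ->
  exists t, [/\ t < size p, P (nth x (x :: p) t) & ~~ P (nth x (x :: p) t.+1)].
Proof.
elim: p x => [|y p IH] x Px /=; first by rewrite Px.
have [Py|nPy] := boolP (P y); last by exists 0.
move=> /(IH y Py)[t [lt h1 h2]]; exists t.+1; split=> //=.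
  by rewrite (set_nth_default y) //= ltnS ltnW.
by rewrite (set_nth_default y).
Qed.

Section Site.
Variables (T : finType) (d r : nat).
Implicit Types (E : {set {set T}}) (x y z u w v s : T).

(** A place for the switching that creates [uv] and [ww']. The distance 2r+4 ensures that no edge
    joins the balls of radius r+1 around [y] and [z], whence [site_switchable]. *)
Definition site E y z u w v w' :=
  [&& adj E u w, adj E v w', 2 * r + 4 <= gdist (adj E) y z,
      (gdist (adj E) y u == r) && (gdist (adj E) y w == r.+1) &
      (gdist (adj E) z v == r) && (gdist (adj E) z w' == r.+1)].

Section OneSite.
Variables (E : {set {set T}}) (y z u w v w' : T).
Hypothesis hE : E \in RG T d.
Hypothesis hs : site E y z u w v w'.
Let e := adj E.
Let conn := RG_connect hE.

Let uw : adj E u w. Proof. by case/and5P: hs. Qed.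
Let vw : adj E v w'. Proof. by case/and5P: hs. Qed.
Let yz : 2 * r + 4 <= gdist e y z. Proof. by case/and5P: hs. Qed.
Let yu : gdist e y u = r. Proof. by case/and5P: hs => _ _ _ /andP[/eqP]. Qed.
Let yw : gdist e y w = r.+1. Proof. by case/and5P: hs => _ _ _ /andP[_ /eqP]. Qed.
Let zv : gdist e z v = r. Proof. by case/and5P: hs => _ _ _ _ /andP[/eqP]. Qed.
Let zw : gdist e z w' = r.+1. Proof. by case/and5P: hs => _ _ _ _ /andP[_ /eqP]. Qed.

Let far s : gdist e y s <= r.+2 -> r.+2 <= gdist e z s.
Proof.
move=> h; have := gdist_triangle conn y s z; rewrite (gdist_sym conn (@adj_sym T E) s z) -/e.
by move: yz h; clear; lia.
Qed.

Lemma siteC : site E z y v w' u w.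
Proof.
move: hs; rewrite /site (gdist_sym conn (@adj_sym T E) z y) => /and5P[-> -> -> -> ->] //.
Qed.

Lemma site_switchable : switchable E u w v w'.
Proof.
have h s1 s2 : gdist e y s1 <= r.+1 -> gdist e z s2 <= r.+1 -> (s1 != s2) && ~~ e s1 s2.
  move=> h1 h2; apply/andP; split.
    by apply: contraTneq h2 => <-; rewrite -ltnNge; apply: far; lia.
  apply/negP => s12; have := gdist_adj conn y s12; move=> h3.
  have : gdist e y s2 <= r.+2 by rewrite -/e in h3; lia.
  by move=> /far; rewrite ltnNge h2.
have /andP[h1 h2] : (u != v) && ~~ e u v by apply: h; rewrite ?yu ?zv.
have /andP[h3 h4] : (w != w') && ~~ e w w' by apply: h; rewrite ?yw ?zw.
by rewrite /switchable uw vw h1 h2 h3 h4.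
Qed.

Lemma site_cut s1 s2 : adj E s1 s2 -> gdist e y s1 <= r -> gdist e y s2 <= r ->
  adj (cut E u w v w') s1 s2.
Proof.
move=> s12 h1 h2; rewrite adj_cut s12 andbT !set2_eq.
have nw s : gdist e y s <= r -> (s == w) = false.
  by move=> h; apply: contraTF h => /eqP ->; rewrite yw ltnn.
have nw' s : gdist e y s <= r -> (s == w') = false.
  move=> h; apply/eqP => sw; have : r.+2 <= gdist e z s by apply: far; lia.
  by rewrite sw zw ltnn.
by rewrite !nw // !nw' // !andbF.
Qed.

Lemma site_ball_connect s : gdist e y s <= r -> connect (adj (cut E u w v w')) y s.
Proof.
move hk: (gdist e y s) => k; elim: k s hk => [|k IH] s hk hr.
  by move/eqP: hk; rewrite (gdist_eq0 conn) => /eqP <-; exact: connect0.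
have ys : y != s by rewrite -(gdist_eq0 conn) -/e hk.
have [t ts ht] := gdist_parent conn ys.
have htk : gdist e y t = k by move: hk; rewrite /e ht => -[].
have htr : gdist e y t <= r by rewrite htk ltnW.
apply: connect_trans (IH t htk (ltnW hr)) (connect1 _).
by apply: site_cut ts htr _; rewrite hk.
Qed.

(** Geodesics inside the ball of radius r around [y] survive, since each removed edge has an end
    outside it. *)
Lemma site_dist_switch s : switch E u w v w' \in RG T d ->
  gdist e y s <= r -> gdist (adj (switch E u w v w')) y s <= gdist e y s.
Proof.
move=> hE'; have conn' := RG_connect hE'.
move hk: (gdist e y s) => k; elim: k s hk => [|k IH] s hk hr.
  by move/eqP: hk; rewrite (gdist_eq0 conn) => /eqP <-; rewrite gdistxx.
have ys : y != s by rewrite -(gdist_eq0 conn) -/e hk.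
have [t ts ht] := gdist_parent conn ys.
have htk : gdist e y t = k by move: hk; rewrite /e ht => -[].
have le := IH t htk (ltnW hr).
have htr : gdist e y t <= r by rewrite htk ltnW.
have hsr : gdist e y s <= r by rewrite hk.
have ts' := sub_cut_switch (site_cut ts htr hsr).
by apply: leq_trans (gdist_adj conn' y ts') _; rewrite ltnS.
Qed.

(** No new edge starts at a vertex reached from [y] in fewer than r steps: [u] is at distance r, and
    [w], [v], [w'] are farther away. So the switching creates no shortcut inside the ball. *)
Lemma site_switch_dist s : switch E u w v w' \in RG T d ->
  gdist (adj (switch E u w v w')) y s <= r ->
  gdist e y s <= gdist (adj (switch E u w v w')) y s.
Proof.
move=> hE'; have conn' := RG_connect hE'.
set e' := adj _; move hk: (gdist e' y s) => k; elim: k s hk => [|k IH] s hk hr.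
  by move/eqP: hk; rewrite (gdist_eq0 conn') => /eqP <-; rewrite gdistxx.
have ys : y != s by rewrite -(gdist_eq0 conn') -/e' hk.
have [t ts ht] := gdist_parent conn' ys.
have htk : gdist e' y t = k by move: hk; rewrite /e' ht => -[].
have le := IH t htk (ltnW hr).
move: ts; rewrite adj_switch adj_cut !set2_eq => /orP[/and3P[_ _ ts]|].
  by apply: leq_trans (gdist_adj conn y ts) _; rewrite ltnS.
have far1 s1 : gdist e z s1 <= r.+1 -> t <> s1.
  by move=> h ts; have : r.+2 <= gdist e z t by [apply: far; lia]; rewrite ts ltnNge h.
case/orP=> /orP[]/andP[/eqP tE _].
- by move: le; rewrite tE yu leqNgt hr.
- by case: (far1 v) => //; rewrite zv.
- by move: le; rewrite tE yw; move: hr; clear; lia.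
- by case: (far1 w') => //; rewrite zw.
Qed.

End OneSite.

(* The new edge uv is the middle edge of every geodesic from y to z. *)
Lemma site_unique E1 E2 y z u1 v1 u2 v2 w w' : E1 \in RG T d -> E2 \in RG T d ->
  site E1 y z u1 w v1 w' -> site E2 y z u2 w v2 w' ->
  switch E1 u1 w v1 w' = switch E2 u2 w v2 w' -> switch E1 u1 w v1 w' \in RG T d ->
  E1 = E2.
Proof.
move=> hE1 hE2 s1 s2 eqE hE'.
have conn1 := RG_connect hE1.
have sw1 := site_switchable hE1 s1; have sw2 := site_switchable hE2 s2.
suff [eu ev] : u2 = u1 /\ v2 = v1 by rewrite -(switchK sw1) -(switchK sw2) eqE eu ev.
have du : gdist (adj E1) y u2 <= r.
  have yu2 : gdist (adj E2) y u2 = r by case/and5P: s2 => _ _ _ /andP[/eqP].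
  have := site_dist_switch hE2 s2 (s := u2); rewrite -eqE yu2 => /(_ hE' (leqnn r)) h.
  exact: leq_trans (site_switch_dist hE1 s1 hE' h) h.
have dv : gdist (adj E1) z v2 <= r.
  have zv2 : gdist (adj E2) z v2 = r by case/and5P: s2 => _ _ _ _ /andP[/eqP].
  have s1' := siteC hE1 s1; have s2' := siteC hE2 s2.
  have := site_dist_switch hE2 s2' (s := v2).
  rewrite switchC -eqE zv2 => /(_ hE' (leqnn r)) h.
  have := site_switch_dist hE1 s1' (s := v2); rewrite switchC => /(_ hE' h) h'.
  exact: leq_trans h' h.
have : adj (switch E1 u1 w v1 w') u2 v2 by rewrite eqE adj_switch eqxx orbT.
case/and5P: s1 => _ _ yz /andP[/eqP yu1 /eqP yw] /andP[/eqP zv1 /eqP zw].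
have near s : gdist (adj E1) z s <= r.+1 -> u2 <> s.
  move=> h us; have := gdist_triangle conn1 y u2 z.
  rewrite us (gdist_sym conn1 (@adj_sym T E1) s z); move: yz du; rewrite us; lia.
rewrite adj_switch adj_cut !set2_eq => /orP[/and3P[_ _ uv]|].
  have := gdist_triangle conn1 y v2 z; have := gdist_adj conn1 y uv.
  rewrite (gdist_sym conn1 (@adj_sym T E1) v2 z); move: yz du dv; lia.
case/orP=> /orP[]/andP[/eqP uE /eqP vE] //.
- by case: (near v1) => //; rewrite zv1.
- by move: du; rewrite uE yw ltnn.
- by case: (near w') => //; rewrite zw.
Qed.

End Site.

(** * Components cut off by a disconnecting switching *)

Section Detached.
Variables (T : finType) (d r : nat) (E : {set {set T}}) (y z : T).
Hypothesis hE : E \in RG T d.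
Let e := adj E.
Let conn := RG_connect hE.

Definition detached (u w v w' : T) : {set T} :=
  [set x | connect (adj (cut E u w v w')) w x].

(** A walk from a common vertex to [w2] in the second cut graph survives in the first one unless it
    uses [u1 w1]; but then [w2] would be linked to [u1] and, through the ball around [y], to [u2].
    So the first cut graph links [w1] to [w2], then by the edge [u2 w2] and the ball to [u1], a
    contradiction. *)
Lemma detached_disjoint u1 w1 u2 w2 v w' x :
  site r E y z u1 w1 v w' -> site r E y z u2 w2 v w' ->
  ~~ connect (adj (cut E u1 w1 v w')) u1 w1 ->
  ~~ connect (adj (cut E u2 w2 v w')) u2 w2 ->
  x \in detached u1 w1 v w' -> x \in detached u2 w2 v w' -> w1 = w2.
Proof.
move=> s1 s2 n1 n2; rewrite !inE => x1 x2; apply/eqP; apply: contraT => nw.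
set e1 := adj (cut E u1 w1 v w') in n1 x1; set e2 := adj (cut E u2 w2 v w') in n2 x2.
have c1 : connect_sym e1 := adj_csym _; have c2 : connect_sym e2 := adj_csym _.
have [yu1 yu2 yw1 yw2] : [/\ gdist e y u1 = r, gdist e y u2 = r,
    gdist e y w1 = r.+1 & gdist e y w2 = r.+1].
  by case/and5P: s1 => _ _ _ /andP[/eqP-> /eqP->] _; case/and5P: s2 => _ _ _ /andP[/eqP-> /eqP->] _.
have b1 s : gdist e y s <= r -> connect e1 y s by exact: site_ball_connect hE s1 _.
have b2 s : gdist e y s <= r -> connect e2 y s by exact: site_ball_connect hE s2 _.
have link1 : connect e1 u1 u2.
  by apply: (@connect_trans _ _ y); [rewrite c1|]; apply: b1; rewrite ?yu1 ?yu2.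
have link2 : connect e2 u1 u2.
  by apply: (@connect_trans _ _ y); [rewrite c2|]; apply: b2; rewrite ?yu1 ?yu2.
have step : e1 u2 w2.
  have := site_switchable hE s2 => /and5P[uw vw _ _ /andP[uv wv]].
  rewrite /e1 adj_cut uw andbT !set2_eq (eq_sym w2) (negPf nw) andbF (negPf uv) /=.
  apply/andP; split.
    by apply/negP => /andP[/eqP uw' _]; move: yw1; rewrite -uw' yu2 => /eqP; rewrite ltn_eqF.
  case/and5P: s2 => _ _ yz _ /andP[_ /eqP zw]; apply/negP => /andP[/eqP uw' _].
  have := gdist_triangle conn y u2 z; rewrite uw' (gdist_sym conn (@adj_sym T E) w' z) -/e zw.
  by rewrite -uw' yu2; move: yz; rewrite -/e; clear; lia.
pose P s := connect e1 w1 s && connect e2 w2 s.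
suff /andP[h _] : P w2.
  case/negP: n1; apply: connect_trans link1 _; rewrite c1.
  by apply: connect_trans h _; rewrite c1; exact: connect1.
have x2' : connect e2 x w2 by rewrite c2.
apply: (@connect_invariant _ _ P _ _ _ x2'); last by rewrite /P x1 x2.
move=> s t st /andP[h1 h2].
have h2' : connect e2 w2 t := connect_trans h2 (connect1 st).
rewrite /P h2' andbT.
have [st1|nst1] := boolP (e1 s t); first exact: connect_trans h1 (connect1 st1).
move: st nst1; rewrite /e2 /e1 !adj_cut => /and3P[_ -> ->]; rewrite !andbT negbK set2_eq.
have bad : connect e2 w2 u1 -> connect e1 w1 t.
  by move=> h; case/negP: n2; rewrite c2; exact: connect_trans h link2.
by case/orP=> /andP[/eqP es /eqP et]; apply: bad; rewrite -?es -?et.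
Qed.

Hypothesis d3 : 3 <= d.

(** A geodesic of length r+1 from [w] can leave the detached part only along [wu] or along [w'v].
    Each of these exits leads to at most (d-1)^r ends, whereas [growing] provides at least
    (5/2)(d-1)^r of them. *)
Lemma detached_large u w v w' : site r E y z u w v w' -> growing d E r w ->
  ~~ connect (adj (cut E u w v w')) u w -> ~~ connect (adj (cut E u w v w')) v w ->
  d.-1 ^ r <= 2 * #|detached u w v w'|.
Proof.
move=> s gw nu nv; set K := detached u w v w'.
pose A := (fun p : r.-tuple T => last u p) @: [set p : r.-tuple T | path e u p && uniq [:: w, u & p]].
(* The number of steps left when a geodesic of length r+1 from [w] has passed [w'] and crossed to
   [v]. *)
pose k := r - gdist e w w'.
pose B := (fun p : k.-tuple T => last v p) @: [set p : k.-tuple T | path e v p && uniq [:: w', v & p]].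
have [uw vw] : adj E u w /\ adj E v w' by case/and5P: s.
have cA : #|A| <= d.-1 ^ r.
  by apply: leq_trans (leq_imset_card _ _) _; apply: card_avoiding_paths.
have cB : #|B| <= d.-1 ^ r.
  apply: leq_trans (leq_imset_card _ _) _.
  apply: leq_trans (card_avoiding_paths hE k vw) _.
  by rewrite leq_pexp2l ?leq_subr //; lia.
suff sub : sphere E r.+1 w \subset K :|: A :|: B.
  have h := subset_leq_card sub.
  have h1 := (leq_card_setU (K :|: A) B).1; have h2 := (leq_card_setU K A).1.
  move: gw; rewrite /growing.
  have : 5 * d.-1 ^ r <= (2 * d).-1 * d.-1 ^ r by rewrite leq_mul2r; apply/orP; right; lia.
  lia.
apply/subsetP => x; rewrite inE => /eqP dx; rewrite !in_setU.
have [xK|nxK] := boolP (x \in K) => //=.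
have [p [pp lp sp]] := gdist_path (conn w x); rewrite -/e dx in sp.
have szp : size p = gdist e w (last w p) by rewrite lp dx.
have up := geodesic_uniq pp szp.
have wK : w \in K by rewrite inE connect0.
rewrite -lp in nxK; have [t [lt tK ntK]] := exit_index (P := mem K) wK nxK.
have et := path_adj pp lt.
have nocut : ~~ adj (cut E u w v w') (nth w (w :: p) t) (nth w (w :: p) t.+1).
  apply: contra ntK => et'; move: tK; rewrite !inE => h.
  exact: connect_trans h (connect1 et').
have uK : u \notin K by rewrite inE adj_csym.
have vK : v \notin K by rewrite inE adj_csym.
have dt : gdist e w (nth w (w :: p) t) = t by apply: geodesic_prefix => //; exact: ltnW.
move: nocut; rewrite adj_cut et andbT negb_and !negbK !set2_eq.
case/orP=> /orP[]/andP[/eqP e1 /eqP e2].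
- by move: tK; rewrite /= e1 (negPf uK).
- have t0 : t = 0 by rewrite -dt e1 gdistxx.
  rewrite t0 in e2; case: p e2 pp sp up lp {szp lt tK ntK et dt e1 nxK} => // u' p /= ->.
  case/andP=> _ pp [sp] up lp; apply/orP; left; apply/imsetP.
  have sz : size p == r by apply/eqP.
  by exists (Tuple sz); rewrite ?inE //= pp.
- by move: tK; rewrite /= e1 (negPf vK).
- rewrite e1 in dt; apply/orP; right; apply/imsetP.
  have pd := path_drop t.+1 pp; rewrite e2 in pd.
  have ld : last v (drop t.+1 p) = x by rewrite -e2 last_drop.
  have sz : size (drop t.+1 p) == k by rewrite size_drop sp subSS /k dt.
  have ud : uniq [:: w', v & drop t.+1 p].
    have := drop_uniq t up; rewrite (@drop_nth _ w t (w :: p) (leqW lt)) e1.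
    by rewrite (@drop_nth _ w t.+1 (w :: p) lt) e2.
  exists (Tuple sz); last by rewrite /= ld.
  by rewrite inE; apply/andP.
Qed.

End Detached.

(** * Graphs in which two given regular vertices are far apart *)

Section DistanceTail.
Variables (T : finType) (d r : nat) (y z : T).
Hypothesis d3 : 3 <= d.
Implicit Types (E : {set {set T}}) (x u v w : T).

Definition far_graphs : {set {set {set T}}} :=
  [set E in RG T d | [&& regular_at d E r y, regular_at d E r z &
    2 * r + 4 <= gdist (adj E) y z]].

(** One fixed parent per vertex, so that the pair of tips determines the switching; by [par_spec]
    the default [w] does not occur on the spheres considered. *)
Let par E x w := odflt w [pick u | adj E u w && (gdist (adj E) x w == (gdist (adj E) x u).+1)].

Let tips E x := [set w in sphere E r.+1 x | growing d E r w].

Let E' E w w' := switch E (par E y w) w (par E z w') w'.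

Let joined E w' := [set w in tips E y | connected_graph (E' E w w')].

Let par_spec E x w : E \in RG T d -> w \in sphere E r.+1 x ->
  [/\ adj E (par E x w) w, gdist (adj E) x (par E x w) = r & gdist (adj E) x w = r.+1].
Proof.
move=> hE; rewrite inE => /eqP xw.
have nxw : x != w by rewrite -(gdist_eq0 (RG_connect hE)) xw.
rewrite /par; case: pickP => [u /andP[uw /eqP]|no] /=; first by rewrite xw => -[<-].
have [u uw hu] := gdist_parent (RG_connect hE) nxw.
by move: (no u); rewrite uw hu eqxx.
Qed.

Let tips_site E w w' : E \in far_graphs -> w \in tips E y -> w' \in tips E z ->
  site r E y z (par E y w) w (par E z w') w'.
Proof.
rewrite inE => /and4P[hE _ _ yz]; rewrite inE => /andP[sw _]; rewrite inE => /andP[sw' _].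
have [h1 h2 h3] := par_spec hE sw; have [h4 h5 h6] := par_spec hE sw'.
by rewrite /site h1 h2 h3 h4 h5 h6 yz !eqxx.
Qed.

(** At least (5/2)(d-1)^r vertices on the sphere, of which at most (1/2)(d-1)^r are stunted. *)
Let card_tips E x : E \in RG T d -> regular_at d E r x -> 2 * d.-1 ^ r <= #|tips E x|.
Proof.
move=> hE /andP[gx st].
have sub : sphere E r.+1 x \subset tips E x :|: (stunted d E r :&: sphere E r.+1 x).
  apply/subsetP => w hw; rewrite in_setU in_setI hw andbT !inE; move: hw; rewrite inE => ->.
  exact: orbN.
have h := leq_trans (subset_leq_card sub) (leq_card_setU _ _).1.
move: gx st h; rewrite /growing; set a := #|sphere _ _ _|; set b := #|_ :&: _|; set c := #|tips _ _|.
have : 5 * d.-1 ^ r <= (2 * d).-1 * d.-1 ^ r by rewrite leq_mul2r; apply/orP; right; lia.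
by move: (d.-1 ^ r) ((2 * d).-1 * _) a b c => {sub} Z Y a b c; clear; lia.
Qed.

Let disconnected_spec E w w' : E \in far_graphs -> w \in tips E y -> w' \in tips E z ->
  ~~ connected_graph (E' E w w') ->
  let e0 := adj (cut E (par E y w) w (par E z w') w') in
  ~~ connect e0 (par E y w) w /\ ~~ connect e0 (par E z w') w.
Proof.
move=> hE _ _ nc; move: hE; rewrite !inE => /and4P[/and3P[_ _ cE] _ _ _].
have := contra (@switch_connected _ E _ _ _ _ cE) nc.
by rewrite !negb_or => /and4P[h1 _ h2 _].
Qed.

(** For fixed [w'], the parts cut off by the failing tips are disjoint and have at least (d-1)^r / 2
    vertices each, out of n in all. *)
Let few_disconnected E w' : E \in far_graphs -> w' \in tips E z ->
  #|tips E y :\: joined E w'| * d.-1 ^ r <= 2 * #|T|.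
Proof.
move=> hE hw'; have hR : E \in RG T d by move: hE; rewrite inE => /andP[].
set B := _ :\: _.
have hB w : w \in B -> w \in tips E y /\ ~~ connected_graph (E' E w w').
  rewrite in_setD in_set; case: (w \in tips E y) => //=; by rewrite andbT.
pose K w := detached E (par E y w) w (par E z w') w'.
apply: (@leq_trans (2 * \sum_(w in B) #|K w|)).
  rewrite -sum_nat_const big_distrr /=; apply: leq_sum => w /hB[hw nc].
  have [n1 n2] := disconnected_spec hE hw hw' nc.
  apply: (detached_large hR d3 (tips_site hE hw hw')) => //.
  by move: hw; rewrite inE => /andP[].
rewrite leq_mul2l /=.
under eq_bigr do rewrite -sum1_card.
rewrite (exchange_big_dep predT) //= -[X in _ <= X]sum1_card.
apply: leq_sum => x _; rewrite sum1_card; apply/card_le1_eqP => w1 w2 /andP[/hB[t1 c1] k1] /andP[/hB[t2 c2] k2].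
have [n1 _] := disconnected_spec hE t1 hw' c1.
have [n2 _] := disconnected_spec hE t2 hw' c2.
exact: esym (detached_disjoint hR (tips_site hE t1 hw') (tips_site hE t2 hw') n1 n2 k1 k2).
Qed.

Let joinable E := [set t : T * T | (t.1 \in tips E z) && (t.2 \in joined E t.1)].

(** In this range at most (d-1)^r of the at least 2(d-1)^r tips around [y] fail for each [w']. *)
Let card_joinable E : 2 * #|T| <= d.-1 ^ (2 * r) -> E \in far_graphs ->
  d.-1 ^ (2 * r) <= #|joinable E|.
Proof.
move=> large hE; have := hE; rewrite inE => /and4P[hR hy hz _].
have b0 : 0 < d.-1 ^ r by rewrite expn_gt0; apply/orP; left; lia.
have er : d.-1 ^ (2 * r) = d.-1 ^ r * d.-1 ^ r by rewrite -expnD addnn mul2n.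
rewrite (card_dep_pairs (tips E z) (joined E)).
apply: (@leq_trans (\sum_(w' in tips E z) d.-1 ^ r)).
  rewrite sum_nat_const er leq_mul2r; apply/orP; right.
  by have := card_tips hR hz; lia.
apply: leq_sum => w' hw'.
have h1 := few_disconnected hE hw'; have h2 := card_tips hR hy.
have h3 : #|tips E y :\: joined E w'| <= d.-1 ^ r.
  by rewrite -(leq_pmul2r b0) -er; apply: leq_trans h1 large.
have : #|tips E y| <= #|joined E w'| + #|tips E y :\: joined E w'|.
  rewrite -[X in X <= _](cardsID (joined E w')) leq_add2r.
  exact/subset_leq_card/subsetIr.
by move: h2 h3; clear; lia.
Qed.

(** Double counting of the switchings at pairs of tips: by [site_unique], the resulting graph and
    its edge [ww'], one of n d oriented edges, determine the original graph. *)
Lemma card_far_graphs : d.-1 ^ (2 * r) * #|far_graphs| <= #|T| * d * #|RG T d|.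
Proof.
(* In the second case (d-1)^(2r) < 2n <= n d, and the bound is trivial. *)
have [large|small] := leqP (2 * #|T|) (d.-1 ^ (2 * r)); last first.
  apply: leq_mul; last by apply/subset_leq_card/subsetP => E; rewrite inE => /andP[].
  by apply: leq_trans (ltnW small) _; rewrite mulnC leq_mul2l ltnW ?orbT.
pose S := [set t : {set {set T}} * (T * T) | (t.1 \in far_graphs) && (t.2 \in joinable t.1)].
pose S' := [set t : {set {set T}} * (T * T) |
  (t.1 \in RG T d) && (t.2 \in [set p : T * T | (p.1 \in [set: T]) && adj t.1 p.1 p.2])].
have cS' : #|S'| = #|T| * d * #|RG T d|.
  rewrite (card_dep_pairs _ (fun E => [set p : T * T | (p.1 \in [set: T]) && adj E p.1 p.2])).
  rewrite mulnC -sum_nat_const; apply: eq_bigr => E hE.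
  by rewrite (card_adj_pairs _ hE) cardsT.
have cS : d.-1 ^ (2 * r) * #|far_graphs| <= #|S|.
  rewrite (card_dep_pairs _ joinable) mulnC -sum_nat_const.
  by apply: leq_sum => E; exact: card_joinable.
apply: leq_trans cS _; rewrite -cS'.
pose f (t : {set {set T}} * (T * T)) := (E' t.1 t.2.2 t.2.1, (t.2.2, t.2.1)).
have facts t : t \in S -> [/\ t.1 \in RG T d,
    site r t.1 y z (par t.1 y t.2.2) t.2.2 (par t.1 z t.2.1) t.2.1 &
    E' t.1 t.2.2 t.2.1 \in RG T d].
  rewrite in_set => /andP[hE]; rewrite in_set => /andP[h1]; rewrite in_set => /andP[h2 h3].
  have hR : t.1 \in RG T d by move: hE; rewrite inE => /andP[].
  have hs := tips_site hE h2 h1; split=> //.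
  by rewrite switch_RG //; exact: site_switchable hR hs.
rewrite -(card_in_imset (f := f) (D := mem S)); last first.
  move=> [E1 [a b]] [E2 [a' b']] /facts[/= h1 h2 h3] /facts[/= h4 h5 h6] [] eE eb ea.
  subst a' b'; congr (_, _); exact: site_unique h1 h4 h2 h5 eE h3.
apply/subset_leq_card/subsetP => _ /imsetP[[E [a b]] /facts[/= h1 h2 h3] ->].
by rewrite in_set h3 in_set /= in_setT adj_switch eqxx !orbT.
Qed.

End DistanceTail.

(** * Geodesics that come close to each other *)

Lemma pedges_nth (T : finType) (x a b : T) p : [set a; b] \in pedges x p ->
  exists2 h, h < size p &
    [set a; b] = [set nth x (x :: p) h; nth x (x :: p) h.+1].
Proof.
elim: p x => //= y p IH x; rewrite inE => /orP[/eqP ->|/IH[h hp ->]].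
  by exists 0.
exists h.+1; rewrite //= (set_nth_default x) ?(set_nth_default x y) //=.
exact: ltnW.
Qed.

Section Approach.
Variables (T : finType) (d : nat) (E : {set {set T}}).
Hypothesis hE : E \in RG T d.
Let e := adj E.
Let conn := RG_connect hE.

Definition geodesic (x : T) (p : seq T) :=
  path (adj E) x p && (size p == gdist (adj E) x (last x p)).

Lemma geodesic_le x p v : geodesic x p -> v \in x :: p -> gdist e x v <= size p.
Proof.
move=> /andP[pp /eqP sp] vp; rewrite -(nth_index x vp) geodesic_prefix //.
  by rewrite -ltnS (leq_trans _ (leqnn (size (x :: p)))) // index_mem.
by rewrite -ltnS (leq_trans _ (leqnn (size (x :: p)))) // index_mem.
Qed.

Lemma geodesic_dist x p i : geodesic x p -> i <= size p -> gdist e x (nth x (x :: p) i) = i.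
Proof. by move=> /andP[pp /eqP sp]; exact: geodesic_prefix. Qed.

Lemma geodesic_nth_inj x p q i j : geodesic x p -> geodesic x q ->
  i <= size p -> j <= size q -> nth x (x :: p) i = nth x (x :: q) j -> i = j.
Proof. by move=> gp gq hi hj h; rewrite -(geodesic_dist gp hi) h geodesic_dist. Qed.

Lemma geodesic_take x p i : geodesic x p -> i <= size p -> geodesic x (take i p).
Proof.
move=> gp hi; have /andP[pp _] := gp; rewrite /geodesic path_take //= last_take //.
by rewrite (geodesic_dist gp hi) size_take_min (minn_idPl hi).
Qed.

Lemma geodesic_uniqP x p : geodesic x p -> uniq (x :: p).
Proof. by move=> /andP[pp /eqP sp]; exact: geodesic_uniq pp sp. Qed.

(** The trace of two geodesics of length at most L from [y], to [x] and to [z], that enter a common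
    vertex [v] by different edges. *)
Definition crossing L y x z := [exists h : 'I_L.+1, exists v : T,
  [&& 0 < h, v \in sphere E h y, low_pairs E y v != set0,
      gdist (adj E) v x <= L - h & gdist (adj E) v z <= L - h]].

(** The trace of two such geodesics linked by a short path: the legs run along them, and the last
    two walks lead to the two ends of an edge of the link. *)
Definition detour k L y x z :=
  [exists i : 'I_L.+1, exists j : 'I_L.+1, exists q : 'I_k, exists q' : 'I_k,
   exists t in @thetas T i j q q' E, let: (y', P, Q, _, _) := t in
   [&& q + q' < k, y' == y, gdist (adj E) (last y P) x <= L - i &
       gdist (adj E) (last y Q) z <= L - j]].

Section Fork.
Variables (y : T) (P Q : seq T).
Hypotheses (gP : geodesic y P) (gQ : geodesic y Q).

(** At the first index after [c] where the geodesics agree again, their preceding vertices differ,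
    and both are low neighbours of the common vertex. *)
Lemma rejoin_crossing L c h : size P <= L -> size Q <= L ->
  nth y (y :: P) c <> nth y (y :: Q) c -> c <= h -> h <= size P -> h <= size Q ->
  nth y (y :: P) h = nth y (y :: Q) h -> crossing L y (last y P) (last y Q).
Proof.
move=> lP lQ nc ch hP hQ eqh.
pose pr h := (c < h) && (nth y (y :: P) h == nth y (y :: Q) h).
have prh : pr h.
  rewrite /pr eqh eqxx andbT ltn_neqAle ch andbT.
  by apply/eqP => ech; apply: nc; rewrite ech.
have [[//|m] /andP[cm /eqP em] minm] := ex_minnP (ex_intro (fun h => pr h) h prh).
have mh : m.+1 <= h := minm h prh.
have npq : nth y (y :: P) m != nth y (y :: Q) m.
  move: cm; rewrite ltnS leq_eqVlt => /orP[/eqP <-|cm]; first exact/eqP.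
  by apply/negP => em'; have := minm m; rewrite /pr cm em' ltnn => /(_ isT).
have mP : m.+1 <= size P := leq_trans mh hP; have mQ : m.+1 <= size Q := leq_trans mh hQ.
have hm : m.+1 < L.+1 by rewrite ltnS (leq_trans mP).
have /andP[pP /eqP sP] := gP; have /andP[pQ /eqP sQ] := gQ.
have av := path_adj pP mP; have aq := path_adj pQ mQ.
have dv := geodesic_dist gP mP.
have vx : gdist e (nth y (y :: P) m.+1) (last y P) <= L - m.+1.
  by rewrite geodesic_suffix // leq_sub2r.
have vz : gdist e (nth y (y :: P) m.+1) (last y Q) <= L - m.+1.
  by rewrite em geodesic_suffix // leq_sub2r.
rewrite -em in aq; move: (nth y (y :: P) m.+1) av aq dv vx vz => v av aq dv vx vz.
apply/existsP; exists (Ordinal hm); apply/existsP; exists v.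
rewrite inE -/e dv eqxx vx vz !andbT /=.
apply/set0Pn; exists (nth y (y :: P) m, nth y (y :: Q) m).
rewrite !inE /= npq -/e dv (geodesic_dist gP (ltnW mP)) (geodesic_dist gQ (ltnW mQ)) leqnSn.
by rewrite /e !(adj_sym E v) av aq.
Qed.

(** Some edge of the link [R] lies outside the initial pieces of [P] and [Q]. Otherwise [R] would
    move along [P] one index at a time and stay at indices at least [c], where [P] and [Q] do not
    meet, although it ends on [Q]. This edge closes the cycle; the parts of [R] before and after it
    are replaced by geodesics. *)
Lemma short_link_detour k L c i j : size P <= L -> size Q <= L ->
  i <= size P -> j <= size Q -> c + k <= i ->
  gdist e (nth y (y :: P) i) (nth y (y :: Q) j) <= k ->
  (forall h, c <= h -> h <= size P -> h <= size Q -> nth y (y :: P) h <> nth y (y :: Q) h) ->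
  detour k L y (last y P) (last y Q).
Proof.
move=> lP lQ hi hj ci short apart.
set m := nth y (y :: P) i in short *; set w := nth y (y :: Q) j in short *.
have [R [pR lR sR]] := gdist_path (conn m w).
set l := size R in sR; have lk : l <= k by rewrite sR.
have gR : geodesic m R by rewrite /geodesic pR lR -sR eqxx.
pose F := pedges y (take i P) ++ pedges y (take j Q).
have [t tl abF] : exists2 t, t < l & [set nth m (m :: R) t; nth m (m :: R) t.+1] \notin F.
  have [/existsP[t ht]|/existsPn no] :=
      boolP [exists t : 'I_l, [set nth m (m :: R) t; nth m (m :: R) t.+1] \notin F].
    by exists t.
  have inv t : t <= l -> exists h, [/\ i <= h + t, h <= i & nth m (m :: R) t = nth y (y :: P) h].
    elim: t => [|t IH] tl; first by exists i; rewrite addn0.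
    have [h [h1 h2 h3]] := IH (ltnW tl).
    have := no (Ordinal tl); rewrite negbK /= mem_cat => /orP[|] hF.
      have [a ha] := pedges_nth hF.
      rewrite size_takel // in ha.
      have tk s : s <= i -> nth y (y :: take i P) s = nth y (y :: P) s.
        by case: s => [|s] //= hs; rewrite nth_take.
      rewrite (tk a (ltnW ha)) (tk a.+1 ha).
      rewrite h3 => /eqP; rewrite set2_eq.
      have haP : a < size P := leq_trans ha hi.
      case/orP=> /andP[/eqP e1 /eqP e2].
        have ah : h = a := geodesic_nth_inj gP gP (leq_trans h2 hi) (ltnW haP) e1.
        by exists a.+1; rewrite -e2; split=> //; lia.
      have ah : h = a.+1 := geodesic_nth_inj gP gP (leq_trans h2 hi) haP e1.
      by exists a; rewrite -e2; split=> //; lia.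
    have := pedges_vertex hF; rewrite h3 => hQ; exfalso.
    have {hQ} /(nthP y)[b]: nth y (y :: P) h \in y :: take j Q by [].
    rewrite /= size_takel // ltnS => hb.
    have -> : nth y (y :: take j Q) b = nth y (y :: Q) b.
      by case: b hb => [|b] //= hb; rewrite nth_take.
    move=> eqb; have hbQ : b <= size Q := leq_trans hb hj.
    have hhP := leq_trans h2 hi.
    have bh : b = h := geodesic_nth_inj gQ gP hbQ hhP eqb.
    by apply: (apart h) => //; [lia|rewrite -bh|rewrite -eqb bh].
  have [h [h1 h2 h3]] := inv l (leqnn l).
  have hw : nth m (m :: R) l = w by rewrite -(last_nth m) lR.
  have hhP := leq_trans h2 hi.
  have jh : j = h by apply: (geodesic_nth_inj gQ gP hj hhP); rewrite -/w -hw h3.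
  case: (apart h) => //; [lia|by rewrite -jh|].
  by rewrite -h3 hw /w jh.
set a := nth m (m :: R) t in abF; set b := nth m (m :: R) t.+1 in abF.
have ab : e a b := path_adj pR tl.
have [S1 [p1 l1 s1]] := gdist_path (conn m a).
have [S2 [p2 l2 s2]] := gdist_path (conn w b).
have ma : gdist e m a = t := geodesic_dist gR (ltnW tl).
have mb : gdist e m b = t.+1 := geodesic_dist gR tl.
have szR : size R = gdist (adj E) m (last m R) by rewrite lR.
have wa : gdist e w a = l - t.
  by rewrite (gdist_sym conn (@adj_sym T E)) -lR geodesic_suffix // ltnW.
have wb : gdist e w b = l - t.+1.
  by rewrite (gdist_sym conn (@adj_sym T E)) -lR geodesic_suffix.
have g1 : geodesic m S1 by rewrite /geodesic p1 l1 -s1 eqxx.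
have g2 : geodesic w S2 by rewrite /geodesic p2 l2 -s2 eqxx.
have bS1 : b \notin m :: S1.
  by apply/negP => /(geodesic_le g1); rewrite -/e in s1; rewrite mb s1 ma ltnn.
have aS2 : a \notin w :: S2.
  by apply/negP => /(geodesic_le g2); rewrite -/e in s2; rewrite wa s2 wb; move: tl; clear; lia.
have iL : i < L.+1 by rewrite ltnS (leq_trans hi).
have jL : j < L.+1 by rewrite ltnS (leq_trans hj).
have tk : t < k := leq_trans tl lk.
have tk' : l - t.+1 < k by move: tl lk; clear; lia.
apply/existsP; exists (Ordinal iL); apply/existsP; exists (Ordinal jL).
apply/existsP; exists (Ordinal tk); apply/existsP; exists (Ordinal tk').
have z1 : size (take i P) == i by rewrite size_takel.
have z2 : size (take j Q) == j by rewrite size_takel.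
have z3 : size S1 == t by rewrite s1 -/e ma.
have z4 : size S2 == l - t.+1 by rewrite s2 -/e wb.
apply/existsP; exists (y, Tuple z1, Tuple z2, Tuple z3, Tuple z4).
have lm : last y (take i P) = m by rewrite last_take.
have lw : last y (take j Q) = w by rewrite last_take.
have /andP[pP /eqP sP] := gP; have /andP[pQ /eqP sQ] := gQ.
apply/andP; split; last first.
  rewrite /= eqxx lm lw /=; apply/and3P; split; first by move: tl lk; clear; lia.
    by rewrite geodesic_suffix // leq_sub2r.
  by rewrite geodesic_suffix // leq_sub2r.
rewrite !in_set; apply/andP; split; last first.
  rewrite /= lm lw l1 l2 [adj E a b]ab andbT catA mem_cat negb_or abF /= mem_cat negb_or.
  apply/andP; split; last by apply: contra aS2 => /pedges_vertex.
  by rewrite setUC; apply: contra bS1 => /pedges_vertex.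
rewrite -[theta_uniq _]/([&& uniq (y :: take i P), uniq (y :: take j Q),
  uniq (last y (take i P) :: S1) & uniq (last y (take j Q) :: S2)]).
rewrite lm lw !geodesic_uniqP ?geodesic_take //.
by rewrite /= lm lw !all_cat -!path_pedges p1 p2 !path_take.
Qed.

(* Unless P and Q still agree at distance c from y, the union of P, Q and a
   geodesic of length at most k joining them contains a cycle. *)
Lemma close_geodesics k L i j c : c = (size P)./2 - k -> size P <= L -> size Q <= L ->
  i <= size P -> size P <= i.*2.+1 -> j <= size Q ->
  gdist e (nth y (y :: P) i) (nth y (y :: Q) j) <= k ->
  [|| (c <= size Q) && (nth y (y :: P) c == nth y (y :: Q) c),
      crossing L y (last y P) (last y Q) | detour k L y (last y P) (last y Q)].
Proof.
move=> cE lP lQ hi Pi hj short.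
have hiP : (size P)./2 <= i by lia.
have dij : i <= j + k.
  have := gdist_triangle conn y (nth y (y :: Q) j) (nth y (y :: P) i).
  rewrite (gdist_sym conn (@adj_sym T E) (nth y (y :: Q) j)) -/e.
  by rewrite (geodesic_dist gP hi) (geodesic_dist gQ hj); move: short; clear; lia.
have cQ : c <= size Q by move: cE hiP dij hj; clear; lia.
rewrite cQ; have [//|/eqP nc] := eqVneq (nth y (y :: P) c) (nth y (y :: Q) c).
have c0 : 0 < c by rewrite lt0n; apply/eqP => c0; apply: nc; rewrite c0.
rewrite /=; apply/orP.
have [/existsP[h /and3P[h1 h2 /eqP h3]]|/existsPn no] :=
  boolP [exists h : 'I_(size P).+1, [&& c <= h, h <= size Q & nth y (y :: P) h == nth y (y :: Q) h]].
  by left; apply: (rejoin_crossing lP lQ nc h1 _ h2 h3); rewrite -ltnS.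
right; apply: (short_link_detour lP lQ hi hj (c := c)) => //.
  by move: cE hiP c0; clear; lia.
move=> h ch hP hQ eqh; have := no (Ordinal (hP : h < (size P).+1)).
by rewrite /= ch hQ; apply/negP; rewrite negbK; apply/eqP.
Qed.

End Fork.
End Approach.

Lemma sum_pow_le b n : 1 < b -> \sum_(i < n.+1) b ^ i <= 2 * b ^ n.
Proof.
move=> hb; elim: n => [|n IH]; first by rewrite big_ord1 expn0.
rewrite big_ord_recr /= mul2n -addnn leq_add2r; apply: leq_trans IH _.
by rewrite expnS leq_mul2r hb orbT.
Qed.

Lemma sum_pow_half_le b n : 1 < b -> \sum_(i < n.+1) b ^ i./2 <= 4 * b ^ n./2.
Proof.
move=> hb; have dbl m : \sum_(i < m.*2) b ^ i./2 = 2 * \sum_(i < m) b ^ i.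
  elim: m => [|m IH]; first by rewrite !big_ord0.
  by rewrite doubleS !big_ord_recr /= IH uphalf_double doubleK -addnA addnn -mul2n mulnDr.
have le : n.+1 <= (n./2.+1).*2 by lia.
apply: (@leq_trans (\sum_(i < (n./2.+1).*2) b ^ i./2)).
  rewrite (big_ord_widen _ (fun i => b ^ i./2) le) [X in _ <= X](bigID (fun i : 'I__ => i < n.+1)) /=.
  exact: leq_addr.
by rewrite dbl (_ : 4 = 2 * 2) // -mulnA leq_mul2l sum_pow_le.
Qed.

(** * Expected numbers of crossings and detours *)

Section Counting.
Variables (T : finType) (d : nat).
Hypothesis d3 : 3 <= d.

Definition crossings (E : {set {set T}}) L : {set T * T * T} :=
  [set t | crossing E L t.1.1 t.1.2 t.2].
Definition detours (E : {set {set T}}) k L : {set T * T * T} :=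
  [set t | detour E k L t.1.1 t.1.2 t.2].

Let ball (E : {set {set T}}) x r : {set T} := [set y | gdist (adj E) x y <= r].

(** Given [y] and [v], both other corners lie in the ball of radius L-h around [v], which has at
    most 4(d-1)^(L-h) vertices. *)
Lemma card_crossings E L : E \in RG T d ->
  #|crossings E L| <= \sum_(h < L.+1 | 0 < h) (\sum_y collisions E h y) * (16 * d.-1 ^ (2 * (L - h))).
Proof.
move=> hE.
pose F (h : 'I_L.+1) (y v : T) : {set T * T * T} :=
  (fun t : T * T => (y, t.1, t.2)) @: setX (ball E v (L - h)) (ball E v (L - h)).
have sub : crossings E L \subset \bigcup_(h < L.+1 | 0 < h) \bigcup_(y : T)
    \bigcup_(v in sphere E h y | low_pairs E y v != set0) F h y v.
  apply/subsetP => -[[y x] z]; rewrite inE => /existsP[h /existsP[v /and5P[h0 hv hl vx vz]]].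
  apply/bigcupP; exists h => //; apply/bigcupP; exists y => //.
  apply/bigcupP; exists v; first by rewrite hv.
  by apply/imsetP; exists (x, z); rewrite // !inE vx vz.
apply: leq_trans (subset_leq_card sub) _; apply: leq_trans (card_bigcup_le _ _) _.
apply: leq_sum => h _; apply: leq_trans (card_bigcup_le _ _) _.
rewrite big_distrl /=; apply: leq_sum => y _; apply: leq_trans (card_bigcup_le _ _) _.
rewrite /collisions big_distrl /= [X in _ <= X](bigID (fun v => low_pairs E y v != set0)) /=.
apply: leq_trans (leq_addr _ _); apply: leq_sum => v /andP[_ hl].
apply: leq_trans (leq_imset_card _ _) _; rewrite cardsX -[X in X <= _]mul1n.
apply: leq_mul; first by rewrite card_gt0.
rewrite mul2n -addnn expnD (_ : 16 = 4 * 4) // mulnACA.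
by apply: leq_mul; exact: card_ball.
Qed.

Lemma card_detours E k L : E \in RG T d ->
  #|detours E k L| <= \sum_(i < L.+1) \sum_(j < L.+1) \sum_(q < k) \sum_(q' < k | q + q' < k)
    #|thetas i j q q' E| * (16 * d.-1 ^ (2 * L - i - j)).
Proof.
move=> hE.
pose F i j q q' (t : theta T i j q q') : {set T * T * T} :=
  let: (y, P, Q, _, _) := t in
  (fun t : T * T => (y, t.1, t.2)) @: setX (ball E (last y P) (L - i)) (ball E (last y Q) (L - j)).
have sub : detours E k L \subset \bigcup_(i < L.+1) \bigcup_(j < L.+1) \bigcup_(q < k)
    \bigcup_(q' < k | q + q' < k) \bigcup_(t in thetas i j q q' E) F i j q q' t.
  apply/subsetP => -[[y x] z]; rewrite inE.
  move=> /existsP[i /existsP[j /existsP[q /existsP[q' /existsP[t /andP[ht ht']]]]]].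
  apply/bigcupP; exists i => //; apply/bigcupP; exists j => //; apply/bigcupP; exists q => //.
  apply/bigcupP; exists q'; first by case: t ht' {ht} => [[[[? ?] ?] ?] ?] /and4P[].
  apply/bigcupP; exists t => //; case: t ht' {ht} => [[[[y' P] Q] V] W] /and4P[_ /eqP -> h1 h2].
  by apply/imsetP; exists (x, z); rewrite // !inE h1 h2.
apply: leq_trans (subset_leq_card sub) _; do 4 (apply: leq_trans (card_bigcup_le _ _) _; apply: leq_sum => ? _).
apply: leq_trans (card_bigcup_le _ _) _; rewrite -sum_nat_const; apply: leq_sum => -[[[[y P] Q] V] W] _.
apply: leq_trans (leq_imset_card _ _) _; rewrite cardsX.
apply: leq_trans (leq_mul (card_ball hE d3 _ _) (card_ball hE d3 _ _)) _.
rewrite mulnACA -expnD leq_mul2l /= leq_pexp2l //; first by lia.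
set i := nat_of_ord _; set j := nat_of_ord _.
by have : i < L.+1 := ltn_ord _; have : j < L.+1 := ltn_ord _; rewrite /i /j; lia.
Qed.

Section Expectation.
Variables H L k : nat.
Hypothesis large : #|T| + 4 * H + 4 * d * d.+1 <= #|T| * d.
Hypothesis hL : L + k < H.

(** The bound (d-1)^(2h) for collisions at height h and (d-1)^(2(L-h)) for the corners multiply to
    the same power for each of the L+1 heights. *)
Lemma sum_crossings : \sum_(E in RG T d) #|crossings E L| <=
  2048 * d ^ 3 * L.+1 * d.-1 ^ (2 * L) * #|RG T d|.
Proof.
apply: (@leq_trans (\sum_(E in RG T d) \sum_(h < L.+1 | 0 < h)
  (\sum_y collisions E h y) * (16 * d.-1 ^ (2 * (L - h))))).
  by apply: leq_sum => E; exact: card_crossings.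
rewrite exchange_big /=.
apply: (@leq_trans (\sum_(h < L.+1) 2048 * d ^ 3 * d.-1 ^ (2 * L) * #|RG T d|)); last first.
  by rewrite sum_nat_const card_ord; apply: eq_leq; ring.
rewrite [X in _ <= X](bigID (fun h : 'I_L.+1 => 0 < h)) /=; apply: leq_trans (leq_addr _ _).
apply: leq_sum => h h0; rewrite -big_distrl /=.
have hh : h < H by have := ltn_ord h; lia.
apply: leq_trans (leq_mul (sum_sum_collisions d3 large h0 hh) (leqnn _)) _.
have -> : 2 * L = 2 * h + 2 * (L - h) by have := ltn_ord h; lia.
by rewrite expnD; apply: eq_leq; ring.
Qed.

(** The legs i and j cancel against the radii L-i and L-j of the balls for the corners, and q+q' < k
    leaves the factor (d-1)^k. *)
Lemma sum_detours : \sum_(E in RG T d) #|detours E k L| <=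
  512 * d ^ 2 * L.+1 ^ 2 * k ^ 2 * d.-1 ^ (2 * L + k) * #|RG T d|.
Proof.
apply: (@leq_trans (\sum_(E in RG T d) \sum_(i < L.+1) \sum_(j < L.+1) \sum_(q < k)
    \sum_(q' < k | q + q' < k) #|thetas i j q q' E| * (16 * d.-1 ^ (2 * L - i - j)))).
  by apply: leq_sum => E; exact: card_detours.
pose C := 512 * d ^ 2 * d.-1 ^ (2 * L + k) * #|RG T d|.
apply: (@leq_trans (\sum_(i < L.+1) \sum_(j < L.+1) \sum_(q < k) \sum_(q' < k) C)); last first.
  by rewrite !sum_nat_const !card_ord /C; apply: eq_leq; ring.
rewrite exchange_big /=; apply: leq_sum => i _.
rewrite exchange_big /=; apply: leq_sum => j _.
rewrite exchange_big /=; apply: leq_sum => q _.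
rewrite exchange_big /= [X in _ <= X](bigID (fun q' : 'I_k => q + q' < k)) /=.
apply: leq_trans (leq_addr _ _); apply: leq_sum => q' qq.
have iL := ltn_ord i; have jL := ltn_ord j.
have n0 : 0 < #|T| by rewrite lt0n; apply: contraTneq large => ->; lia.
rewrite -big_distrl /=.
apply: leq_trans (leq_mul (sum_card_thetas d3 n0 _) (leqnn _)) _; first by lia.
apply: (@leq_trans (512 * d ^ 2 * d.-1 ^ (i + j + q + q' + (2 * L - i - j)) * #|RG T d|)).
  by rewrite (expnD _ (i + j + q + q')); apply: eq_leq; ring.
rewrite leq_mul2r; apply/orP; right; rewrite leq_mul2l; apply/orP; right.
by rewrite leq_pexp2l //; lia.
Qed.

End Expectation.
End Counting.

(** * Triangles *)

Lemma rev_path_cons (T : Type) (x : T) p : last x p :: rev (belast x p) = rev (x :: p).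
Proof. by rewrite [in RHS]lastI rev_rcons. Qed.

Lemma last_rev_belast (T : Type) (x : T) p : last (last x p) (rev (belast x p)) = x.
Proof. by rewrite (last_nth x) rev_path_cons size_rev size_belast nth_rev //= subnn. Qed.

Section Triangles.
Variables (T : finType) (d : nat) (E : {set {set T}}).
Hypothesis d3 : 3 <= d.
Hypothesis hE : E \in RG T d.
Let e := adj E.
Let conn := RG_connect hE.
Let sym := @adj_sym T E.

Lemma geodesic_rev x p : geodesic E x p -> geodesic E (last x p) (rev (belast x p)).
Proof.
move=> /andP[pp /eqP sp]; rewrite /geodesic last_rev_belast rev_path (eq_path (e' := adj E)) ?pp //=.
by rewrite size_rev size_belast sp gdist_sym.
Qed.

(* Two geodesics from y, one of them to x, that agree up to distance c from y,
   seen from the longer one: it determines the shorter one up to distance c,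
   which leaves few choices for the other end of the shorter one. *)
Definition early_merge k L y (Q : seq T) x :=
  let c := (gdist (adj E) y x)./2 - k in
  [&& size Q <= L, gdist (adj E) y x <= size Q &
    gdist (adj E) (nth y (y :: Q) c) x == gdist (adj E) y x - c].

Definition late_merge k L y (P : seq T) z :=
  let c := (size P)./2 - k in
  (size P <= L) && (gdist (adj E) (nth y (y :: P) c) z <= size P - c).

(** If [x] is at distance h from [y], then it is at distance at most h/2 + k + 1 from a vertex of
    [Q] fixed by h. The sum over h is geometric. *)
Lemma card_early_merge k L y Q :
  #|[set x | early_merge k L y Q x]| <= (size Q <= L) * (8 * d.-1 ^ k.+1 * d.-1 ^ (size Q)./2).
Proof.
rewrite /early_merge; case: (leqP (size Q) L) => hQ; last first.
  by rewrite /= mul0n leqn0 cards_eq0; apply/eqP/setP => x; rewrite !inE.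
rewrite mul1n /=; have b2 : 1 < d.-1 by lia.
pose c h := h./2 - k.
have sub : [set x | (gdist e y x <= size Q) &&
    (gdist e (nth y (y :: Q) (c (gdist e y x))) x == gdist e y x - c (gdist e y x))] \subset
  \bigcup_(h < (size Q).+1) sphere E (h - c h) (nth y (y :: Q) (c h)).
  apply/subsetP => x; rewrite inE -ltnS => /andP[lt h].
  by apply/bigcupP; exists (Ordinal lt); rewrite // inE.
apply: leq_trans (subset_leq_card sub) _; apply: leq_trans (card_bigcup_le _ _) _.
apply: (@leq_trans (\sum_(h < (size Q).+1) 2 * d.-1 ^ k.+1 * d.-1 ^ h./2)).
  apply: leq_sum => h _; apply: leq_trans (card_sphere hE d3 _ _) _.
  by rewrite -mulnA -expnD leq_mul2l /= leq_pexp2l //; [exact: ltnW|rewrite /c; lia].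
rewrite -big_distrr /=; apply: leq_trans (leq_mul (leqnn _) (sum_pow_half_le _ b2)) _.
by apply: eq_leq; ring.
Qed.

Lemma card_late_merge k L y P :
  #|[set z | late_merge k L y P z]| <= (size P <= L) * (8 * d.-1 ^ k.+1 * d.-1 ^ (size P)./2).
Proof.
rewrite /late_merge; case: (leqP (size P) L) => hP; last first.
  by rewrite /= mul0n leqn0 cards_eq0; apply/eqP/setP => x; rewrite !inE.
rewrite mul1n /=; apply: leq_trans (card_ball hE d3 _ _) _.
rewrite -mulnA -expnD leq_mul // leq_pexp2l //; lia.
Qed.

(** Which alternative holds depends on which of the two geodesics is longer. *)
Lemma merge_early_late k L y P Q c : geodesic E y P -> geodesic E y Q ->
  c = (size P)./2 - k -> size P <= L -> size Q <= L ->
  c <= size Q -> nth y (y :: P) c = nth y (y :: Q) c ->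
  early_merge k L y Q (last y P) || late_merge k L y P (last y Q).
Proof.
move=> gP gQ cE lP lQ cQ eqc; have /andP[pP /eqP sP] := gP; have /andP[pQ /eqP sQ] := gQ.
have cP : c <= size P by lia.
rewrite /early_merge /late_merge -sP -cE lP lQ /=; case: (leqP (size P) (size Q)) => /= hs.
  by rewrite -eqc geodesic_suffix ?eqxx.
by rewrite eqc geodesic_suffix // leq_sub2r // ltnW.
Qed.

Definition fork_at k L y (P Q : seq T) x z :=
  [|| early_merge k L y Q x, late_merge k L y P z, crossing E L y x z | detour E k L y x z].

Lemma close_fork k L y P Q i j : geodesic E y P -> geodesic E y Q ->
  size P <= L -> size Q <= L -> i <= size P -> size P <= i.*2.+1 -> j <= size Q ->
  gdist e (nth y (y :: P) i) (nth y (y :: Q) j) <= k ->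
  fork_at k L y P Q (last y P) (last y Q).
Proof.
move=> gP gQ lP lQ hi Pi hj short; rewrite /fork_at.
have := close_geodesics hE gP gQ (erefl _) lP lQ hi Pi hj short.
case/or3P=> [/andP[cQ /eqP eqc]|->|->]; rewrite ?orbT //.
by case/orP: (merge_early_late gP gQ erefl lP lQ cQ eqc) => ->; rewrite ?orbT.
Qed.

Section OneTriangle.
Variables (x y z : T) (p q r : seq T) (k L : nat).
Hypotheses (gp : geodesic E x p) (gq : geodesic E y q) (gr : geodesic E z r).
Hypotheses (lp : last x p = y) (lq : last y q = z) (lr : last z r = x).
Hypotheses (sp : size p <= L) (sq : size q <= L) (sr : size r <= L).

Let p' := rev (belast x p).
Let r' := rev (belast z r).

Definition forked := fork_at k L y p' q x z || fork_at k L x p r' y z.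

Let gp' : geodesic E y p'. Proof. by have := geodesic_rev gp; rewrite lp. Qed.
Let gr' : geodesic E x r'. Proof. by have := geodesic_rev gr; rewrite lr. Qed.

Let side_nth u (s : seq T) v : v \in u :: s -> exists2 i, i <= size s & nth u (u :: s) i = v.
Proof.
by move=> hv; exists (index v (u :: s)); [rewrite -ltnS index_mem|rewrite nth_index].
Qed.

(** Seen from [y], the vertex lies beyond the midpoint of the side [x,y], up to rounding, so the
    fork is at [y]; [near_previous] is the mirror image at [x]. *)
Lemma near_next i v : i <= size p -> v \in y :: q -> (size p <= (size p - i).*2.+1) ->
  gdist e (nth x (x :: p) i) v <= k -> forked.
Proof.
move=> hi /side_nth[j hj <-] mid short; apply/orP; left.
have szp' : size p' = size p by rewrite size_rev size_belast.
have lp' : last y p' = x by rewrite -lp last_rev_belast.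
have nth' : nth y (y :: p') (size p - i) = nth x (x :: p) i.
  have -> : y :: p' = rev (x :: p) by rewrite -lp rev_path_cons.
  rewrite nth_rev /= ?ltnS ?leq_subr // subSS subKn //.
  by apply: set_nth_default.
have := @close_fork k L y p' q (size p - i) j gp' gq.
by rewrite lp' lq szp' nth'; apply; rewrite // leq_subr.
Qed.

Lemma near_previous i v : i <= size p -> v \in z :: r -> size p <= i.*2.+1 ->
  gdist e (nth x (x :: p) i) v <= k -> forked.
Proof.
move=> hi hv mid short; apply/orP; right.
have szr' : size r' = size r by rewrite size_rev size_belast.
have lr' : last x r' = z by rewrite -lr last_rev_belast.
have {hv} : v \in x :: r' by rewrite -lr rev_path_cons mem_rev.
case/side_nth => j hj hv; have := @close_fork k L x p r' i j gp gr'.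
by rewrite lp lr' szr' hv; apply; rewrite // -szr'.
Qed.

Lemma slim_forked (A B C : {set T}) : A =i x :: p -> B =i y :: q -> C =i z :: r ->
  k < #|T| -> slim e A B C <= k -> forked.
Proof.
move=> hA hB hC kT; rewrite /slim /least; set pr := fun k => _ => le.
(* The search defining [slim] succeeds, since its result is at most k < [#|T|]. *)
have lt : find pr (iota 0 #|T|) < #|T| := leq_ltn_trans le kT.
have hp : has pr (iota 0 #|T|) by rewrite has_find size_iota.
have := nth_find 0 hp; rewrite nth_iota // add0n; set s := find _ _ in le lt *.
case/and3P => /forall_inP h _ _.
have hi : (size p)./2 <= size p by clear; lia.
(* The rounded midpoint satisfies the conditions of both [near_next] and [near_previous], so it may
   be close to either of the other sides. *)
have mA : nth x (x :: p) (size p)./2 \in A by rewrite hA mem_nth.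
have /exists_inP[v] := h _ mA; rewrite inE => /orP[hv|hv] short.
  by apply: (near_next hi (v := v)); rewrite -?hB //; [clear; lia|exact: leq_trans short le].
by apply: (near_previous hi (v := v)); rewrite -?hC //; [clear; lia|exact: leq_trans short le].
Qed.

Lemma minn_big_le (I : finType) (A : {set I}) (f : I -> nat) N m : m < N ->
  \big[minn/N]_(u in A) f u <= m -> exists2 u, u \in A & f u <= m.
Proof.
move=> mN; elim/big_ind: _ => [|a b IHa IHb|u uA le]; first by rewrite leqNgt mN.
  by rewrite geq_min => /orP[/IHa|/IHb].
by exists u.
Qed.

Lemma minsize_forked (A B C : {set T}) : A =i x :: p -> B =i y :: q -> C =i z :: r ->
  k < #|T| -> minsize e A B C <= k -> forked.
Proof.
move=> hA hB hC kT /(minn_big_le kT)[u uA /(minn_big_le kT)[v vB /(minn_big_le kT)[w wC dm]]].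
have dle a b : a \in [set u; v; w] -> b \in [set u; v; w] -> gdist e a b <= k.
  move=> ha hb; apply: leq_trans dm; rewrite /diam.
  rewrite (bigD1 a) //= (bigD1 b) //=; apply: leq_trans (leq_maxl _ _); exact: leq_maxl.
rewrite hA in uA; have [i hi hu] := side_nth uA.
have uv : gdist e u v <= k by apply: dle; rewrite !inE eqxx ?orbT.
have uw : gdist e u w <= k by apply: dle; rewrite !inE eqxx ?orbT.
(* The vertex [u] is close to both other sides; the half of [x,y] that contains it decides which of
   them is used. *)
have [le|gt] := leqP (size p) (size p - i).*2.+1.
  by apply: (near_next hi (v := v)); rewrite -?hB // hu.
by apply: (near_previous hi (v := w)); rewrite -?hC ?hu //; move: gt hi; clear; lia.
Qed.

End OneTriangle.
End Triangles.

(** * Circulant graphs *)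

Section Circulant.
Variable m : nat.
Local Notation Z := 'I_m.+2.
Implicit Types (S : {set Z}) (a b x y : Z).
Import GRing.Theory.
Local Open Scope ring_scope.

(** The sets of differences along the edges of a circulant graph; the element 1 makes the graph
    connected. *)
Definition connection_set S := [&& 0 \notin S, 1 \in S & [forall a in S, - a \in S]].

(** A nonzero element equal to its negative is half the modulus. *)
Lemma involution_unique a b : a != 0 -> b != 0 -> - a = a -> - b = b -> a = b.
Proof.
have half (c : Z) : c != 0 -> - c = c -> ((nat_of_ord c) * 2 = m.+2)%N.
  move=> c0 hc; have := congr1 (@nat_of_ord _) hc; rewrite /= => h.
  have c1 : nat_of_ord c != 0%N by apply: contraNneq c0 => c1; apply/eqP/val_inj.
  have lt : (nat_of_ord c < m.+2)%N := ltn_ord (c : 'I_m.+2).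
  by move: h; rewrite modn_small; move: c1 lt; clear; lia.
by move=> a0 b0 ha hb; apply: val_inj; have := half a a0 ha; have := half b b0 hb; rewrite /=; lia.
Qed.

(** Of two elements outside [S] and 0, at least one differs from its negative and can be added
    together with it. *)
Lemma connection_set_grow S : connection_set S -> (#|S| + 2 < m.+2)%N ->
  exists2 S' : {set Z}, connection_set S' & #|S'| = #|S|.+2.
Proof.
move=> /and3P[S0 S1 /forall_inP SN] lt.
pose C := ~: (0 |: S).
have cC : (1 < #|C|)%N.
  have := cardsC (0 |: S); rewrite -/C cardsU1 S0 card_ord /=; set s := #|S|; set c := #|C|.
  have : (s + 2 < m.+2)%N := lt.
  move: s c => s c; clear; lia.
have [a [b [aC bC ab]]] : exists a b, [/\ a \in C, b \in C & a != b].
  have /card_gt0P[a aC] : (0 < #|C|)%N by exact: ltnW.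
  have : (0 < #|C :\ a|)%N by move: cC; rewrite (cardsD1 a) aC.
  by case/card_gt0P => b /setD1P[ba bC]; exists a, b; rewrite eq_sym aC bC ba.
have hC c : c \in C -> c != 0 /\ c \notin S by rewrite !inE negb_or => /andP[].
have [a0 aS] := hC a aC; have [b0 bS] := hC b bC.
have [c [c0 cS nc]] : exists c, [/\ c != 0, c \notin S & - c != c].
  have [ea|na] := eqVneq (- a) a; last by exists a.
  have [eb|nb] := eqVneq (- b) b; last by exists b.
  by move: ab; rewrite (involution_unique a0 b0 ea eb) eqxx.
have ncS : - c \notin S by apply: contra cS => /SN; rewrite opprK.
exists (- c |: (c |: S)); last by rewrite !cardsU1 !inE negb_or nc ncS cS.
rewrite /connection_set !inE S1 !orbT !negb_or S0 eq_sym oppr_eq0 c0 eq_sym c0 /=.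
apply/forall_inP => s; rewrite !inE => /or3P[/eqP->|/eqP->|/SN ->]; rewrite ?orbT //.
  by rewrite opprK eqxx orbT.
by rewrite eqxx.
Qed.

(** Steps of two, starting from {1,-1}, or for odd d from this set with half the modulus added; the
    modulus is then even by parity. *)
Lemma connection_set_exists d : (1 < d)%N -> (d < m.+2)%N -> ~~ odd (m.+2 * d) ->
  exists2 S : {set Z}, connection_set S & #|S| = d.
Proof.
elim/ltn_ind: d => d IH d1 dm ev.
have n1 : (1 : Z) != 0 by exact: oner_neq0.
have [d4|d4] := ltnP 3 d.
  have e : d = (d - 2).+2 by lia.
  have [] := IH (d - 2)%N; [by lia|by lia|by lia| |].
    by rewrite oddM oddB ?addbF -?oddM // ltnW // ltnW.
  by move=> S cS sz; have [|S' h1 h2] := connection_set_grow cS; [lia|exists S' => //; lia].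
have m1 : (0 < m)%N by lia.
have n2 : - (1 : Z) != 1.
  apply/eqP => /(congr1 (@nat_of_ord _)) /=; rewrite !modn_small; lia.
have cs : connection_set [set 1; -1].
  rewrite /connection_set !inE eqxx orTb eq_sym (negPf n1) eq_sym oppr_eq0 (negPf n1) /=.
  by apply/forall_inP => s; rewrite !inE => /orP[]/eqP->; rewrite ?opprK eqxx ?orbT.
have [d2|d3] : d = 2 \/ d = 3 by lia.
  by exists [set 1; -1]; rewrite // cards2 eq_sym n2 d2.
have lt : (m.+2./2 < m.+2)%N by lia.
have em : (m.+2./2 * 2 = m.+2)%N by move: ev; rewrite d3; lia.
pose h : Z := Ordinal lt.
have hN : - h = h by apply: val_inj; rewrite /= modn_small; lia.
have h0 : h != 0 by apply/eqP => /(congr1 (@nat_of_ord _)) /=; lia.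
have hS : h \notin [set 1; -1].
  rewrite !inE negb_or; apply/andP; split.
    by apply/eqP => /(congr1 (@nat_of_ord _)) /=; rewrite modn_small; lia.
  rewrite -hN eqr_opp; by apply/eqP => /(congr1 (@nat_of_ord _)) /=; rewrite modn_small; lia.
have cS : #|[set (1 : Z); -1]| = 2 by rewrite cards2 eq_sym n2.
move: [set 1; -1] cs hS cS => S /and3P[c1 c2 /forall_inP c3] hS cS.
exists (h |: S); last by rewrite cardsU1 hS cS d3.
rewrite /connection_set !in_setU1 c2 orbT eq_sym (negPf h0) c1.
by apply/forall_inP => s; rewrite !in_setU1 => /orP[/eqP->|/c3 ->]; rewrite ?hN ?eqxx ?orbT.
Qed.

Lemma circulant_RG S : connection_set S ->
  [set e | [exists x, exists s in S, e == [set x; x + s]]] \in RG Z #|S|.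
Proof.
case/and3P => S0 S1 /forall_inP SN; set E := [set e | _].
have adjE x y : adj E x y = (y - x \in S).
  rewrite /adj inE; apply/existsP/idP => [[u /exists_inP[s sS]]|h].
    rewrite set2_eq => /orP[]/andP[/eqP-> /eqP->]; first by rewrite addrAC subrr add0r.
    by rewrite opprD addNKr SN.
  by exists x; apply/exists_inP; exists (y - x); rewrite // addrC subrK.
rewrite inE; apply/and3P; split.
- apply/forall_inP => e; rewrite inE => /existsP[x /exists_inP[s sS /eqP->]].
  rewrite cards2 -subr_eq0 opprD addrA subrr add0r oppr_eq0.
  by rewrite (_ : s != 0) //; apply: contraNneq S0 => <-.
- apply/forallP => x; apply/eqP; rewrite -(card_imset S (addrI x)).
  apply: eq_card => y; rewrite inE adjE; apply/idP/imsetP => [h|[s sS ->]].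
    by exists (y - x); rewrite // addrC subrK.
  by rewrite addrAC subrr add0r.
have step x k : connect (adj E) x (x + k%:R).
  elim: k => [|k IH]; first by rewrite addr0.
  by apply: connect_trans IH (connect1 _); rewrite adjE mulrSr addrA [X in X \in S]addrC addKr.
apply/forallP => x; apply/forallP => y.
by have := step x (nat_of_ord (y - x)); rewrite natr_Zp addrC subrK.
Qed.

End Circulant.

(** Circulant graphs show that the denominator of [RRG_prob] is not 0. *)
Lemma RG_gt0 n d : 1 < d -> d < n -> ~~ odd (n * d) -> 0 < #|RG 'I_n d|.
Proof.
case: n => [|[|m]] d1 dn ev; [by []|by lia|].
have [S cS <-] := connection_set_exists d1 dn ev.
by apply/card_gt0P; exists [set e | [exists x, exists s in S, e == [set x; x + s]%R]]; exact: circulant_RG.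
Qed.

(** * Means over triangles *)

From mathcomp Require Import reals.

Import Order.TTheory GRing.Theory Num.Theory.
Local Open Scope ring_scope.

Section UniformMean.
Variables (R : realType) (I : finType) (A : {set I}).
Hypothesis A0 : A != finset.set0.

Let cA : 0 < #|A|%:R :> R. Proof. by rewrite ltr0n card_gt0. Qed.

(** One averaging step, used once for each side of a triangle: [f] and [g] depend on the geodesic
    being averaged, [u] collects the terms that do not. *)
Lemma unif_mean_affine (c K u : R) (f g : I -> R) :
  (forall a, a \in A -> c <= f a + K * (u + g a)) ->
  c <= unif_mean A f + K * (u + unif_mean A g).
Proof.
move=> h; have := ler_sum (index_enum I) h.
rewrite sumr_const big_split /= -mulr_sumr big_split /= sumr_const.
rewrite -[_ *+ _]mulr_natr -[u *+ _]mulr_natr => h'.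
rewrite /unif_mean -(ler_pM2r cA); apply: le_trans h' _.
rewrite le_eqVlt; apply/orP; left; apply/eqP.
by field; rewrite gt_eqF.
Qed.

Lemma unif_meanD (f g : I -> R) :
  unif_mean A (fun a => f a + g a) = unif_mean A f + unif_mean A g.
Proof. by rewrite /unif_mean big_split mulrDl. Qed.

Lemma unif_mean_le (f : I -> R) B : (forall a, a \in A -> f a <= B) -> unif_mean A f <= B.
Proof.
move=> h; rewrite /unif_mean ler_pdivrMr // mulr_natr -sumr_const.
exact: ler_sum.
Qed.

End UniformMean.

Lemma sum_bool_card (I : finType) (P : pred I) : (\sum_x P x)%N = #|[set x | P x]%SET|.
Proof. by rewrite -sum1_card [RHS]big_mkcond; apply: eq_bigr => x _; rewrite inE; case: (P x). Qed.

Lemma unif_mean_setT (R : realType) (I : finType) (f : I -> R) :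
  unif_mean [set: I]%SET f = (\sum_a f a) / #|I|%:R.
Proof. by rewrite /unif_mean cardsT; congr (_ / _); apply: eq_bigl => a; rewrite inE. Qed.

Lemma fork_sum_gt0 (a b c g h g' h' l l' e e' : bool) :
  [|| e, l, g | h] || [|| e', l', g' | h'] ->
  (0 < a + b + c + (g + h) + (g' + h') + (l + l') + e + e')%N.
Proof. by rewrite !addn_gt0 !lt0b => /orP[] /or4P[] ->; rewrite ?orbT. Qed.

Lemma sum3_nat_split (T : finType) (a b c g h g' h' : T -> T -> T -> nat) :
  (\sum_x \sum_y \sum_z (a x y z + b x y z + c x y z + (g x y z + h x y z) +
     (g' x y z + h' x y z)) =
   \sum_x \sum_y \sum_z a x y z + \sum_x \sum_y \sum_z b x y z +
   \sum_x \sum_y \sum_z c x y z +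
   (\sum_x \sum_y \sum_z g x y z + \sum_x \sum_y \sum_z h x y z) +
   (\sum_x \sum_y \sum_z g' x y z + \sum_x \sum_y \sum_z h' x y z))%N.
Proof.
rewrite -!big_split; apply: eq_bigr => x _; rewrite -!big_split; apply: eq_bigr => y _.
by rewrite -!big_split.
Qed.

Lemma sum3_split (R : realType) (T : finType) (K : R) (f u l l' e e' : T -> T -> T -> R) :
  \sum_x \sum_y \sum_z (f x y z + K * (u x y z + (l x y z + l' x y z) + e x y z + e' x y z)) =
  \sum_x \sum_y \sum_z f x y z + K * (\sum_x \sum_y \sum_z u x y z +
   (\sum_x \sum_y \sum_z l x y z + \sum_x \sum_y \sum_z l' x y z) +
   \sum_x \sum_y \sum_z e x y z + \sum_x \sum_y \sum_z e' x y z).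
Proof.
rewrite -!big_split mulr_sumr -big_split; apply: eq_bigr => x _.
rewrite -!big_split mulr_sumr -big_split; apply: eq_bigr => y _.
by rewrite -!big_split mulr_sumr -big_split.
Qed.

Lemma mean3 (R : realType) (T : finType) (F : T -> T -> T -> R) (N : R) : N != 0 ->
  N ^+ 3 * ((\sum_x (\sum_y (\sum_z F x y z) / N) / N) / N) = \sum_x \sum_y \sum_z F x y z.
Proof.
move=> N0; under eq_bigr do rewrite -mulr_suml.
by rewrite -!mulr_suml; field.
Qed.

(** * From exceptional events to the mean over triangles *)

Section MeanBound.
Variables (R : realType) (T : finType) (d : nat) (E : {set {set T}}).
Hypothesis d3 : (3 <= d)%N.
Hypothesis hE : E \in RG T d.
Variables (k L : nat).
Let e := adj E.
Let n := #|T|.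

Definition far_pairs : {set T * T} := [set t : T * T | (L < gdist e t.1 t.2)%N]%SET.

Definition half_power_sum : nat :=
  \sum_(t : T * T) (gdist e t.1 t.2 <= L)%N * d.-1 ^ (gdist e t.1 t.2)./2.

Variable f : {set T} -> {set T} -> {set T} -> nat.
Hypothesis hf : forall x y z (p q r : seq T) (A B C : {set T}),
  geodesic E x p -> geodesic E y q -> geodesic E z r ->
  last x p = y -> last y q = z -> last z r = x ->
  (size p <= L)%N -> (size q <= L)%N -> (size r <= L)%N ->
  A =i x :: p -> B =i y :: q -> C =i z :: r -> (f A B C <= k)%N ->
  forked E x y z p q r k L.

Let geod0 x y : geodesics e x y != finset.set0.
Proof.
apply/set0Pn; have [p [pp lp _]] := geodesicP hE x y.
by exists p; rewrite inE pp lp eqxx.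
Qed.

Let geodE x y (p : (gdist e x y).-tuple T) : p \in geodesics e x y ->
  geodesic E x p /\ last x p = y.
Proof. by rewrite inE => /andP[pp /eqP lp]; rewrite /geodesic pp lp size_tuple eqxx. Qed.

Let u0 x y z : nat :=
  (L < gdist e x y) + (L < gdist e y z) + (L < gdist e z x) +
  (crossing E L y x z + detour E k L y x z) + (crossing E L x y z + detour E k L x y z).

(** A pointwise union bound: a value at most k forces a side longer than L or one of the events of a
    fork at [y] or at [x], and then the sum of indicators is positive. *)
Let pt x y z (p : (gdist e x y).-tuple T) (q : (gdist e y z).-tuple T)
    (r : (gdist e z x).-tuple T) :
  p \in geodesics e x y -> q \in geodesics e y z -> r \in geodesics e z x ->
  (k.+1 <= f (side x p) (side y q) (side z r) + k.+1 * (u0 x y z +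
    (late_merge E k L y (rev (belast x p)) z + late_merge E k L x p z) +
    early_merge E k L y q x + early_merge E k L x (rev (belast z r)) y))%N.
Proof.
move=> /geodE[gp lp] /geodE[gq lq] /geodE[gr lr].
have [hk|hk] := ltnP k (f (side x p) (side y q) (side z r)).
  exact: leq_trans (leq_addr _ _).
set s := (u0 x y z + _ + _ + _)%N; suff : (0 < s)%N.
  by move=> s0; apply: leq_trans (leq_addl _ _); rewrite leq_pmulr.
have sd u (j : nat) (s' : j.-tuple T) : side u s' =i u :: s' by move=> v; rewrite inE.
have [hp|hp] := leqP (size p) L; last by move: hp; rewrite /s /u0 size_tuple => ->.
have [hq|hq] := leqP (size q) L; last by move: hq; rewrite /s /u0 size_tuple => ->; rewrite ?addnS.
have [hr|hr] := leqP (size r) L; last by move: hr; rewrite /s /u0 size_tuple => ->; rewrite ?addnS.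
have := hf gp gq gr lp lq lr hp hq hr (sd _ _ _) (sd _ _ _) (sd _ _ _) hk.
rewrite /forked /fork_at /s /u0.
exact: fork_sum_gt0.
Qed.

Let S3 (F : T -> T -> T -> R) := \sum_x \sum_y \sum_z F x y z.

(** The number of third corners that merge with a given geodesic is bounded in terms of its length
    alone. So averaging over the geodesics of a pair keeps the bound, and summing over pairs gives
    [half_power_sum]. *)
Let mean_base (g : forall y z, (gdist e y z).-tuple T -> T -> bool) :
  (forall y z (q : (gdist e y z).-tuple T),
    (#|[set x | g y z q x]%SET| <= (size q <= L) * (8 * d.-1 ^ k.+1 * d.-1 ^ (size q)./2))%N) ->
  \sum_y \sum_z \sum_x unif_mean (geodesics e y z) (fun q => (g y z q x)%:R : R) <=
  (8 * d.-1 ^ k.+1 * half_power_sum)%:R.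
Proof.
move=> hg; rewrite /half_power_sum big_distrr natr_sum /= pair_bigA /=.
apply: ler_sum => -[y z] _ /=.
apply: (@le_trans _ _ (unif_mean (geodesics e y z) (fun q => \sum_x (g y z q x)%:R))).
  by rewrite /unif_mean -mulr_suml exchange_big.
apply: unif_mean_le => // q _; rewrite -natr_sum ler_nat.
rewrite sum_bool_card; apply: leq_trans (hg y z q) _; rewrite size_tuple.
by apply: eq_leq; rewrite mulnCA.
Qed.

Let inner (x y z : T) : R :=
  unif_mean (geodesics e x y) (fun p => unif_mean (geodesics e y z) (fun q =>
  unif_mean (geodesics e z x) (fun r => (f (side x p) (side y q) (side z r))%:R))).

Let inner_bound x y z : (k.+1)%:R <= inner x y z + (k.+1)%:R * ((u0 x y z)%:R +
  (unif_mean (geodesics e x y) (fun p => (late_merge E k L y (rev (belast x p)) z)%:R) +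
   unif_mean (geodesics e x y) (fun p => (late_merge E k L x p z)%:R)) +
  unif_mean (geodesics e y z) (fun q => (early_merge E k L y q x)%:R) +
  unif_mean (geodesics e z x) (fun r => (early_merge E k L x (rev (belast z r)) y)%:R)).
Proof.
rewrite -unif_meanD.
set l := unif_mean (geodesics e x y) _; set e1 := unif_mean (geodesics e y z) _.
set e2 := unif_mean (geodesics e z x) _; rewrite /inner.
rewrite (_ : _ + l + e1 + e2 = ((u0 x y z)%:R + e1 + e2) + l); last by ring.
apply: unif_mean_affine => // p hp.
rewrite (_ : _ + e1 + e2 + _ = ((u0 x y z)%:R + e2 + ((late_merge E k L y (rev (belast x p)) z)%:R +
  (late_merge E k L x p z)%:R)) + e1); last by ring.
apply: unif_mean_affine => // q hq.
rewrite (_ : _ + e2 + _ + _ = ((u0 x y z)%:R + ((late_merge E k L y (rev (belast x p)) z)%:R +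
  (late_merge E k L x p z)%:R) + (early_merge E k L y q x)%:R) + e2); last by ring.
apply: unif_mean_affine => // r hr.
by rewrite -!natrD -natrM -natrD ler_nat pt.
Qed.

Let sum_u0 : (\sum_x \sum_y \sum_z u0 x y z = 3 * (n * #|far_pairs|) +
  2 * (#|crossings E L| + #|detours E k L|))%N.
Proof.
have sT : (\sum_(z : T) 1 = n)%N by rewrite sum1_card.
have cf : (\sum_x \sum_y (L < gdist e x y) = #|far_pairs|)%N.
  by rewrite pair_bigA /= sum_bool_card.
have far1 : (\sum_x \sum_y \sum_(z : T) (L < gdist e x y) = n * #|far_pairs|)%N.
  rewrite -cf big_distrr /=; apply: eq_bigr => x _; rewrite big_distrr /=.
  by apply: eq_bigr => y _; rewrite sum_nat_const.
have far2 : (\sum_(x : T) \sum_y \sum_z (L < gdist e y z) = n * #|far_pairs|)%N.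
  by rewrite cf sum_nat_const.
have far3 : (\sum_x \sum_(y : T) \sum_z (L < gdist e z x) = n * #|far_pairs|)%N.
  rewrite exchange_big /= -far2; apply: eq_bigr => y _; exact: exchange_big.
have tri (P : T -> T -> T -> bool) :
    (\sum_x \sum_y \sum_z P x y z = #|[set t : T * T * T | P t.1.1 t.1.2 t.2]%SET|)%N.
  rewrite -sum_bool_card pair_bigA pair_bigA /=.
  by apply: eq_bigr.
have c1 : (\sum_x \sum_y \sum_z crossing E L x y z = #|crossings E L|)%N by exact: tri.
have c2 : (\sum_x \sum_y \sum_z detour E k L x y z = #|detours E k L|)%N by exact: tri.
have c1' : (\sum_x \sum_y \sum_z crossing E L y x z = #|crossings E L|)%N.
  by rewrite -c1; exact: exchange_big.
have c2' : (\sum_x \sum_y \sum_z detour E k L y x z = #|detours E k L|)%N.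
  by rewrite -c2; exact: exchange_big.
have split := @sum3_nat_split T (fun x y _ => L < gdist e x y)%N (fun _ y z => L < gdist e y z)%N
  (fun x _ z => L < gdist e z x)%N (fun x y z => crossing E L y x z)
  (fun x y z => detour E k L y x z) (fun x y z => crossing E L x y z)
  (fun x y z => detour E k L x y z).
rewrite [LHS]split; apply: etrans (congr2 addn (congr2 addn (congr2 addn (congr2 addn far1 far2) far3)
  (congr2 addn c1' c2')) (congr2 addn c1 c2)) _.
move: (n * _)%N #|crossings _ _| #|detours _ _ _| => a b c; clear; lia.
Qed.

(** Sum of [inner_bound] over all corners: three possibly long sides, crossings and detours at two
    corners, and an early and a late merge at each of these two. *)
Lemma mean_bound : (0 < n)%N -> (n ^ 3 * k.+1)%:R <= n%:R ^+ 3 * triangle_mean R e f +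
  (k.+1 * (3 * (n * #|far_pairs|) + 2 * (#|crossings E L| + #|detours E k L|) +
     4 * (8 * d.-1 ^ k.+1 * half_power_sum)))%:R.
Proof.
move=> n0; have n0' : n%:R != 0 :> R by rewrite pnatr_eq0 -lt0n.
have -> : n%:R ^+ 3 * triangle_mean R e f = S3 inner.
  rewrite /triangle_mean /S3 unif_mean_setT -/n -(mean3 inner n0'); congr (_ * (_ / _)).
  apply: eq_bigr => x _; rewrite unif_mean_setT -/n; congr (_ / _).
  by apply: eq_bigr => y _; rewrite unif_mean_setT.
have -> : (n ^ 3 * k.+1)%:R = S3 (fun _ _ _ => k.+1%:R).
  rewrite /S3 !sumr_const -!mulrnA; congr (_ *+ _); rewrite (_ : #|_| = n) //.
  by ring.
have h : S3 (fun _ _ _ => k.+1%:R) <= S3 (fun x y z => inner x y z + (k.+1)%:R * ((u0 x y z)%:R +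
  (unif_mean (geodesics e x y) (fun p => (late_merge E k L y (rev (belast x p)) z)%:R) +
   unif_mean (geodesics e x y) (fun p => (late_merge E k L x p z)%:R)) +
  unif_mean (geodesics e y z) (fun q => (early_merge E k L y q x)%:R) +
  unif_mean (geodesics e z x) (fun r => (early_merge E k L x (rev (belast z r)) y)%:R))).
  by apply: ler_sum => x _; apply: ler_sum => y _; apply: ler_sum => z _; exact: inner_bound.
apply: le_trans h _; rewrite /S3.
rewrite sum3_split lerD2l natrM ler_wpM2l //.
set B := (8 * _ * _)%N; rewrite [in X in _ <= X]natrD -sum_u0.
have l1 := @mean_base (fun x y p z => late_merge E k L y (rev (belast x p)) z).
have l2 := @mean_base (fun x y p z => late_merge E k L x p z).
have e1 := @mean_base (fun y z q x => early_merge E k L y q x).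
have e2 := @mean_base (fun z x r y => early_merge E k L x (rev (belast z r)) y).
rewrite (_ : (4 * B)%:R = B%:R + B%:R + B%:R + B%:R :> R); last first.
  by rewrite -!natrD; congr (_%:R); clear; lia.
have -> : (\sum_x \sum_y \sum_z u0 x y z)%:R = \sum_x \sum_y \sum_z (u0 x y z)%:R :> R.
  rewrite natr_sum; apply: eq_bigr => x _; rewrite natr_sum; apply: eq_bigr => y _.
  exact: natr_sum.
rewrite -!addrA lerD2l.
rewrite lerD //; first by apply: l1 => x y p;
  have := card_late_merge d3 hE k L y (rev (belast x p)); rewrite size_rev size_belast.
rewrite lerD //; first by apply: l2 => x y p; exact: card_late_merge d3 hE k L x p.
rewrite lerD //.
  rewrite exchange_big /=; under eq_bigr do rewrite exchange_big /=.
  by apply: e1 => y z q; exact: card_early_merge d3 hE k L y q.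
under eq_bigr do rewrite exchange_big /=.
rewrite exchange_big /=.
by apply: e2 => z x r;
  have := card_early_merge d3 hE k L x (rev (belast z r)); rewrite size_rev size_belast.
Qed.

End MeanBound.

(** * Expected distances *)

Section ExpectedDistances.
Variables (T : finType) (d H : nat).
Hypothesis d3 : (3 <= d)%N.
Let n := #|T|.
Hypothesis large : (n + 4 * H + 4 * d * d.+1 <= n * d)%N.

(** A far pair has two regular ends, and [card_far_graphs] applies, or one of its ends is among the
    few irregular vertices. *)
Lemma sum_far_pairs r : (r.+1 < H)%N ->
  (d.-1 ^ (2 * r) * \sum_(E in RG T d) #|far_pairs E (2 * r + 3)| <=
   (n ^ 3 * d + 2 * 3840 * d ^ 6 * n * d.-1 ^ r * d.-1 ^ (2 * r)) * #|RG T d|)%N.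
Proof.
move=> hr.
pose irr (E : {set {set T}}) : {set T} := [set y | ~~ regular_at d E r y]%SET.
have le1 : (\sum_(E in RG T d) #|far_pairs E (2 * r + 3)| <=
    \sum_(t : T * T) #|far_graphs d r t.1 t.2| + 2 * n * \sum_(E in RG T d) #|irr E|)%N.
  have -> : (\sum_(t : T * T) #|far_graphs d r t.1 t.2| =
      \sum_(E in RG T d) #|[set t : T * T | E \in far_graphs d r t.1 t.2]%SET|)%N.
    transitivity (\sum_(t : T * T) \sum_(E in far_graphs d r t.1 t.2) 1)%N.
      by apply: eq_bigr => t _; rewrite sum1_card.
    rewrite (exchange_big_dep (mem (RG T d))) /=; last first.
      by move=> t E _; rewrite inE => /andP[].
    by apply: eq_bigr => E hE; rewrite -sum1_card; apply: eq_bigl => t; rewrite [RHS]inE.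
  rewrite big_distrr -big_split /=; apply: leq_sum => E hE.
  have sub : far_pairs E (2 * r + 3) \subset [set t : T * T | E \in far_graphs d r t.1 t.2]%SET
      :|: (setX (irr E) [set: T] :|: setX [set: T] (irr E))%SET.
    apply/subsetP => -[y z]; rewrite in_set /= => h; rewrite !in_setU !in_setX !in_setT /=.
    have [ry|nry] := boolP (regular_at d E r y); last by rewrite [y \in _]inE nry !orbT.
    have [rz|nrz] := boolP (regular_at d E r z); last by rewrite [z \in _]inE nrz !orbT.
    by rewrite in_set /= /far_graphs in_set hE ry rz (_ : 2 * r + 4 = (2 * r + 3).+1)%N ?h // addn4 addn3.
  apply: leq_trans (subset_leq_card sub) _; apply: leq_trans (leq_card_setU _ _).1 _.
  rewrite leq_add2l; apply: leq_trans (leq_card_setU _ _).1 _.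
  by rewrite !cardsX cardsT -/n; move: #|irr E| n; clear; lia.
have le2 : (d.-1 ^ (2 * r) * \sum_(t : T * T) #|far_graphs d r t.1 t.2| <=
    n ^ 3 * d * #|RG T d|)%N.
  rewrite big_distrr /=; apply: (@leq_trans (\sum_(t : T * T) n * d * #|RG T d|)).
    by apply: leq_sum => t _; exact: card_far_graphs.
  by rewrite sum_nat_const card_prod -/n; apply: eq_leq; ring.
have le3 := sum_irregular d3 large hr.
apply: leq_trans (leq_mul (leqnn _) le1) _; rewrite mulnDr mulnDl leq_add //.
rewrite mulnCA; apply: leq_trans (leq_mul (leqnn _) (leq_mul (leqnn _) le3)) _.
by apply: eq_leq; ring.
Qed.

(** Pairs are sorted by the half h of their distance, rounded down. Up to h0 each contributes at
    most (d-1)^h0; beyond, the pair is far for the radius h-2, as 2(h-2)+3 < 2h. *)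
Lemma half_power_sum_le (E : {set {set T}}) L h0 : (2 <= h0)%N ->
  (half_power_sum d E L <= 2 * n ^ 2 * d.-1 ^ h0 +
    \sum_(h0 <= h < (L./2).+1) d.-1 ^ h * #|far_pairs E (2 * (h - 2) + 3)|)%N.
Proof.
move=> h02; rewrite /half_power_sum.
pose dd (t : T * T) := gdist (adj E) t.1 t.2.
have pt (t : T * T) : ((dd t <= L)%N * d.-1 ^ (dd t)./2 <= d.-1 ^ h0 +
    \sum_(h0 <= h < (L./2).+1) d.-1 ^ h * (t \in far_pairs E (2 * (h - 2) + 3)))%N.
  have [hL|hL] := leqP (dd t) L; last by rewrite mul0n.
  rewrite mul1n; have [hs|hs] := leqP (dd t)./2 h0.
    by apply: leq_trans (leq_addr _ _); rewrite leq_pexp2l //; lia.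
  apply: leq_trans (leq_addl _ _).
  rewrite (bigD1_seq (dd t)./2) ?iota_uniq //=; last first.
    by rewrite mem_index_iota (ltnW hs) ltnS half_leq.
  apply: leq_trans (leq_addr _ _); rewrite inE -/(dd t).
  by rewrite (_ : (_ < dd t)%N) ?muln1 //; move: hs h02; clear; lia.
apply: (@leq_trans (\sum_(t : T * T) (d.-1 ^ h0 +
    \sum_(h0 <= h < (L./2).+1) d.-1 ^ h * (t \in far_pairs E (2 * (h - 2) + 3))))).
  by apply: leq_sum => t _; exact: pt.
rewrite big_split /= sum_nat_const card_prod -/n; apply: leq_add.
  by rewrite -[(n * n)%N]/(n ^ 2)%N leq_mul2r; apply/orP; right; lia.
rewrite exchange_big /=; apply: leq_sum => h _; rewrite -big_distrr /= leq_mul2l; apply/orP; right.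
by rewrite sum_bool_card; apply: subset_leq_card; apply/subsetP => t; rewrite inE.
Qed.

(** The terms from far pairs with regular ends decrease geometrically from h0 on, and n <= (d-1)^(2
    h0) bounds the first; those from irregular ends increase geometrically up to s+1. *)
Lemma sum_half_power (R : realType) s h0 : (2 <= h0)%N -> (s.+1 < H)%N -> (n <= d.-1 ^ (2 * h0))%N ->
  (\sum_(E in RG T d) half_power_sum d E (2 * s + 3))%:R <=
  (n%:R ^+ 2 * d.-1%:R ^+ h0 * (2 + 2 * d%:R * d.-1%:R ^+ 4) +
   15360 * d%:R ^+ 6 * n%:R * d.-1%:R ^+ (2 * s.+1)) * #|RG T d|%:R :> R.
Proof.
move=> h02 hs nh0.
set b : R := d.-1%:R; set N : R := n%:R; set G : R := #|RG T d|%:R.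
have b2 : 2 <= b by rewrite /b (ler_nat R 2); lia.
have b0 : 0 < b by lra.
have bX m : 0 < b ^+ m by rewrite exprn_gt0.
have G0 : 0 <= G by rewrite ler0n.
have N0 : 0 <= N by rewrite ler0n.
have D0 : 0 <= d%:R :> R by rewrite ler0n.
pose F h : R := (\sum_(E in RG T d) #|far_pairs E (2 * (h - 2) + 3)|)%:R.
have hF h : (h0 <= h)%N -> (h <= s.+1)%N -> b ^+ h * F h <=
    (N ^+ 3 * d%:R * b ^+ 4 * (b ^+ h)^-1 + 7680 * d%:R ^+ 6 * N * b ^+ (2 * h)) * G.
  move=> hh0 hhs.
  have hr : ((h - 2).+1 < H)%N by move: hs hh0 hhs h02; clear; lia.
  have h1 := sum_far_pairs hr.
  rewrite -(ler_nat R) !(natrM, natrD, natrX) -/b -/N -/G -/(F h) in h1.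
  set m := (h - 2)%N in h1.
  have hm : h = m.+2 by rewrite /m; move: h02 hh0; clear; lia.
  have {}h1 : F h <= (N ^+ 3 * d%:R / b ^+ (2 * m) + 7680 * d%:R ^+ 6 * N * b ^+ m) * G.
    rewrite -(ler_pM2l (bX (2 * m)%N)); apply: le_trans h1 _.
    by rewrite le_eqVlt; apply/orP; left; apply/eqP; field; rewrite gt_eqF.
  apply: le_trans (ler_wpM2l (ltW (bX h)) h1) _.
  rewrite mulrA ler_wpM2r // mulrDr lerD //.
    rewrite le_eqVlt; apply/orP; left; apply/eqP.
    rewrite hm mulnC exprM !exprS; field; by rewrite !gt_eqF.
  rewrite mulrCA ler_wpM2l // ?mulr_ge0 ?exprn_ge0 //.
  rewrite -exprD ler_weXn2l //; first by lra.
  by rewrite mul2n -addnn leq_add2l leq_subr.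
have step : (\sum_(E in RG T d) half_power_sum d E (2 * s + 3))%:R <=
    (2 * N ^+ 2 * b ^+ h0) * G + \sum_(h0 <= h < s.+2) b ^+ h * F h.
  have : (\sum_(E in RG T d) half_power_sum d E (2 * s + 3) <=
      2 * n ^ 2 * d.-1 ^ h0 * #|RG T d| +
      \sum_(h0 <= h < s.+2) d.-1 ^ h * \sum_(E in RG T d) #|far_pairs E (2 * (h - 2) + 3)|)%N.
    apply: (@leq_trans (\sum_(E in RG T d) (2 * n ^ 2 * d.-1 ^ h0 +
      \sum_(h0 <= h < s.+2) d.-1 ^ h * #|far_pairs E (2 * (h - 2) + 3)|))).
      apply: leq_sum => E _; apply: leq_trans (half_power_sum_le E _ h02) _.
      by rewrite (_ : (2 * s + 3)./2 = s.+1) //; clear; lia.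
    rewrite big_split /= sum_nat_const mulnC leq_add2l exchange_big /=.
    by apply: leq_sum => h _; rewrite big_distrr.
  rewrite -(ler_nat R) => h1; apply: le_trans h1 _.
  by rewrite natrD !natrM !natrX natr_sum -/b -/N -/G lerD2l; apply: ler_sum => h _; rewrite natrM natrX.
apply: le_trans step _.
have geo1 m : \sum_(h0 <= h < m) (b ^+ h)^-1 <= 2 * (b ^+ h0)^-1.
  have [mh|lt] := leqP m h0; first by rewrite big_geq // mulr_ge0 // invr_ge0 ltW.
  suff : \sum_(h0 <= h < m) (b ^+ h)^-1 <= 2 * (b ^+ h0)^-1 - 2 * (b ^+ m)^-1.
    by have : 0 < (b ^+ m)^-1 by [rewrite invr_gt0]; lra.
  elim: m lt => // m IH; rewrite ltnS leq_eqVlt => /orP[/eqP <-|lt].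
    rewrite big_nat1 exprS invfM.
    have : 0 < (b ^+ h0)^-1 by rewrite invr_gt0.
    have : b^-1 <= 2^-1 by rewrite lef_pV2 ?posrE //; lra.
    by nra.
  rewrite big_nat_recr ?(ltnW lt) //= exprS invfM.
  have h1 := IH lt.
  have : 0 < (b ^+ m)^-1 by rewrite invr_gt0.
  have : b^-1 <= 2^-1 by rewrite lef_pV2 ?posrE //; lra.
  by nra.
have geo2 m : \sum_(h0 <= h < m.+1) b ^+ (2 * h) <= 2 * b ^+ (2 * m).
  elim: m => [|m IH].
    by rewrite big_geq ?(ltnW h02) // mulr_ge0 // ltW.
  have [le|lt] := leqP m.+2 h0.
    by rewrite big_geq // mulr_ge0 // ltW.
  rewrite big_nat_recr //=.
  have : 4 * b ^+ (2 * m) <= b ^+ (2 * m.+1).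
    rewrite mulnS exprD ler_pM2r // expr2; nra.
  by have := bX (2 * m)%N; lra.
have : \sum_(h0 <= h < s.+2) b ^+ h * F h <=
    \sum_(h0 <= h < s.+2) (N ^+ 3 * d%:R * b ^+ 4 * (b ^+ h)^-1 + 7680 * d%:R ^+ 6 * N * b ^+ (2 * h)) * G.
  by apply: ler_sum_nat => h /andP[h1 h2]; exact: hF.
rewrite -mulr_suml big_split /= -!mulr_sumr => h1.
apply: le_trans (lerD (lexx _) h1) _; rewrite -mulrDl ler_wpM2r //.
have n1 : N <= b ^+ h0 * b ^+ h0.
  by rewrite -exprD addnn -mul2n -natrX ler_nat.
have n2 : N ^+ 3 * (b ^+ h0)^-1 <= N ^+ 2 * b ^+ h0.
  by rewrite ler_pdivrMr // (exprSr N 2) -[X in _ <= X]mulrA ler_wpM2l // exprn_ge0.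
have n3 : N ^+ 3 * d%:R * b ^+ 4 * \sum_(h0 <= h < s.+2) (b ^+ h)^-1 <=
    2 * d%:R * b ^+ 4 * (N ^+ 2 * b ^+ h0).
  apply: (@le_trans _ _ (2 * d%:R * b ^+ 4 * (N ^+ 3 * (b ^+ h0)^-1))).
    rewrite (_ : 2 * _ * _ * _ = N ^+ 3 * d%:R * b ^+ 4 * (2 * (b ^+ h0)^-1)); last by ring.
    by rewrite ler_wpM2l // !mulr_ge0 ?exprn_ge0 // ltW.
  by rewrite ler_wpM2l // !mulr_ge0 ?exprn_ge0 // ltW.
have n4 : 7680 * d%:R ^+ 6 * N * \sum_(h0 <= h < s.+2) b ^+ (2 * h) <=
    7680 * d%:R ^+ 6 * N * (2 * b ^+ (2 * s.+1)).
  by rewrite ler_wpM2l // !mulr_ge0 ?exprn_ge0.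
apply: le_trans (lerD (lexx _) (lerD n3 n4)) _.
by rewrite le_eqVlt; apply/orP; left; apply/eqP; ring.
Qed.

End ExpectedDistances.

(** * The expected number of exceptional triangles *)

(** By [mean_bound], this is n^3 times a bound for the frequency of exceptional triangles. *)
Definition cost (T : finType) (d k L : nat) (E : {set {set T}}) : nat :=
  3 * (#|T| * #|far_pairs E L|) + 2 * (#|crossings E L| + #|detours E k L|) +
  4 * (8 * d.-1 ^ k.+1 * half_power_sum d E L).

(* N, D, b, S, P, K, l, c stand for n, d, d-1, (d-1)^s, (d-1)^h0, (d-1)^k, L+1, k *)
Definition cost_bound (R : realType) (N D b S P K l c : R) : R :=
  3 * (N * (N ^+ 3 * D / S ^+ 2 + 7680 * D ^+ 6 * N * S)) +
  2 * (2048 * D ^+ 3 * l * (S ^+ 4 * b ^+ 6) +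
       512 * D ^+ 2 * l ^+ 2 * c ^+ 2 * (S ^+ 4 * b ^+ 6 * K)) +
  4 * (8 * (b * K) * (N ^+ 2 * P * (2 + 2 * D * b ^+ 4) + 15360 * D ^+ 6 * N * (b * S) ^+ 2)).

Lemma sum_cost (R : realType) (T : finType) (d H s h0 k : nat) : (3 <= d)%N ->
  (#|T| + 4 * H + 4 * d * d.+1 <= #|T| * d)%N -> (2 * s + 3 + k < H)%N ->
  (2 <= h0)%N -> (#|T| <= d.-1 ^ (2 * h0))%N ->
  (\sum_(E in RG T d) cost d k (2 * s + 3) E)%:R <=
  cost_bound #|T|%:R d%:R d.-1%:R (d.-1%:R ^+ s) (d.-1%:R ^+ h0) (d.-1%:R ^+ k)
    (2 * s + 4)%:R k%:R * #|RG T d|%:R :> R.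
Proof.
move=> d3 large hL h02 nh0.
have hs : (s.+1 < H)%N by move: hL; clear; lia.
have h1 := sum_far_pairs d3 large hs.
have h2 := sum_crossings d3 large hL.
have h3 := sum_detours d3 large hL.
have h4 := sum_half_power d3 large R h02 hs nh0.
set L := (2 * s + 3)%N in h2 h3 h4 *.
rewrite /cost big_split /= big_split /= -!big_distrr /= big_split /=.
set X1 := (\sum_(E in _) #|far_pairs _ _|)%N in h1 *.
set X2 := (\sum_(E in _) #|crossings _ _|)%N in h2 *.
set X3 := (\sum_(E in _) #|detours _ _ _|)%N in h3 *.
set X4 := (\sum_(E in _) half_power_sum _ _ _)%N in h4 *.
set G := #|RG T d| in h1 h2 h3 h4 *; set n := #|T| in h1 h4 *.
clearbody X1 X2 X3 X4 G n.
move: h1 h2 h3; rewrite -!(ler_nat R) => h1 h2 h3.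
have b0 : 0 < d.-1%:R :> R by rewrite ltr0n; move: d3; clear; lia.
have e1 : d.-1%:R ^+ (2 * s) = (d.-1%:R ^+ s) ^+ 2 :> R by rewrite mulnC exprM.
have e2 : d.-1%:R ^+ (2 * L) = (d.-1%:R ^+ s) ^+ 4 * d.-1%:R ^+ 6 :> R.
  by rewrite -exprM -exprD /L; congr (_ ^+ _); clear; lia.
have e3 : d.-1%:R ^+ (2 * s.+1) = (d.-1%:R * d.-1%:R ^+ s) ^+ 2 :> R.
  by rewrite -exprS -exprM mulnC.
have N0 : 0 <= n%:R :> R by rewrite ler0n.
have S0 : 0 < d.-1%:R ^+ s :> R by rewrite exprn_gt0.
have el : L.+1%:R = (2 * s + 4)%:R :> R by congr (_%:R); rewrite /L; clear; lia.
rewrite !(natrM, natrD, natrX) e1 in h1.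
rewrite !(natrM, natrX) e2 el in h2.
rewrite !(natrM, natrX) exprD e2 el in h3.
rewrite e3 in h4; rewrite /cost_bound.
set N : R := n%:R in N0 h1 h4 *; set D : R := d%:R in h1 h2 h3 h4 *.
set b : R := d.-1%:R in b0 S0 h1 h2 h3 h4 *; set S : R := b ^+ s in S0 h1 h2 h3 h4 *.
set l : R := (2 * s + 4)%:R in h2 h3 *; set c : R := k%:R in h3 *.
set P := b ^+ h0 in h4 *; set K := b ^+ k in h3 *.
have x1 : X1%:R <= (N ^+ 3 * D / S ^+ 2 + 7680 * D ^+ 6 * N * S) * G%:R :> R.
  rewrite -(ler_pM2l (exprn_gt0 2 S0)); apply: le_trans h1 _.
  by rewrite le_eqVlt; apply/orP; left; apply/eqP; field; rewrite gt_eqF.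
rewrite !(natrD, natrM) natrX exprS -/N -/b -/K.
have x2 := lerD h2 h3.
have p1 : 3 * (N * X1%:R) <= 3 * (N * ((N ^+ 3 * D / S ^+ 2 + 7680 * D ^+ 6 * N * S) * G%:R)) :> R.
  by rewrite !ler_wpM2l.
have p2 := ler_wpM2l (ler0n R 2) x2.
have p3 : 4 * (8 * (b * K) * X4%:R) <= 4 * (8 * (b * K) * ((N ^+ 2 * P * (2 + 2 * D * b ^+ 4) +
    15360 * D ^+ 6 * N * (b * S) ^+ 2) * G%:R)) :> R.
  by rewrite !ler_wpM2l // !mulr_ge0 ?exprn_ge0 // ltW.
apply: le_trans (lerD (lerD p1 p2) p3) _.
by rewrite le_eqVlt; apply/orP; left; apply/eqP; ring.
Qed.

Definition deviation (R : realType) (D b : R) : R :=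
  3 * D + 3 * 7680 * D ^+ 6 * b + 18 * 2048 * D ^+ 3 * b ^+ 10 + 162 * 512 * D ^+ 2 * b ^+ 10 +
   32 * b ^+ 2 * (2 + 2 * D * b ^+ 4) + 32 * 15360 * b ^+ 5 * D ^+ 6.

(** Here [u] and [w] stand for the square roots of n and of l = log_b n. The merges with regular
    distances are critical: K w^3 <= u is spent in full on them. Long sides are controlled by u w^2
    <= S. Every other term has a spare factor [u], which absorbs powers of [w] up to the 19th. The
    six summands of [deviation] match [t1] to [t6]. *)
Lemma cost_bound_le (R : realType) (D b u w S P K l c : R) :
  2 <= b -> 0 <= D -> 1 <= w -> w ^+ 20 <= u -> 0 <= K -> K * w ^+ 3 <= u ->
  u * w ^+ 2 <= S -> S <= b * u * w ^+ 2 -> 0 <= P -> P <= b * u ->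
  0 <= l -> l <= 9 * w ^+ 2 -> 0 <= c -> c <= w ^+ 2 ->
  w ^+ 3 * cost_bound (u ^+ 2) D b S P K l c <=
  deviation D b * u ^+ 6.
Proof.
move=> b2 D0 w1 wu K0 Kw Sl Su P0 Pu l0 lw c0 cw.
have w0 : 0 <= w by lra.
have b0 : 0 <= b by lra.
have wX m n : (m <= n)%N -> w ^+ m <= w ^+ n by move=> mn; rewrite ler_weXn2l.
have wXu m : (m <= 20)%N -> w ^+ m <= u by move=> hm; apply: le_trans (wX _ _ hm) wu.
have u1 : 1 <= u by rewrite -(expr0 w); exact: wXu.
have u0 : 0 < u by lra.
have u0' := ltW u0.
have uX m : 0 <= u ^+ m by rewrite exprn_ge0.
have DX m : 0 <= D ^+ m by rewrite exprn_ge0.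
have bX m : 0 <= b ^+ m by rewrite exprn_ge0.
have wX0 m : 0 <= w ^+ m by rewrite exprn_ge0.
have S0 : 0 < S by apply: lt_le_trans Sl; rewrite mulr_gt0 // exprn_gt0 //; lra.
have S0' := ltW S0.
have Ku : K <= u by apply: le_trans Kw; rewrite ler_peMr // -(expr0 w) wX.
have SX m : S ^+ m <= (b * u * w ^+ 2) ^+ m by rewrite lerXn2r // nnegrE // !mulr_ge0.
have SX0 m : 0 <= S ^+ m by rewrite exprn_ge0.
have t1 : w ^+ 3 * (3 * (u ^+ 2 * ((u ^+ 2) ^+ 3 * D / S ^+ 2))) <= 3 * D * u ^+ 6.
  rewrite (_ : w ^+ 3 * _ = 3 * D * u ^+ 6 * ((u * w ^+ 2) ^+ 2 / w / S ^+ 2)); last first.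
    by field; rewrite ?gt_eqF //; lra.
  rewrite ler_piMr ?mulr_ge0 // ler_pdivrMr ?exprn_gt0 // mul1r.
  apply: (@le_trans _ _ ((u * w ^+ 2) ^+ 2)); last by rewrite lerXn2r // nnegrE // mulr_ge0.
  by rewrite ler_pdivrMr ?ler_peMr ?exprn_ge0 ?mulr_ge0 //; lra.
have t2 : w ^+ 3 * (3 * (u ^+ 2 * (7680 * D ^+ 6 * u ^+ 2 * S))) <= 3 * 7680 * D ^+ 6 * b * u ^+ 6.
  rewrite (_ : w ^+ 3 * _ = 3 * 7680 * D ^+ 6 * u ^+ 4 * w ^+ 3 * S); last by ring.
  apply: (@le_trans _ _ (3 * 7680 * D ^+ 6 * u ^+ 4 * w ^+ 3 * (b * u * w ^+ 2))).
    by rewrite ler_wpM2l // !mulr_ge0.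
  rewrite (_ : _ * (b * u * w ^+ 2) = 3 * 7680 * D ^+ 6 * b * u ^+ 5 * w ^+ 5); last by ring.
  rewrite (_ : _ * u ^+ 6 = 3 * 7680 * D ^+ 6 * b * u ^+ 5 * u); last by ring.
  by rewrite ler_wpM2l ?mulr_ge0 ?wXu.
have t3 : w ^+ 3 * (2 * (2048 * D ^+ 3 * l * (S ^+ 4 * b ^+ 6))) <= 18 * 2048 * D ^+ 3 * b ^+ 10 * u ^+ 6.
  rewrite (_ : w ^+ 3 * _ = 2 * 2048 * D ^+ 3 * b ^+ 6 * w ^+ 3 * (l * S ^+ 4)); last by ring.
  apply: (@le_trans _ _ (2 * 2048 * D ^+ 3 * b ^+ 6 * w ^+ 3 * (9 * w ^+ 2 * (b * u * w ^+ 2) ^+ 4))).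
    by rewrite ler_wpM2l ?ler_pM // !mulr_ge0.
  rewrite (_ : _ * (_ * _ ^+ 4) = 18 * 2048 * D ^+ 3 * b ^+ 10 * u ^+ 4 * w ^+ 13); last by ring.
  rewrite (_ : _ * u ^+ 6 = 18 * 2048 * D ^+ 3 * b ^+ 10 * u ^+ 4 * (u * u)); last by ring.
  rewrite ler_wpM2l ?mulr_ge0 //; apply: (le_trans (wXu _ _)) => //.
  by rewrite ler_peMr.
have t4 : w ^+ 3 * (2 * (512 * D ^+ 2 * l ^+ 2 * c ^+ 2 * (S ^+ 4 * b ^+ 6 * K))) <=
    162 * 512 * D ^+ 2 * b ^+ 10 * u ^+ 6.
  rewrite (_ : w ^+ 3 * _ = 1024 * D ^+ 2 * b ^+ 6 * w ^+ 3 * (l ^+ 2 * c ^+ 2 * S ^+ 4 * K)); last by ring.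
  apply: (@le_trans _ _ (1024 * D ^+ 2 * b ^+ 6 * w ^+ 3 *
    ((9 * w ^+ 2) ^+ 2 * (w ^+ 2) ^+ 2 * (b * u * w ^+ 2) ^+ 4 * u))).
    rewrite ler_wpM2l ?mulr_ge0 // ler_pM ?mulr_ge0 ?exprn_ge0 // ler_pM ?mulr_ge0 ?exprn_ge0 //.
    by rewrite ler_pM ?exprn_ge0 // lerXn2r // nnegrE // mulr_ge0.
  rewrite (_ : _ * (_ * u) = 162 * 512 * D ^+ 2 * b ^+ 10 * u ^+ 5 * w ^+ 19); last by ring.
  rewrite (_ : _ * u ^+ 6 = 162 * 512 * D ^+ 2 * b ^+ 10 * u ^+ 5 * u); last by ring.
  by rewrite ler_wpM2l ?mulr_ge0 ?wXu.
have t5 : w ^+ 3 * (4 * (8 * (b * K) * ((u ^+ 2) ^+ 2 * P * (2 + 2 * D * b ^+ 4)))) <=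
    32 * b ^+ 2 * (2 + 2 * D * b ^+ 4) * u ^+ 6.
  have c1 : 0 <= 2 + 2 * D * b ^+ 4 by rewrite addr_ge0 ?mulr_ge0.
  set C := 2 + 2 * D * b ^+ 4 in c1 *.
  rewrite (_ : w ^+ 3 * _ = 32 * b * C * u ^+ 4 * ((K * w ^+ 3) * P)); last by ring.
  apply: (@le_trans _ _ (32 * b * C * u ^+ 4 * (u * (b * u)))).
    by rewrite ler_wpM2l ?mulr_ge0 // ler_pM ?mulr_ge0.
  by rewrite le_eqVlt; apply/orP; left; apply/eqP; ring.
have t6 : w ^+ 3 * (4 * (8 * (b * K) * (15360 * D ^+ 6 * u ^+ 2 * (b * S) ^+ 2))) <=
    32 * 15360 * b ^+ 5 * D ^+ 6 * u ^+ 6.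
  rewrite (_ : w ^+ 3 * _ = 32 * 15360 * b ^+ 3 * D ^+ 6 * u ^+ 2 * ((K * w ^+ 3) * S ^+ 2)); last by ring.
  apply: (@le_trans _ _ (32 * 15360 * b ^+ 3 * D ^+ 6 * u ^+ 2 * (u * (b * u * w ^+ 2) ^+ 2))).
    by rewrite ler_wpM2l ?mulr_ge0 // ler_pM ?mulr_ge0.
  rewrite (_ : _ * (u * _) = 32 * 15360 * b ^+ 5 * D ^+ 6 * u ^+ 5 * w ^+ 4); last by ring.
  rewrite (_ : _ * u ^+ 6 = 32 * 15360 * b ^+ 5 * D ^+ 6 * u ^+ 5 * u); last by ring.
  by rewrite ler_wpM2l ?mulr_ge0 ?wXu.
have t := lerD (lerD (lerD (lerD (lerD t1 t2) t3) t4) t5) t6.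
apply: le_trans (le_trans _ t) _; last first.
  by rewrite le_eqVlt /deviation; apply/orP; left; apply/eqP; ring.
have distr (x N x1 x2 x3 x4 a x5 x6 : R) :
    x * (3 * (N * (x1 + x2)) + 2 * (x3 + x4) + 4 * (a * (x5 + x6))) =
    x * (3 * (N * x1)) + x * (3 * (N * x2)) + x * (2 * x3) + x * (2 * x4) +
    x * (4 * (a * x5)) + x * (4 * (a * x6)) by ring.
by rewrite /cost_bound distr.
Qed.

(** * Asymptotics *)

From mathcomp Require Import all_classical all_reals all_analysis.

Import numFieldNormedType.Exports.

Lemma power_bracket (R : realType) (b : nat) (X : R) : (1 < b)%N -> 1 <= X ->
  exists k, b%:R ^+ k <= X < b%:R ^+ k.+1.
Proof.
move=> b1 X1.
have ex : exists m, X < b%:R ^+ m.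
  exists (Num.trunc X).+1; apply: lt_trans (truncnS_gt X) _.
  by rewrite -natrX ltr_nat ltn_expl.
have [[|k] hk mink] := ex_minnP ex.
  by move: hk; rewrite expr0 ltNge X1.
exists k; rewrite hk andbT leNgt; apply/negP => /mink; by rewrite ltnn.
Qed.

Lemma exponent_le_log (R : realType) (b x : R) m : 1 < b -> b ^+ m <= x -> m%:R <= ln x / ln b.
Proof.
move=> b1 le; have b0 : 0 < b by apply: lt_trans b1.
have x0 : 0 < x by apply: lt_le_trans le; rewrite exprn_gt0.
rewrite ler_pdivlMr ?ln_gt0 // mulr_natl -lnXn // ler_ln ?posrE //.
by rewrite exprn_gt0.
Qed.

(** With y = x^(1/40), exp(t) >= 1 + t bounds (ln x)/40 by y, and for large x also the factor 40 /
    ln b is at most y; so the logarithm is at most y^2. *)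
Lemma log_power_le (R : realType) (b : R) : 1 < b ->
  exists M : R, forall x, 0 < x -> M <= ln x / ln b -> (ln x / ln b) ^+ 20 <= x.
Proof.
move=> b1; have lb : 0 < ln b by rewrite ln_gt0.
set K : R := 40 / ln b; have K0 : 0 < K by rewrite divr_gt0.
exists (K ^+ 2) => x x0; set l := ln x / ln b => hl.
set y := expR (ln x / 40).
have y40 : y ^+ 40 = x.
  rewrite -expRM_natl (_ : 40%:R * _ = ln x); last by field.
  by rewrite lnK // posrE.
have hy : ln x / 40 < y by have := expR_ge1Dx (ln x / 40); rewrite -/y; lra.
have y0 : 0 < y by exact: expR_gt0.
have lE : l = K * (ln x / 40) by rewrite /l /K; field; rewrite gt_eqF.
have Ky : K <= y.
  apply: le_trans (ltW hy); rewrite -(ler_pM2l K0) -lE -expr2; exact: hl.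
have l0 : 0 <= l by apply: le_trans hl; rewrite exprn_ge0 // ltW.
have ly : l <= y * y.
  have lx : 0 <= ln x / 40 by move: l0; rewrite lE pmulr_rge0.
  by rewrite lE ler_pM // ltW.
apply: le_trans (_ : (y * y) ^+ 20 <= x); last by rewrite -expr2 -exprM y40.
by rewrite lerXn2r // nnegrE // mulr_ge0 // ltW.
Qed.

(** * Choice of the parameters and Markov's inequality *)

Section LargeGraphs.
Variables (R : realType) (d n : nat) (b l w u : R).
Hypothesis d3 : (3 <= d)%N.
Hypotheses (bE : b = d.-1%:R) (lE : l = ln n%:R / ln b).
Hypotheses (wE : w = Num.sqrt l) (uE : u = Num.sqrt n%:R).
Hypotheses (dn : (d < n)%N) (even : ~~ odd (n * d)) (n1 : (4 * d * d.+1 <= n)%N)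
  (n2 : (10000 <= n)%N) (n3 : b ^+ 2 <= n%:R) (l1 : 1 <= l) (l20 : l ^+ 20 <= n%:R).

Let b2 : 2 <= b. Proof. by rewrite bE (ler_nat R 2); lia. Qed.
Let b1 : 1 < b. Proof. by move: b2; lra. Qed.
Let lb : 0 < ln b. Proof. exact: ln_gt0. Qed.
Let w2 : w ^+ 2 = l. Proof. by rewrite wE sqr_sqrtr //; move: l1; lra. Qed.
Let u2 : u ^+ 2 = n%:R. Proof. by rewrite uE sqr_sqrtr // ler0n. Qed.
Let w0 : 0 <= w. Proof. by rewrite wE sqrtr_ge0. Qed.
Let u0 : 0 <= u. Proof. by rewrite uE sqrtr_ge0. Qed.
Let w1 : 1 <= w. Proof. by rewrite -(ler_pXn2r (n := 2)) ?nnegrE // expr1n w2. Qed.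
Let ub : b <= u. Proof. by rewrite -(ler_pXn2r (n := 2)) ?nnegrE ?u2 //; move: b2; lra. Qed.
Let u100 : 100 <= u.
Proof.
rewrite -(ler_pXn2r (n := 2)) ?nnegrE ?u2 // -natrX ler_nat; exact: leq_trans n2.
Qed.
Let wu : w ^+ 20 <= u.
Proof. by rewrite -(ler_pXn2r (n := 2)) ?nnegrE ?exprn_ge0 // u2 exprAC w2. Qed.
Let wuX m : (m <= 20)%N -> w ^+ m <= u.
Proof. by move=> hm; apply: le_trans wu; rewrite ler_weXn2l. Qed.
Let lu : l <= u. Proof. by rewrite -w2; exact: wuX. Qed.

Local Ltac size_lra := move: b2 u0 w0 w1 u100 l1; lra.

Let lower : R := 1 / 2 * log b n%:R - 3 / 2 * log b (log b n%:R).

Section Exponents.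
(** The integer part of l/2 - (3/2) log_b l is [k]. The other two provide h0 = k1+1, with b^h0 about
    sqrt n, and s = k2+1, with b^s about l sqrt n. *)
Variables (k k1 k2 : nat).
Hypothesis hk : b ^+ k <= u / w ^+ 3 < b ^+ k.+1.
Hypothesis hk1 : b ^+ k1 <= u < b ^+ k1.+1.
Hypothesis hk2 : b ^+ k2 <= u * w ^+ 2 < b ^+ k2.+1.

Let w3 : 0 < w ^+ 3. Proof. by rewrite exprn_gt0 //; size_lra. Qed.

Let kl : k%:R <= l.
Proof.
rewrite lE; apply: exponent_le_log b1 _; have /andP[h _] := hk.
apply: le_trans h _; rewrite -u2 expr2 ler_pdivrMr // -mulrA ler_peMr //.
by rewrite mulr_ege1 // ?exprn_ege1 //; size_lra.
Qed.

Let k2l : k2%:R <= l.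
Proof.
rewrite lE; apply: exponent_le_log b1 _; have /andP[h _] := hk2.
by apply: le_trans h _; rewrite -u2 [X in _ <= X]expr2 ler_wpM2l // wuX.
Qed.

Let lower_le : lower <= k.+1%:R.
Proof.
have /andP[_ h] := hk.
have u0' : 0 < u by size_lra.
have w0' : 0 < w by size_lra.
have h1 : ln (u / w ^+ 3) <= k.+1%:R * ln b.
  by rewrite mulr_natl -lnXn ?ler_ln ?posrE ?exprn_gt0 ?divr_gt0 //; [exact: ltW|size_lra|size_lra].
rewrite ln_div ?posrE ?exprn_gt0 // lnXn // in h1.
have hu : ln n%:R = 2 * ln u by rewrite -u2 lnXn // mulr_natl.
have hw : ln l = 2 * ln w by rewrite -w2 lnXn // mulr_natl.
rewrite /lower /log -lE -(ler_pM2r lb) hw lE hu; apply: le_trans h1.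
by rewrite le_eqVlt; apply/orP; left; apply/eqP; field; rewrite gt_eqF.
Qed.

(** Longer sides have expected frequency O(l^(-2)), small enough to lose a factor l in Markov's
    inequality. *)
Let L := (2 * k2.+1 + 3)%N.

Let kn : (k < n)%N.
Proof.
rewrite -(ltr_nat R); apply: le_lt_trans kl _; apply: le_lt_trans lu _.
by rewrite -u2 expr2 ltr_pMr; size_lra.
Qed.

(** By [mean_bound], the mean falls short of k+1 by at most (k+1) cost / n^3 <= 2 l cost / n^3 <=
    2. *)
Let small_cost (E : {set {set 'I_n}}) : E \in RG 'I_n d ->
  (cost d k L E)%:R * l <= n%:R ^+ 3 ->
  forall f, (forall x y z (p q r : seq 'I_n) (A B C : {set 'I_n}),
    geodesic E x p -> geodesic E y q -> geodesic E z r ->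
    last x p = y -> last y q = z -> last z r = x ->
    (size p <= L)%N -> (size q <= L)%N -> (size r <= L)%N ->
    A =i x :: p -> B =i y :: q -> C =i z :: r -> (f A B C <= k)%N ->
    forked E x y z p q r k L) ->
  lower - 2 <= triangle_mean R (adj E) f.
Proof.
move=> hE hc f hf.
have n0 : (0 < #|'I_n|)%N by rewrite card_ord; apply: leq_trans n2.
have := mean_bound R d3 hE hf n0; rewrite -[(3 * _ + _ + _)%N]/(cost d k L E) card_ord.
set M := triangle_mean _ _ _; rewrite (natrM _ (n ^ 3)) natrX (natrM _ k.+1).
set N : R := n%:R ^+ 3 in hc *; set c : R := (cost _ _ _ _)%:R in hc *.
move=> h; have N0 : 0 < N by rewrite exprn_gt0 // ltr0n; apply: leq_trans n2.
have k0 : 0 <= k.+1%:R :> R by rewrite ler0n.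
have kl' : k.+1%:R <= 2 * l by rewrite -addn1 natrD; move: kl l1; size_lra.
have : k.+1%:R * c <= 2 * N.
  apply: (@le_trans _ _ (2 * l * c)); first by rewrite ler_wpM2r // ler0n.
  by rewrite -mulrA ler_wpM2l // mulrC.
move=> h2; have : k.+1%:R - 2 <= M by rewrite -(ler_pM2l N0); size_lra.
by move: lower_le; size_lra.
Qed.

(** Markov's inequality at the level n^3 / l: the expected cost is O(n^3 l^(-3/2)), so the costly
    graphs have frequency O(l^(-1/2)). *)
Let few_costly :
  #|[set E in RG 'I_n d | n%:R ^+ 3 < (cost d k L E)%:R * l :> R]%SET|%:R <=
  deviation d%:R b / w * #|RG 'I_n d|%:R :> R.
Proof.
set bad := [set E in _ | _]%SET.
have n0 : 0 < n%:R ^+ 3 :> R by rewrite exprn_gt0 // ltr0n; apply: leq_trans n2.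
(* The bound on lengths is taken as n/4, so each of the three summands is at most n, and d >= 3. *)
have large : (#|'I_n| + 4 * (n %/ 4) + 4 * d * d.+1 <= #|'I_n| * d)%N.
  by rewrite card_ord; move: n1 d3; clear; nia.
have hL : (2 * k2.+1 + 3 + k < n %/ 4)%N.
  rewrite leq_divRL // -(ler_nat R) -u2 natrM -addn1 !natrD natrM -addn1 natrD.
  by move: kl k2l lu u100 l1; nra.
have h02 : (2 <= k1.+1)%N.
  rewrite ltnS lt0n; apply/eqP => k10; have /andP[_] := hk1.
  by rewrite k10 expr1 ltNge ub.
have /andP[hk11 hk12] := hk1; have /andP[hk21 hk22] := hk2; have /andP[hkk _] := hk.
have nh0 : (#|'I_n| <= d.-1 ^ (2 * k1.+1))%N.
  rewrite card_ord -(ler_nat R) natrX -bE -u2 mulnC exprM.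
  by rewrite lerXn2r ?nnegrE ?exprn_ge0 //; [size_lra|exact: ltW].
have := sum_cost R d3 large hL h02 nh0; rewrite card_ord -bE -/L -u2.
set G : R := #|RG 'I_n d|%:R; set CB := cost_bound _ _ _ _ _ _ _ _ => hsum.
have hCB : w ^+ 3 * CB <= deviation d%:R b * u ^+ 6.
  have b0 : 0 <= b by size_lra. 
  rewrite /CB; apply: cost_bound_le => //; rewrite ?ler0n ?exprn_ge0 //.
  - by rewrite -ler_pdivlMr.
  - exact: ltW.
  - by rewrite exprS -mulrA ler_wpM2l.
  - by rewrite exprS ler_wpM2l.
  - by rewrite w2 natrD natrM -addn1 natrD; move: k2l l1; size_lra.
  - by rewrite w2.
have hbad : #|bad|%:R * n%:R ^+ 3 <= l * (CB * G) :> R.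
  apply: (@le_trans _ _ (l * (\sum_(E in RG 'I_n d) cost d k L E)%:R)); last first.
    by rewrite ler_wpM2l //; size_lra.
  rewrite natr_sum mulr_sumr mulr_natl -sumr_const.
  apply: (@le_trans _ _ (\sum_(E in bad) l * (cost d k L E)%:R)).
    by apply: ler_sum => E; rewrite inE => /andP[_ /ltW]; rewrite mulrC.
  rewrite [X in _ <= X](bigID (mem bad)) /=.
  rewrite (eq_bigl (fun E => (E \in RG 'I_n d) && (E \in bad))); last first.
    by move=> E; rewrite [E \in bad]inE; case: (E \in RG 'I_n d).
  by rewrite lerDl; apply: sumr_ge0 => E _; rewrite mulr_ge0 //; size_lra.
have w0' : 0 < w by size_lra.
have u6 : n%:R ^+ 3 = u ^+ 6 by rewrite -u2 -exprM.
rewrite -(ler_pM2r n0) -(ler_pM2l w0').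
apply: (@le_trans _ _ (w ^+ 3 * CB * G)).
  rewrite (_ : w ^+ 3 * CB * G = w * (l * (CB * G))) ?ler_wpM2l //.
  by rewrite -w2; ring.
apply: le_trans (ler_wpM2r (ler0n R _) hCB) _; rewrite u6.
by rewrite le_eqVlt; apply/orP; left; apply/eqP; field; rewrite gt_eqF.
Qed.

Lemma RRG_prob_ge_aux : 1 - deviation d%:R b / w <=
  RRG_prob R d (fun E : {set {set 'I_n}} =>
    (lower - 2 <= mean_slim R E) && (lower - 2 <= mean_minsize R E)).
Proof.
rewrite /RRG_prob -[RRG n d]/(RG 'I_n d).
have G0 : 0 < #|RG 'I_n d|%:R :> R by rewrite ltr0n RG_gt0 // ltnW.
rewrite ler_pdivlMr // mulrBl mul1r lerBlDr.
apply: (@le_trans _ _ (#|[set E in RG 'I_n d | (lower - 2 <= mean_slim R E) &&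
   (lower - 2 <= mean_minsize R E)]%SET|%:R +
   #|[set E in RG 'I_n d | n%:R ^+ 3 < (cost d k L E)%:R * l :> R]%SET|%:R)); last first.
  by rewrite lerD2l few_costly.
rewrite -natrD ler_nat; apply: leq_trans (leq_card_setU _ _).1.
apply/subset_leq_card/fintype.subsetP => E hE; apply/finset.setUP.
have [hc|hc] := ltP (n%:R ^+ 3) ((cost d k L E)%:R * l).
  by right; rewrite finset.in_set hE.
left; rewrite finset.in_set hE /=; apply/andP; split; apply: (small_cost hE hc);
  move=> x y z p q r A B C gp gq gr lp lq lr sp sq sr hA hB hC.
  by apply: (slim_forked d3 hE gp gq gr lp lq lr sp sq sr hA hB hC); rewrite card_ord.
by apply: (minsize_forked d3 hE gp gq gr lp lq lr sp sq sr hA hB hC); rewrite card_ord.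
Qed.

End Exponents.

Lemma RRG_prob_ge : 1 - deviation d%:R b / w <=
  RRG_prob R d (fun E : {set {set 'I_n}} =>
    (lower - 2 <= mean_slim R E) && (lower - 2 <= mean_minsize R E)).
Proof.
have b1' : (1 < d.-1)%N by move: d3; clear; lia.
have w3 : 0 < w ^+ 3 by rewrite exprn_gt0 //; move: w1; lra.
have X : 1 <= u / w ^+ 3 by rewrite ler_pdivlMr // mul1r wuX.
have X1 : 1 <= u by move: u100; lra.
have X2 : 1 <= u * w ^+ 2 by rewrite mulr_ege1 // exprn_ege1.
have [k hk] := power_bracket b1' X; rewrite -bE in hk.
have [k1 hk1] := power_bracket b1' X1; rewrite -bE in hk1.
have [k2 hk2] := power_bracket b1' X2; rewrite -bE in hk2.
exact: RRG_prob_ge_aux hk hk1 hk2.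
Qed.

End LargeGraphs.

Theorem theorem5p3 (R : realType) (d : nat) (hd : (3 <= d)%N) :
  exists C : R, 0 < C /\
    RRG_whp R d (fun (n : nat) (E : {set {set 'I_n}}) =>
      let b : R := d%:R - 1 in
      let lower : R := 1 / 2 * log b n%:R - 3 / 2 * log b (log b n%:R) - C in
      (lower <= mean_slim R E) && (lower <= mean_minsize R E)).
Proof.
(* The shortfall from [small_cost]; [lower_le] has already absorbed the rounding of [k]. *)
exists 2; split; first by lra.
have db : d%:R - 1 = d.-1%:R :> R by rewrite -subn1 natrB //; lia.
rewrite /RRG_whp db; set b : R := d.-1%:R.
have b1 : 1 < b by rewrite /b (ltr_nat R 1); lia.
have lb : 0 < ln b by rewrite ln_gt0.
have [M0 hM0] := log_power_le b1.
have dev0 : 0 <= deviation d%:R b.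
  by rewrite /deviation !addr_ge0 ?mulr_ge0 ?exprn_ge0 ?ler0n ?addr_ge0 ?mulr_ge0 ?exprn_ge0 ?ler0n.
apply/cvgrPdist_le => eps eps0.
(* A lower bound for l that makes [log_power_le] applicable, gives l >= 1, and brings [deviation]
   divided by sqrt l down to [eps]. *)
pose M := Num.max (Num.max M0 1) ((deviation d%:R b / eps) ^+ 2).
have ln_large : exists N, forall n, (N <= n)%N -> M <= ln n%:R / ln b :> R.
  exists (Num.trunc (expR (M * ln b))).+1 => n hn.
  have le : expR (M * ln b) <= n%:R.
    apply: le_trans (ltW (truncnS_gt _)) _; by rewrite ler_nat.
  rewrite ler_pdivlMr // -[X in X <= _]expRK ler_ln ?posrE ?expR_gt0 //.
  exact: lt_le_trans (expR_gt0 _) le.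
have [N hN] := ln_large.
exists (maxn N (maxn d.+1 (maxn (4 * d * d.+1) (maxn 10000 (d.-1 ^ 2))))) => // n /=.
rewrite !geq_max => /andP[nN /andP[dn /andP[n1 /andP[n2 n3]]]] ev.
have := hN n nN; rewrite !ge_max => /andP[/andP[lM0 l1] leps].
have n0 : 0 < n%:R :> R by rewrite ltr0n; apply: leq_trans n2.
have n3' : b ^+ 2 <= n%:R by rewrite -natrX ler_nat.
have := RRG_prob_ge hd erefl erefl erefl erefl dn ev n1 n2 n3' l1 (hM0 _ n0 lM0).
set l := ln n%:R / ln b in l1 leps *.
have sl : 0 < Num.sqrt l by rewrite sqrtr_gt0; lra.
have le_eps : deviation d%:R b / Num.sqrt l <= eps.
  rewrite ler_pdivrMr // mulrC -ler_pdivrMr //.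
  by rewrite -(ler_pXn2r (n := 2)) ?nnegrE ?divr_ge0 ?sqrtr_ge0 ?(ltW eps0) // sqr_sqrtr //; lra.
set p := RRG_prob _ _ _ => hp.
have p1 : p <= 1.
  rewrite /p /RRG_prob ler_pdivrMr ?mul1r ?ler_nat; last first.
    by rewrite ltr0n; apply: (RG_gt0 _ dn ev); exact: ltnW.
  by apply/subset_leq_card/fintype.subsetP => E; rewrite inE => /andP[].
by rewrite ger0_norm; lra.
Qed.
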